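(* Let $V\in\mathcal{C}^\infty(\mathbb{T}^2,\mathbb{R})$ and let $(\varepsilon_\hbar)_{0<\hbar\le 1}$ be positive numbers with $\hbar^2\ll\varepsilon_\hbar\ll\hbar$, i.e. $\varepsilon_\hbar/\hbar^2\to+\infty$ and $\varepsilon_\hbar/\hbar\to0$ as $\hbar\to0^+$. Let $(\psi_\hbar)_{\hbar\to0^+}$ be a family of functions in $L^2(\mathbb{T}^2)$ with $\|\psi_\hbar\|_{L^2}=1$ satisfying $$\lim_{\delta\to0^+}\limsup_{\hbar\to0^+}\|\mathbf{1}_{[0,\delta]}(-\hbar^2\Delta)\psi_\hbar\|_{L^2}=0,\qquad \lim_{R\to+\infty}\limsup_{\hbar\to0^+}\|\mathbf{1}_{[R,+\infty[}(-\hbar^2\Delta)\psi_\hbar\|_{L^2}=0.$$ Assume that for every $\Lambda\in\mathcal{L}_1$ there is a finite positive Radon measure $\mathbf{F}^0_\Lambda$ on $\mathbb{T}^2\times\mathbb{R}$ such that for every $a\in\mathcal{C}^\infty_c(\mathbb{T}^2\times\mathbb{R})$, $$\lim_{\hbar\to0^+}\Big\langle\psi_\hbar,\operatorname{Op}_\hbar\Big(\mathcal{I}_\Lambda(a)\Big(x,\tfrac{\hbar H_\Lambda(\xi)}{\varepsilon_\hbar}\Big)\Big)\psi_\hbar\Big\rangle=\int_{\mathbb{T}^2\times\mathbb{R}}a\,d\mathbf{F}^0_\Lambda .$$ Let $u_\hbar(t)$ solve $i\hbar\partial_t u_\hbar=-\frac{\hbar^2}{2}\Delta u_\hbar$, $u_\hbar(0)=\psi_\hbar$,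 and $u^\varepsilon_\hbar(t)$ solve $i\hbar\partial_t u^\varepsilon_\hbar=-\frac{\hbar^2}{2}\Delta u^\varepsilon_\hbar+\varepsilon_\hbar V u^\varepsilon_\hbar$, $u^\varepsilon_\hbar(0)=\psi_\hbar$, and set $\tau^c_\hbar=\hbar/\varepsilon_\hbar$. Then for every $t\in\mathbb{R}$, $$\lim_{\hbar\to0^+}\langle u^\varepsilon_\hbar(t\tau^c_\hbar),u_\hbar(t\tau^c_\hbar)\rangle=e^{it\int_{\mathbb{T}^2}V}\Big(1-\sum_{\Lambda\in\mathcal{L}_1}\mathbf{F}^0_\Lambda(\mathbb{T}^2\times\mathbb{R})\Big)+\sum_{\Lambda\in\mathcal{L}_1}\int_{\mathbb{T}^2\times\mathbb{R}}e^{i\int_0^t\mathcal{I}_\Lambda(V)\left(x+s\frac{\eta\vec v_\Lambda}{L_\Lambda}\right)ds}\,\mathbf{F}^0_\Lambda(dx,d\eta).$$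
   Context: $\mathbb{T}^2=\mathbb{R}^2/\mathbb{Z}^2$ with Lebesgue measure; $\langle u,v\rangle=\int_{\mathbb{T}^2}\overline{u}v\,dx$; $e_k(x)=e^{2i\pi k\cdot x}$ for $k\in\mathbb{Z}^2$. For a smooth symbol $a(x,\xi)$, $\mathbb{Z}^2$-periodic in $x$ with bounded derivatives, the standard quantization $\operatorname{Op}_\hbar(a)$ acts on $L^2(\mathbb{T}^2)$ by $\operatorname{Op}_\hbar(a)e_k=a(x,2\pi\hbar k)e_k$ (equivalently $\operatorname{Op}_\hbar(a)u(x)=(2\pi\hbar)^{-2}\iint e^{\frac{i}{\hbar}\langle x-y,\xi\rangle}a(x,\xi)u(y)\,dy\,d\xi$). $\mathcal{L}_1$ is the set of primitive rank-one sublattices $\Lambda$ of $\mathbb{Z}^2$ (i.e. $\Lambda=\mathbb{Z}\vec v_\Lambda$ with $\mathbb{R}\vec v_\Lambda\cap\mathbb{Z}^2=\Lambda$); for each such $\Lambda$ a generator $\vec v_\Lambda$ is fixed, $\vec v_\Lambda^\perp$ is $\vec v_\Lambda$ rotated by $+\pi/2$, $L_\Lambda=\|\vec v_\Lambda\|$, $H_\Lambda(\xi)=\langle\xi,\vec v_\Lambda\rangle/L_\Lambda$. For a function $b$ of $x$ (possibly depending on extra variables), $\mathcal{I}_\Lambda(b)(x,\cdot)=\frac{1}{L_\Lambda}\int_0^{L_\Lambda}b\big(x+t\vec v_\Lambda^\perp/L_\Lambda,\cdot\big)dt$. *)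

(* Defs.v *)
From Stdlib Require Import Reals ZArith.
From mathcomp Require Import all_boot all_algebra.
From mathcomp Require Import all_classical all_reals all_analysis.
From mathcomp Require Import Rstruct Rstruct_topology.
From Coquelicot Require Import Coquelicot.

Set Implicit Arguments.
Unset Strict Implicit.

Open Scope R_scope.

Definition Z2 := (Z * Z)%type.

Definition Z2sub (j k : Z2) : Z2 := (Z.sub j.1 k.1, Z.sub j.2 k.2).

Definition knorm2 (k : Z2) : R := IZR k.1 ^ 2 + IZR k.2 ^ 2.

Definition ofsq (N i : nat) : Z := Z.sub (Z.of_nat i) (Z.of_nat N).

Definition sqsumC (f : Z2 -> C) (N : nat) : C :=
  sum_n (fun i => sum_n (fun j => f (ofsq N i, ofsq N j)) (N + N)%nat) (N + N)%nat.
Definition sqsumR (f : Z2 -> R) (N : nat) : R :=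
  sum_n (fun i => sum_n (fun j => f (ofsq N i, ofsq N j)) (N + N)%nat) (N + N)%nat.

(* sum over Z^2 (limit of the square partial sums; all the sums used below
   are absolutely convergent, so this is the usual sum) *)
Definition zsumC (f : Z2 -> C) : C :=
  (real (Lim_seq (fun N => Re (sqsumC f N))), real (Lim_seq (fun N => Im (sqsumC f N)))).

(** * L^2(T^2), represented by Fourier coefficients in l^2(Z^2):
    psi = sum_k psi_k e_k, e_k(x) = exp(2 i pi k.x) *)

Definition is_l2 (psi : Z2 -> C) : Prop :=
  ex_finite_lim_seq (sqsumR (fun k => Cmod (psi k) ^ 2)).

Definition nrm2 (psi : Z2 -> C) : R :=
  real (Lim_seq (sqsumR (fun k => Cmod (psi k) ^ 2))).

Definition ip (u w : Z2 -> C) : C := zsumC (fun k => (Cconj (u k) * w k)%C).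

Definition cis (th : R) : C := (Rtrigo_def.cos th, Rtrigo_def.sin th).

Definition periodic2 (f : R -> R -> R) : Prop :=
  forall x y, f (x + 1) y = f x y /\ f x (y + 1) = f x y.

Fixpoint dR2 (ds : list bool) (f : R -> R -> R) : R -> R -> R :=
  match ds with
  | nil => f
  | b :: ds' =>
      let g := dR2 ds' f in
      if b then (fun x y => Derive (fun s => g s y) x)
      else (fun x y => Derive (fun s => g x s) y)
  end.

Definition smooth2 (f : R -> R -> R) : Prop :=
  forall ds : list bool,
    (forall x y, ex_derive (fun s => dR2 ds f s y) x /\ ex_derive (fun s => dR2 ds f x s) y)
    /\ (forall x y, continuous (fun p : R * R => dR2 ds f p.1 p.2) (x, y)).

Fixpoint dR3 (ds : list nat) (f : R -> R -> R -> R) : R -> R -> R -> R :=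
  match ds with
  | nil => f
  | d :: ds' =>
      let g := dR3 ds' f in
      match d with
      | O => fun x y e => Derive (fun s => g s y e) x
      | S O => fun x y e => Derive (fun s => g x s e) y
      | _ => fun x y e => Derive (fun s => g x y s) e
      end
  end.

Definition smooth3 (f : R -> R -> R -> R) : Prop :=
  forall ds : list nat,
    (forall x y e, ex_derive (fun s => dR3 ds f s y e) x /\
                   ex_derive (fun s => dR3 ds f x s e) y /\
                   ex_derive (fun s => dR3 ds f x y s) e)
    /\ (forall x y e, continuous (fun p : R * R * R => dR3 ds f p.1.1 p.1.2 p.2) (x, y, e)).

Definition test_symbol (a : R -> R -> R -> R) : Prop :=
  smooth3 a
  /\ (forall x y e, a (x + 1) y e = a x y e /\ a x (y + 1) e = a x y e)
  /\ (exists M, forall x y e, M < Rabs e -> a x y e = 0).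

Definition fourier2 (g : R -> R -> R) (m : Z2) : C :=
  (RInt (fun x => RInt (fun y => g x y * Rtrigo_def.cos (2 * PI * (IZR m.1 * x + IZR m.2 * y))) 0 1) 0 1,
   - RInt (fun x => RInt (fun y => g x y * Rtrigo_def.sin (2 * PI * (IZR m.1 * x + IZR m.2 * y))) 0 1) 0 1).

Definition torus_int (g : R -> R -> R) : R :=
  RInt (fun x => RInt (fun y => g x y) 0 1) 0 1.

(** * Primitive rank-one sublattices.
    Each Lambda in L_1 is Z v for exactly one primitive v = (p,q) with
    gcd(p,q) = 1 and (p > 0 or (p,q) = (0,1)); this v is the fixed generator. *)

Definition prim (v : Z2) : bool :=
  Z.eqb (Z.gcd v.1 v.2) Z.one &&
  (Z.ltb Z.zero v.1 || (Z.eqb v.1 Z.zero && Z.eqb v.2 Z.one)).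

Definition Lv (v : Z2) : R := sqrt (knorm2 v).

Definition avgI (v : Z2) (b : R -> R -> R) (x y : R) : R :=
  / Lv v * RInt (fun t => b (x - t * IZR v.2 / Lv v) (y + t * IZR v.1 / Lv v)) 0 (Lv v).

Definition HL (v : Z2) (xi1 xi2 : R) : R := (xi1 * IZR v.1 + xi2 * IZR v.2) / Lv v.

(** * The quadratic form <psi, Op_h(b) psi> for the symbol
      b(x, xi) = I_Lambda(a)(x, h H_Lambda(xi) / eps).
    Op_h(b) e_k = b(., 2 pi h k) e_k, hence
    <e_j, Op_h(b) psi> = sum_k psi_k bhat_k(j - k), with
    bhat_k = Fourier coefficients of x |-> b(x, 2 pi h k). *)

Definition symb_at (h eps : R) (v : Z2) (a : R -> R -> R -> R) (k : Z2) : R -> R -> R :=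
  avgI v (fun x y => a x y (h * HL v (2 * PI * h * IZR k.1) (2 * PI * h * IZR k.2) / eps)).

Definition op_quad (h eps : R) (v : Z2) (a : R -> R -> R -> R) (psi : Z2 -> C) : C :=
  zsumC (fun j => (Cconj (psi j) *
     zsumC (fun k => (psi k * fourier2 (symb_at h eps v a k) (Z2sub j k))%C))%C).

(** * Schrodinger evolution  i h d_t u = - h^2/2 Delta u + W u,  u(0) = psi,
    as a continuous curve in L^2 satisfying the equation mode by mode.
    (- h^2/2 Delta e_k = 2 pi^2 h^2 |k|^2 e_k, and (W u)_k = sum_j What(k-j) u_j.) *)

Definition mIoh (h : R) : C := (0, - / h).

Definition SchrSol (h : R) (W : R -> R -> R) (psi : Z2 -> C) (u : R -> Z2 -> C) : Prop :=
  u 0 = psi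
  /\ (forall t, is_l2 (u t))
  /\ (forall t, filterlim (fun s => nrm2 (fun k => (u s k - u t k)%C)) (locally t) (locally 0))
  /\ (forall t k,
        is_derive (fun s => u s k) t
          (mIoh h *
           (RtoC (2 * PI ^ 2 * h ^ 2 * knorm2 k) * u t k
            + zsumC (fun j => (fourier2 W (Z2sub k j) * u t j)%C)))%C).

(** * Finite positive Borel (= Radon) measures on T^2 x R, represented as
    finite measures on R^2 x R carried by the fundamental domain [0,1)^2 x R. *)

Definition RM := measurableTypeR R.
Definition PT := (RM * RM * RM)%type.

Section Meas.
Local Open Scope classical_set_scope.
Local Open Scope ereal_scope.

Definition torus_measure (F : measure PT R) : Prop :=
  F setT < +oo
  /\ F [set z : PT | ~ (Rle R0 z.1.1 /\ Rlt z.1.1 R1 /\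
                       Rle R0 z.1.2 /\ Rlt z.1.2 R1)] = 0%E.

Definition mint (F : measure PT R) (f : R -> R -> R -> R) : R :=
  fine (\int[F]_z (f z.1.1 z.1.2 z.2)%:E).

Definition mass (F : measure PT R) : R := fine (F setT).
End Meas.

(* Main.v *)
(* In the interaction picture the overlap equals <w(t), psi>, where the Fourier
   coefficients of w solve a linear system whose coupling k <-> k + m carries the phase
   exp(2 i theta (k.m) s), with theta = 2 pi^2 h^2 / eps -> 0.  Truncating V to finitely many modes
   and expanding in a Dyson series, the overlap becomes, up to small errors, a finite sum over words
   w = m_1 ... m_n of coef(w) <psi, Op(I_w) psi>, I_w being an iterated oscillatory integral with
   the frequencies 2 theta k.m_i.
   - If w contains two non-parallel modes, then |h k| >= delta forces one frequency to be at least
     c h / eps -> oo, and integration by parts kills the word.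
   - If all the modes of w are multiples of one primitive v, then I_w is a function of
     h H_v / eps only and the word converges to an integral against F_v.
   - The words of zero modes give (t^n / n!) (i Vhat(0))^n.
   On the limit side, the words along v sum up to the exponential of the time integral of the average
   of V, by uniform convergence of its Fourier series; the zero words are counted once for every v,
   whence the factor 1 - sum_v F_v(1).  The same geometric remark on non-parallel modes gives
   sum_v F_v(1) <= 1. *)

From HB Require Import structures.
Require Import Defs.
From Stdlib Require Import Reals ZArith Lra Lia Psatz.
From mathcomp Require Import all_boot all_algebra ssrZ zify.
From mathcomp Require Import all_classical all_reals all_analysis.
From mathcomp Require Import Rstruct Rstruct_topology.
From Coquelicot Require Import Coquelicot.
Open Scope R_scope.
(* The key [%R] denotes the generic ring scope of the algebra library, so real and integer
   expressions are marked with [%Re] and [%ZZ]. *)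
Delimit Scope R_scope with Re.
Delimit Scope Z_scope with ZZ.
Set Implicit Arguments.
Unset Strict Implicit.
Unset Printing Implicit Defensive.

(** The two scale conditions do different work. As eps/h^2 -> oo, theta -> 0, so the frequency met
    after the earlier letters of a word have shifted k may be frozen at k; each word becomes a
    multiplier in k followed by one translation. As eps/h -> 0, two non-parallel directions cannot
    both be slow. Both rates depend on the word, so the truncation N is fixed before h -> 0. The
    equation holds mode by mode only. The expansion is therefore run on finite sets of modes against
    arbitrary weights, with bounds uniform in the set; the same estimate, tested against the
    solution itself, yields the norm bound that it requires. The measures F_v are reached only
    through real symbols with compact support in eta. A word with a nonzero letter decays in eta, so
    a cut-off loses little. A zero word does not decay: the part of the mass of psi that escapes to
    |eta| = oo for every v is invisible to all F_v, and its weight is 1 - sum_v F_v(1). *)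

HB.instance Definition _ := Monoid.isComLaw.Build C (RtoC 0) Cplus Cplus_assoc Cplus_comm Cplus_0_l.

Notation "\sumC_ ( i <- r ) F" := (\big[Cplus/RtoC 0]_(i <- r) F%C)
  (at level 41, F at level 41, i, r at level 50).
Notation "\sumR_ ( i <- r ) F" := (\big[Rplus/0]_(i <- r) F%Re)
  (at level 41, F at level 41, i, r at level 50).

(** * Finite sums over lists *)

Section FiniteSums.
Context {T : Type}.
Implicit Types (l : seq T).

Lemma csum_scal_l (c : C) l (f : T -> C) :
  (c * \sumC_(k <- l) f k)%C = \sumC_(k <- l) (c * f k).
Proof. elim: l => [|x l IH]; [rewrite !big_nil; ring | rewrite !big_cons -IH; ring]. Qed.

Lemma rsum_scal_l (c : R) l (f : T -> R) :
  c * (\sumR_(k <- l) f k) = \sumR_(k <- l) (c * f k).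
Proof. elim: l => [|x l IH]; [rewrite !big_nil; ring | rewrite !big_cons -IH; ring]. Qed.

Lemma Cmod_csum l (f : T -> C) :
  Cmod (\sumC_(k <- l) f k) <= \sumR_(k <- l) Cmod (f k).
Proof.
elim: l => [|x l IH]; first by rewrite !big_nil Cmod_0; lra.
rewrite !big_cons; apply: Rle_trans (Cmod_triangle _ _) _; lra.
Qed.

Lemma rsum_le l (f g : T -> R) :
  (forall k, f k <= g k) -> \sumR_(k <- l) f k <= \sumR_(k <- l) g k.
Proof.
move=> H; elim: l => [|x l IH]; first by rewrite !big_nil; lra.
rewrite !big_cons; have := H x; lra.
Qed.

Lemma rsum_ge0 l (f : T -> R) : (forall k, 0 <= f k) -> 0 <= \sumR_(k <- l) f k.
Proof.
move=> H; elim: l => [|x l IH]; first by rewrite big_nil; lra.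
rewrite big_cons; have := H x; lra.
Qed.

Lemma csum_conj l (f : T -> C) :
  Cconj (\sumC_(k <- l) f k) = \sumC_(k <- l) Cconj (f k).
Proof.
elim: l => [|x l IH].
  by rewrite !big_nil /Cconj /=; apply: injective_projections => /=; ring.
by rewrite !big_cons -IH; apply: injective_projections => /=; ring.
Qed.

Lemma Re_csum l (f : T -> C) : Re (\sumC_(k <- l) f k) = \sumR_(k <- l) Re (f k).
Proof. by elim: l => [|x l IH]; rewrite ?big_nil // !big_cons -IH. Qed.

Lemma RtoC_rsum l (f : T -> R) : RtoC (\sumR_(k <- l) f k) = \sumC_(k <- l) RtoC (f k).
Proof.
elim: l => [|x l IH]; rewrite ?big_nil // !big_cons -IH.
by apply: injective_projections => /=; ring.
Qed.

(** Induction on the list: the step is the planar inequality for ([a x], sqrt A) and ([b x], sqrt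
    B), that is, the positivity of ([a x] sqrt B - [b x] sqrt A)^2. *)
Lemma rsum_CauchySchwarz l (a b : T -> R) :
  (forall k, 0 <= a k) -> (forall k, 0 <= b k) ->
  \sumR_(k <- l) (a k * b k) <=
    sqrt (\sumR_(k <- l) (a k ^ 2)) * sqrt (\sumR_(k <- l) (b k ^ 2)).
Proof.
move=> Ha Hb; elim: l => [|x l IH]; first by rewrite !big_nil sqrt_0; lra.
rewrite !big_cons.
set A := \big[Rplus/0]_(j <- l) (a j ^ 2); set B := \big[Rplus/0]_(j <- l) (b j ^ 2).
have HA : 0 <= A by apply: rsum_ge0 => k; apply: pow2_ge_0.
have HB : 0 <= B by apply: rsum_ge0 => k; apply: pow2_ge_0.
rewrite -/A -/B in IH.
apply: (Rle_trans _ (a x * b x + sqrt A * sqrt B)); first by lra.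
have ax := Ha x; have bx := Hb x.
have sA := sqrt_pos A; have sB := sqrt_pos B.
rewrite -(sqrt_mult (a x ^ 2 + A)); [|nra|nra].
rewrite -[X in X <= _]sqrt_Rsqr; last by nra.
apply: sqrt_le_1_alt; rewrite /Rsqr.
have EA := sqrt_sqrt A HA; have EB := sqrt_sqrt B HB.
have : 0 <= (a x * sqrt B - b x * sqrt A) ^ 2 by apply: pow2_ge_0.
move: EA EB; set p := sqrt A; set q := sqrt B => <- <-; nra.
Qed.
End FiniteSums.

Lemma rsum_subset (T : eqType) (l1 l2 : seq T) (f : T -> R) :
  (forall k, 0 <= f k) -> uniq l1 -> {subset l1 <= l2} ->
  \sumR_(k <- l1) f k <= \sumR_(k <- l2) f k.
Proof.
move=> f0; elim: l1 l2 => [|x l1 IH] l2 /= Hu Hs.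
  by rewrite big_nil; apply: rsum_ge0.
case/andP: Hu => xl1 u1.
have xl2 : x \in l2 by apply: Hs; rewrite inE eqxx.
rewrite (perm_big _ (perm_to_rem xl2)) /= !big_cons.
apply: Rplus_le_compat_l; apply: IH => // y yl1.
have : y \in l2 by apply: Hs; rewrite inE yl1 orbT.
rewrite (perm_mem (perm_to_rem xl2)) inE => /orP[/eqP E|//].
by rewrite -E yl1 in xl1.
Qed.

Lemma csum_subset_diff (T : eqType) (l1 l2 : seq T) (f : T -> C) :
  uniq l1 -> uniq l2 -> {subset l1 <= l2} ->
  \sumC_(k <- l2) f k =
  (\sumC_(k <- l1) f k + \sumC_(k <- [seq k <- l2 | k \notin l1]) f k)%C.
Proof.
move=> u1 u2 Hs; rewrite -big_cat; apply: perm_big; apply: uniq_perm => //.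
  rewrite cat_uniq u1 filter_uniq // andbT /=.
  by apply/hasPn => x; rewrite mem_filter => /andP[].
move=> x; rewrite mem_cat mem_filter.
by case E: (x \in l1) => //=; apply: Hs.
Qed.

Lemma rsum_subset_diff (T : eqType) (l1 l2 : seq T) (f : T -> R) :
  uniq l1 -> uniq l2 -> {subset l1 <= l2} ->
  \sumR_(k <- l2) f k =
  \sumR_(k <- l1) f k + \sumR_(k <- [seq k <- l2 | k \notin l1]) f k.
Proof.
move=> u1 u2 Hs; rewrite -big_cat; apply: perm_big; apply: uniq_perm => //.
  rewrite cat_uniq u1 filter_uniq // andbT /=.
  by apply/hasPn => x; rewrite mem_filter => /andP[].
move=> x; rewrite mem_cat mem_filter.
by case E: (x \in l1) => //=; apply: Hs.
Qed.

(** * Square boxes of Z^2 *)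

Definition zrange (N : nat) : seq Z := [seq ofsq N i | i <- seq.iota 0 (N + N).+1].
Definition box (N : nat) : seq Z2 := [seq (x, y) | x <- zrange N, y <- zrange N].

Lemma mem_zrange N x : (x \in zrange N) <-> (- Z.of_nat N <= x <= Z.of_nat N)%ZZ.
Proof.
split.
  by case/mapP => i; rewrite mem_iota /ofsq => /andP[_ Hi] ->; lia.
move=> H; apply/mapP; exists (Z.to_nat (x + Z.of_nat N)); last by rewrite /ofsq; lia.
by rewrite mem_iota; lia.
Qed.

Lemma zrange_uniq N : uniq (zrange N).
Proof. by rewrite map_inj_uniq ?iota_uniq // => i j; rewrite /ofsq; lia. Qed.

Lemma mem_box N (k : Z2) : (k \in box N) <->
  (- Z.of_nat N <= k.1 <= Z.of_nat N)%ZZ /\ (- Z.of_nat N <= k.2 <= Z.of_nat N)%ZZ.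
Proof.
split.
  by case/allpairsP => [[a b] /= [/mem_zrange Ha /mem_zrange Hb ->]].
case: k => a b /= [Ha Hb]; apply/allpairsP; exists (a, b) => /=.
by split; [apply/mem_zrange|apply/mem_zrange|].
Qed.

Lemma box_uniq N : uniq (box N).
Proof. by apply: allpairs_uniq; rewrite ?zrange_uniq // => -[a b] [c d] _ _ /= [-> ->]. Qed.

Lemma box_subset N N' : (N <= N')%N -> {subset box N <= box N'}.
Proof. by move=> H k /mem_box Hk; apply/mem_box; lia. Qed.

Lemma subset_box (l : seq Z2) : exists N, {subset l <= box N}.
Proof.
elim: l => [|k l [N IH]]; first by exists 0%N.
exists (maxn N (maxn (Z.to_nat (Z.abs k.1)) (Z.to_nat (Z.abs k.2)))) => x.
rewrite inE => /orP[/eqP ->|/IH Hx]; first by apply/mem_box; lia.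
by apply: box_subset Hx; lia.
Qed.

Lemma sum_n_bigC (f : nat -> C) n : sum_n f n = \sumC_(i <- seq.iota 0 n.+1) f i.
Proof.
elim: n => [|n IH]; first by rewrite sum_O /= big_cons big_nil Cplus_0_r.
by rewrite sum_Sn IH -(addn1 n.+1) iotaD big_cat /= add0n big_seq1.
Qed.

Lemma sum_n_bigR (f : nat -> R) n : sum_n f n = \sumR_(i <- seq.iota 0 n.+1) f i.
Proof.
elim: n => [|n IH]; first by rewrite sum_O /= big_cons big_nil Rplus_0_r.
by rewrite sum_Sn IH -(addn1 n.+1) iotaD big_cat /= add0n big_seq1.
Qed.

Lemma sqsumCE (f : Z2 -> C) N : sqsumC f N = \sumC_(k <- box N) f k.
Proof.
rewrite /sqsumC sum_n_bigC /box big_allpairs big_map; apply: eq_bigr => i _.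
by rewrite sum_n_bigC big_map.
Qed.

Lemma sqsumRE (f : Z2 -> R) N : sqsumR f N = \sumR_(k <- box N) f k.
Proof.
rewrite /sqsumR sum_n_bigR /box big_allpairs big_map; apply: eq_bigr => i _.
by rewrite sum_n_bigR big_map.
Qed.

(** * Complex limits and unconditional sums *)

Lemma ReB (a b : C) : Re (a - b)%C = Re a - Re b.
Proof. by []. Qed.

Lemma ImB (a b : C) : Im (a - b)%C = Im a - Im b.
Proof. by []. Qed.

Lemma Cmod_le_abs (z : C) : Cmod z <= Rabs (Re z) + Rabs (Im z).
Proof.
rewrite /Cmod /Re /Im.
have a0 := Rabs_pos z.1; have b0 := Rabs_pos z.2.
rewrite -[X in _ <= X]sqrt_Rsqr; last by lra.
apply: sqrt_le_1_alt; rewrite /Rsqr -(pow2_abs z.1) -(pow2_abs z.2); nra.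
Qed.

Lemma Rabs_Re_le (z : C) : Rabs (Re z) <= Cmod z.
Proof. exact: Rle_trans (Rmax_l _ _) (Rmax_Cmod z). Qed.

Lemma Rabs_Im_le (z : C) : Rabs (Im z) <= Cmod z.
Proof. exact: Rle_trans (Rmax_r _ _) (Rmax_Cmod z). Qed.

(** Neighbourhoods in [C] are those of the product R x R; all later estimates are in modulus, and
    this is the bridge between the two. *)
Lemma filterlim_CmodP (T : Type) (F : (T -> Prop) -> Prop) {FF : Filter F} (f : T -> C) (l : C) :
  filterlim f F (locally l) <-> (forall e, 0 < e -> F (fun x => Cmod (f x - l)%C < e)).
Proof.
split.
  move=> /filterlim_locally H e e0.
  have e20 : 0 < e / 2 by lra.
  apply: filter_imp (H (mkposreal _ e20)) => x [/= H1 H2].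
  apply: Rle_lt_trans (Cmod_le_abs _) _.
  move: H1 H2; rewrite /ball /= /AbsRing_ball /abs /minus /plus /opp /=.
  rewrite /Re /Im /Cminus /Cplus /Copp /=; lra.
move=> H; apply/filterlim_locally => e.
apply: filter_imp (H e (cond_pos e)) => x Hx.
split; rewrite /ball /= /AbsRing_ball /abs /minus /plus /opp /=.
  by have := Rabs_Re_le (f x - l)%C; rewrite ReB /Re /Rminus; lra.
by have := Rabs_Im_le (f x - l)%C; rewrite ImB /Im /Rminus; lra.
Qed.

Lemma eventually_CmodP (u : nat -> C) (l : C) :
  (forall e, 0 < e -> exists N, forall n, (N <= n)%N -> Cmod (u n - l)%C <= e) ->
  filterlim u eventually (locally l).
Proof.
move=> H; apply/filterlim_CmodP => e e0.
have [|N HN] := H (e / 2); first lra.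
exists N => n Hn; have := HN n; have -> : (N <= n)%N by lia.
by move=> /(_ isT); lra.
Qed.

Lemma Re_lim (u : nat -> C) (l : C) :
  filterlim u eventually (locally l) -> is_lim_seq (fun n => Re (u n)) (Re l).
Proof.
move=> /filterlim_CmodP H; apply/is_lim_seq_spec => e.
apply: filter_imp (H e (cond_pos e)) => n Hn.
by have := Rabs_Re_le (u n - l)%C; rewrite ReB; lra.
Qed.

Lemma Im_lim (u : nat -> C) (l : C) :
  filterlim u eventually (locally l) -> is_lim_seq (fun n => Im (u n)) (Im l).
Proof.
move=> /filterlim_CmodP H; apply/is_lim_seq_spec => e.
apply: filter_imp (H e (cond_pos e)) => n Hn.
by have := Rabs_Im_le (u n - l)%C; rewrite ImB; lra.
Qed.

(* Unconditional convergence along finite subsets of Z^2; unlike the square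
   partial sums it is invariant under translations of the index. *)
Definition usum (f : Z2 -> C) (l : C) : Prop :=
  forall e, 0 < e -> exists N, forall L, uniq L -> {subset box N <= L} ->
    Cmod (\sumC_(k <- L) f k - l)%C <= e.

Lemma usum_sqsum f l : usum f l -> filterlim (sqsumC f) eventually (locally l).
Proof.
move=> H; apply: eventually_CmodP => e e0; have [N HN] := H e e0.
exists N => n Hn; rewrite sqsumCE; apply: HN; [exact: box_uniq | exact: box_subset].
Qed.

Lemma usum_zsumC f l : usum f l -> zsumC f = l.
Proof.
move=> /usum_sqsum H; rewrite /zsumC.
rewrite (is_lim_seq_unique _ _ (Re_lim H)) (is_lim_seq_unique _ _ (Im_lim H)) /=.
by case: l {H}.
Qed.

Lemma usum_unique f l l' : usum f l -> usum f l' -> l = l'.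
Proof. by move=> /usum_zsumC <- /usum_zsumC <-. Qed.

Lemma usum_ext f g l : (forall k, f k = g k) -> usum f l -> usum g l.
Proof.
move=> E H e e0; have [N HN] := H e e0; exists N => L u s.
by rewrite -(eq_bigr _ (fun k _ => E k)); apply: HN.
Qed.

Lemma usum_plus f g l m : usum f l -> usum g m -> usum (fun k => f k + g k)%C (l + m)%C.
Proof.
move=> Hf Hg e e0.
have e2 : 0 < e / 2 by lra.
have [N1 H1] := Hf _ e2; have [N2 H2] := Hg _ e2.
exists (maxn N1 N2) => L u s; rewrite big_split /=.
set A := \big[_/_]_(_ <- _) _; set B := \big[_/_]_(_ <- _) _.
have -> : (A + B - (l + m) = (A - l) + (B - m))%C by ring.
apply: Rle_trans (Cmod_triangle _ _) _.
have := H1 L u; have := H2 L u; rewrite -/A -/B => HB HA.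
have : Cmod (A - l) <= e / 2 by apply: HA => x Hx; apply: s; apply: box_subset Hx; lia.
have : Cmod (B - m) <= e / 2 by apply: HB => x Hx; apply: s; apply: box_subset Hx; lia.
by lra.
Qed.

Lemma usum_scal c f l : usum f l -> usum (fun k => c * f k)%C (c * l)%C.
Proof.
move=> Hf e e0; have c0 := Cmod_ge_0 c.
have e2 : 0 < e / (1 + Cmod c) by apply: Rdiv_lt_0_compat; lra.
have [N H] := Hf _ e2; exists N => L u s; rewrite -csum_scal_l.
set A := \big[_/_]_(_ <- _) _; have -> : (c * A - c * l = c * (A - l))%C by ring.
rewrite Cmod_mult; apply: (Rle_trans _ (Cmod c * (e / (1 + Cmod c)))).
  by apply: Rmult_le_compat_l => //; apply: H.
have -> : e = (1 + Cmod c) * (e / (1 + Cmod c)) by field; lra.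
have -> : (1 + Cmod c) * (e / (1 + Cmod c)) / (1 + Cmod c) = e / (1 + Cmod c) by field; lra.
nra.
Qed.

Lemma usum_finite f (L0 : seq Z2) :
  uniq L0 -> (forall k, k \notin L0 -> f k = RtoC 0) -> usum f (\sumC_(k <- L0) f k).
Proof.
move=> u0 H e e0; have [N HN] := subset_box L0; exists N => L u s.
rewrite (@csum_subset_diff _ L0 L) //; last by move=> x /HN; apply: s.
rewrite [X in (_ + X)%C]big1_seq; last by move=> k; rewrite mem_filter => /andP[_ /andP[/H]].
have -> : forall z : C, (z + 0 - z = 0)%C by move=> z; ring.
by rewrite Cmod_0; lra.
Qed.

Lemma usum_0 : usum (fun _ => RtoC 0) (RtoC 0).
Proof. by have := @usum_finite (fun _ => RtoC 0) [::] isT (fun _ _ => erefl); rewrite big_nil. Qed.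

Lemma usum_big (I : Type) (s : seq I) (F : I -> Z2 -> C) (l : I -> C) :
  (forall i, usum (F i) (l i)) ->
  usum (fun k => \sumC_(i <- s) F i k) (\sumC_(i <- s) l i).
Proof.
move=> H; elim: s => [|i s IH].
  by rewrite big_nil; apply: usum_ext usum_0 => k; rewrite big_nil.
rewrite big_cons; apply: usum_ext (usum_plus (H i) IH) => k; by rewrite big_cons.
Qed.

Definition Z2add (j k : Z2) : Z2 := (Z.add j.1 k.1, Z.add j.2 k.2).

Lemma Z2add_inj p : injective (Z2add p).
Proof. by move=> [a b] [c d]; rewrite /Z2add /= => -[? ?]; congr pair; lia. Qed.

Lemma usum_shift p f l : usum f l -> usum (fun k => f (Z2add p k)) l.
Proof.
move=> H e e0; have [N HN] := H e e0.
exists (N + maxn (Z.to_nat (Z.abs p.1)) (Z.to_nat (Z.abs p.2)))%N => L u s.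
have -> : \sumC_(k <- L) f (Z2add p k) = \sumC_(k <- [seq Z2add p k | k <- L]) f k.
  by rewrite big_map.
apply: HN; first by rewrite map_inj_uniq //; apply: Z2add_inj.
move=> x /mem_box Hx; apply/mapP; exists (Z2sub x p).
  by apply: s; apply/mem_box; rewrite /Z2sub /=; lia.
by rewrite /Z2add /Z2sub /=; case: x {Hx} => a b /=; congr pair; lia.
Qed.

(** A finite set containing [box N] lies in a larger box, so what it adds to the box sum of [g] is
    at most the tail [G - sum]. One tail estimate thus makes the box sums of [f] Cauchy and also
    controls every other finite set. *)
Lemma usum_dominated f g B :
  (forall k, Cmod (f k) <= g k) -> (forall N, \sumR_(k <- box N) g k <= B) ->
  exists l, usum f l.
Proof.
move=> fg HB.
have g0 k : 0 <= g k by apply: Rle_trans (fg k); apply: Cmod_ge_0.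
have incr n : \sumR_(k <- box n) g k <= \sumR_(k <- box n.+1) g k.
  by apply: rsum_subset => //; [exact: box_uniq | apply: box_subset].
have [G HG] := ex_finite_lim_seq_incr _ _ incr HB.
have HGle N : \sumR_(k <- box N) g k <= G.
  by apply: (is_lim_seq_incr_compare _ _ HG incr).
have tailL N L : uniq L -> {subset box N <= L} ->
    Cmod (\sumC_(k <- L) f k - \sumC_(k <- box N) f k)%C <= G - \sumR_(k <- box N) g k.
  move=> u s; rewrite (csum_subset_diff _ (box_uniq N) u s).
  set A := \big[_/_]_(_ <- _) _; set D := \big[_/_]_(_ <- _) _.
  have -> : (A + D - A = D)%C by ring.
  apply: Rle_trans (Cmod_csum _ _) _.
  apply: (Rle_trans _ (\sumR_(k <- [seq k <- L | k \notin box N]) g k)); first exact: rsum_le.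
  have [N' HN'] := subset_box L.
  have := Rle_trans _ _ _ (rsum_subset g0 u HN') (HGle N').
  rewrite (rsum_subset_diff g (box_uniq N) u s).
  set X := \big[Rplus/0]_(k <- box N) _; set Y := \big[Rplus/0]_(k <- _) _; lra.
have tail e : 0 < e -> exists N, G - \sumR_(k <- box N) g k < e.
  move=> e0; move/is_lim_seq_spec: (HG) => /(_ (mkposreal _ e0)) [N HN].
  exists N; have /= := HN N (le_n _); have := HGle N => h; rewrite -Rabs_Ropp Rabs_pos_eq; lra.
have cau (pr : C -> R) : (forall z, Rabs (pr z) <= Cmod z) ->
    (forall a b, pr (a - b)%C = pr a - pr b) ->
    ex_finite_lim_seq (fun n => pr (\sumC_(k <- box n) f k)).
  move=> Hpr prB; apply/ex_lim_seq_cauchy_corr => e.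
  have [|N HN] := tail (e / 2); first by have := cond_pos e; lra.
  exists N => n m /leP Hn /leP Hm.
  have bd q : (N <= q)%N -> Rabs (pr (\sumC_(k <- box q) f k) - pr (\sumC_(k <- box N) f k)) < e / 2.
    move=> Hq; rewrite -prB; apply: Rle_lt_trans (Hpr _) _.
    by apply: Rle_lt_trans HN; apply: tailL; [apply: box_uniq | apply: box_subset].
  have := bd n Hn; have := bd m Hm.
  set x := pr _; set y := pr _; set z := pr _ => h1 h2.
  have -> : z - x = (z - y) + - (x - y) by ring.
  apply: Rle_lt_trans (Rabs_triang _ _) _; rewrite Rabs_Ropp; lra.
have [||lr Hr] := cau Re; [exact: Rabs_Re_le | exact: ReB |].
have [||li Hi] := cau Im; [exact: Rabs_Im_le | exact: ImB |].
exists (lr, li) => e e0.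
have e4 : 0 < e / 4 by lra.
have [N0 HN0] := tail (e / 4) e4.
move/is_lim_seq_spec: Hr => /(_ (mkposreal _ e4)) [N1 HN1].
move/is_lim_seq_spec: Hi => /(_ (mkposreal _ e4)) [N2 HN2].
exists N0 => L u s.
pose N := maxn N0 (maxn N1 N2).
set S := \big[_/_]_(_ <- L) _; pose S' := \sumC_(k <- box N) f k; pose S0 := \sumC_(k <- box N0) f k.
have -> : (S - (lr, li) = (S - S0) + ((S0 - S') + (S' - (lr, li))))%C by ring.
apply: Rle_trans (Cmod_triangle _ _) _.
apply: (Rle_trans _ (e / 4 + (e / 4 + (e / 4 + e / 4)))); last by lra.
apply: Rplus_le_compat; first by have := tailL N0 L u s; rewrite -/S -/S0; lra.
apply: Rle_trans (Cmod_triangle _ _) _; apply: Rplus_le_compat.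
  rewrite -Cmod_opp; have -> : (- (S0 - S') = S' - S0)%C by ring.
  apply: Rle_trans (Rlt_le _ _ HN0); apply: tailL; [exact: box_uniq | apply: box_subset; lia].
apply: Rle_trans (Cmod_le_abs _) _; apply: Rplus_le_compat; apply: Rlt_le.
  by have /= := HN1 N; apply; apply/leP; lia.
by have /= := HN2 N; apply; apply/leP; lia.
Qed.

Lemma usum_bound f l B :
  usum f l -> (forall L, uniq L -> \sumR_(k <- L) Cmod (f k) <= B) -> Cmod l <= B.
Proof.
move=> H HB; apply: le_epsilon => e e0; have [N HN] := H e e0.
have := HN (box N) (box_uniq N) (fun x h => h).
set S := \big[_/_]_(_ <- _) _ => h.
have -> : l = (S + - (S - l))%C by ring.
apply: Rle_trans (Cmod_triangle _ _) _; rewrite Cmod_opp.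
apply: Rplus_le_compat h; apply: Rle_trans (Cmod_csum _ _) _; apply: HB; exact: box_uniq.
Qed.

(** * The space l^2(Z^2) *)

Lemma is_l2_sum_le psi (L : seq Z2) :
  is_l2 psi -> uniq L -> \sumR_(k <- L) Cmod (psi k) ^ 2 <= nrm2 psi.
Proof.
case=> l Hl u; have [N HN] := subset_box L.
apply: (Rle_trans _ (\sumR_(k <- box N) Cmod (psi k) ^ 2)).
  by apply: rsum_subset => // k; apply: pow2_ge_0.
rewrite /nrm2 (is_lim_seq_unique _ _ Hl) /= -sqsumRE.
apply: (is_lim_seq_incr_compare _ _ Hl) => n; rewrite !sqsumRE.
by apply: rsum_subset => [k||]; [apply: pow2_ge_0 | exact: box_uniq | apply: box_subset].
Qed.

Lemma is_l2_le psi B :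
  (forall N, \sumR_(k <- box N) Cmod (psi k) ^ 2 <= B) -> is_l2 psi /\ nrm2 psi <= B.
Proof.
move=> H.
have [||l Hl] := @ex_finite_lim_seq_incr (sqsumR (fun k => Cmod (psi k) ^ 2)) B.
- move=> n; rewrite !sqsumRE.
  by apply: rsum_subset => [k||]; [apply: pow2_ge_0 | exact: box_uniq | apply: box_subset].
- by move=> n; rewrite sqsumRE.
split; first by exists l.
rewrite /nrm2 (is_lim_seq_unique _ _ Hl) /=.
apply: (is_lim_seq_le _ _ l B _ Hl (is_lim_seq_const _)) => n; rewrite sqsumRE; exact: H.
Qed.

Lemma nrm2_ge0 psi : is_l2 psi -> 0 <= nrm2 psi.
Proof. by move=> H; have := @is_l2_sum_le psi [::] H isT; rewrite big_nil. Qed.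

Lemma nrm2_mono psi phi : (forall k, Cmod (psi k) <= Cmod (phi k)) -> is_l2 phi ->
  is_l2 psi /\ nrm2 psi <= nrm2 phi.
Proof.
move=> H H2; apply: is_l2_le => N.
apply: Rle_trans (is_l2_sum_le H2 (box_uniq N)); apply: rsum_le => k.
by have := H k; have := Cmod_ge_0 (psi k); nra.
Qed.

Lemma is_l2_pointwise psi k : is_l2 psi -> Cmod (psi k) <= sqrt (nrm2 psi).
Proof.
move=> H; rewrite -[X in X <= _]sqrt_pow2; last exact: Cmod_ge_0.
by apply: sqrt_le_1_alt; have := @is_l2_sum_le psi [:: k] H isT; rewrite big_seq1.
Qed.

Lemma l2_pairing (a b : Z2 -> C) p (L : seq Z2) : is_l2 a -> is_l2 b -> uniq L ->
  \sumR_(k <- L) (Cmod (a k) * Cmod (b (Z2add p k))) <= sqrt (nrm2 a) * sqrt (nrm2 b).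
Proof.
move=> Ha Hb u; apply: Rle_trans (rsum_CauchySchwarz _ _ _) _; try by move=> k; apply: Cmod_ge_0.
apply: Rmult_le_compat; try exact: sqrt_pos.
  by apply: sqrt_le_1_alt; apply: is_l2_sum_le.
apply: sqrt_le_1_alt.
have := @is_l2_sum_le b [seq Z2add p k | k <- L] Hb; rewrite map_inj_uniq ?big_map.
  by apply.
exact: Z2add_inj.
Qed.

(** The shape of all quadratic forms below: [a] is psi, [b] its conjugate, [c] a bounded symbol, [p]
    the total shift of the modes. Cauchy-Schwarz gives a bound independent of [p]. *)
Lemma usum_pairing (a b : Z2 -> C) (c : Z2 -> C) p B : is_l2 a -> is_l2 b ->
  (forall k, Cmod (c k) <= B) ->
  exists2 l, usum (fun k => a k * b (Z2add p k) * c k)%C l &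
             Cmod l <= B * (sqrt (nrm2 a) * sqrt (nrm2 b)).
Proof.
move=> Ha Hb Hc.
have B0 : 0 <= B by apply: Rle_trans (Hc (0, 0)%ZZ); apply: Cmod_ge_0.
have bd L : uniq L -> \sumR_(k <- L) Cmod (a k * b (Z2add p k) * c k)%C <=
    B * (sqrt (nrm2 a) * sqrt (nrm2 b)).
  move=> u.
  apply: (Rle_trans _ (B * \sumR_(k <- L) (Cmod (a k) * Cmod (b (Z2add p k))))); last first.
    by apply: Rmult_le_compat_l => //; apply: l2_pairing.
  rewrite rsum_scal_l; apply: rsum_le => k; rewrite !Cmod_mult.
  rewrite Rmult_comm; apply: Rmult_le_compat_r => //.
  by apply: Rmult_le_pos; apply: Cmod_ge_0.
have [||l Hl] := @usum_dominated (fun k => a k * b (Z2add p k) * c k)%C (fun k => Cmod (a k * b (Z2add p k) * c k)%C) (B * (sqrt (nrm2 a) * sqrt (nrm2 b))).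
- by move=> k; lra.
- by move=> N; apply: bd; exact: box_uniq.
by exists l => //; apply: usum_bound Hl bd.
Qed.

(** * Complex-valued calculus of one real variable *)

Definition imC (r : R) : C := (0, r).

Lemma imC_opp r : imC (- r) = (- imC r)%C.
Proof. by apply: injective_projections => /=; ring. Qed.

Lemma cis_add a b : cis (a + b) = (cis a * cis b)%C.
Proof. by rewrite /cis cos_plus sin_plus; apply: injective_projections => /=; ring. Qed.

Lemma cis0 : cis 0 = RtoC 1.
Proof. by rewrite /cis cos_0 sin_0. Qed.

Lemma Cmod_cis a : Cmod (cis a) = 1.
Proof.
rewrite /Cmod /cis /=; rewrite -[RHS]sqrt_1; congr sqrt.
by have := sin2_cos2 a; rewrite /Rsqr; lra.
Qed.

Lemma Cconj_cis a : Cconj (cis a) = cis (- a).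
Proof. by rewrite /Cconj /cis cos_neg sin_neg. Qed.

Lemma Cmod_Cconj z : Cmod (Cconj z) = Cmod z.
Proof. by rewrite /Cmod /Cconj /=; congr sqrt; ring. Qed.

(** Continuity, derivative and integral are taken componentwise, so that the real calculus
    ([auto_derive], [RInt], the mean value theorem) applies directly. *)
Definition Ccont (f : R -> C) : Prop :=
  forall x, continuous (fun s => Re (f s)) x /\ continuous (fun s => Im (f s)) x.

Definition Cder (f : R -> C) (x : R) (l : C) : Prop :=
  is_derive (fun s => Re (f s)) x (Re l) /\ is_derive (fun s => Im (f s)) x (Im l).

Lemma Cder_ext f g x l : (forall s, f s = g s) -> Cder f x l -> Cder g x l.
Proof. by move=> E [H1 H2]; split; [apply: is_derive_ext H1 | apply: is_derive_ext H2] => s; rewrite E. Qed.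


Lemma is_derive_eq (f : R -> R) (x l l' : R) : is_derive f x l -> l = l' -> is_derive f x l'.
Proof. by move=> H <-. Qed.

Lemma is_derive_Rmult (u v : R -> R) x p q : is_derive u x p -> is_derive v x q ->
  is_derive (fun s => u s * v s) x (p * v x + u x * q).
Proof. by move=> hu hv; apply: (is_derive_mult u v x p q hu hv) => n m'; apply: Rmult_comm. Qed.

Lemma is_derive_Rplus (u v : R -> R) x p q : is_derive u x p -> is_derive v x q ->
  is_derive (fun s => u s + v s) x (p + q).
Proof. by move=> hu hv; apply: (is_derive_plus u v x p q hu hv). Qed.

Lemma is_derive_Rminus (u v : R -> R) x p q : is_derive u x p -> is_derive v x q ->
  is_derive (fun s => u s - v s) x (p - q).
Proof. by move=> hu hv; apply: (is_derive_minus u v x p q hu hv). Qed.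

Lemma Cder_eq f x l l' : Cder f x l -> l = l' -> Cder f x l'.
Proof. by move=> H <-. Qed.

Lemma Cder_plus f g x l m : Cder f x l -> Cder g x m -> Cder (fun s => f s + g s)%C x (l + m)%C.
Proof. by move=> [a b] [c d]; split; apply: is_derive_Rplus. Qed.

Lemma Cder_const c x : Cder (fun _ => c) x (RtoC 0).
Proof. by split; apply: (is_derive_const (V := R_NormedModule)). Qed.

Lemma Cder_mult f g x l m : Cder f x l -> Cder g x m ->
  Cder (fun s => f s * g s)%C x (l * g x + f x * m)%C.
Proof.
move=> [a b] [c d]; split.
  apply: is_derive_eq (is_derive_Rminus (is_derive_Rmult a c) (is_derive_Rmult b d)) _.
  by rewrite /Re /Im /=; ring.
apply: is_derive_eq (is_derive_Rplus (is_derive_Rmult a d) (is_derive_Rmult b c)) _.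
by rewrite /Re /Im /=; ring.
Qed.

Lemma Cder_scal c f x l : Cder f x l -> Cder (fun s => c * f s)%C x (c * l)%C.
Proof. by move=> H; apply: Cder_eq (Cder_mult (Cder_const c x) H) _; ring. Qed.

Lemma Cder_conj f x l : Cder f x l -> Cder (fun s => Cconj (f s)) x (Cconj l).
Proof.
move=> [a b]; split => //.
apply: is_derive_eq (is_derive_ext _ _ x _ _ (is_derive_scal _ x (-1) _ b)) _ => [s|].
  by rewrite /Im /=; ring.
by rewrite /Im /=; ring.
Qed.

Lemma Cder_big (I : Type) (r : seq I) (f : I -> R -> C) (l : I -> C) x :
  (forall i, Cder (f i) x (l i)) ->
  Cder (fun s => \sumC_(i <- r) f i s) x (\sumC_(i <- r) l i).
Proof.
move=> H; elim: r => [|i r IH].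
  rewrite big_nil; apply: Cder_ext (Cder_const (RtoC 0) x) => s; by rewrite big_nil.
rewrite big_cons; apply: Cder_ext (Cder_plus (H i) IH) => s; by rewrite big_cons.
Qed.

Lemma Cder_cis a b x : Cder (fun s => cis (a * s + b)) x (imC a * cis (a * x + b))%C.
Proof. by split; rewrite /Re /Im /=; auto_derive => //; ring. Qed.

Lemma Cder_cont f l : (forall x, Cder f x (l x)) -> Ccont f.
Proof.
move=> H x; have [a b] := H x.
by split; apply: ex_derive_continuous; [exists (Re (l x)) | exists (Im (l x))].
Qed.

Lemma Ccont_ext f g : (forall s, f s = g s) -> Ccont f -> Ccont g.
Proof.
move=> E H x; have [a b] := H x.
by split; [apply: continuous_ext a | apply: continuous_ext b] => s; rewrite E.
Qed.

Lemma Ccont_const c : Ccont (fun _ => c).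
Proof. by move=> x; split; apply: continuous_const. Qed.

Lemma Ccont_plus f g : Ccont f -> Ccont g -> Ccont (fun s => f s + g s)%C.
Proof.
move=> Hf Hg x; have [a b] := Hf x; have [c d] := Hg x.
by split; [exact: (continuous_plus _ _ _ a c) | exact: (continuous_plus _ _ _ b d)].
Qed.

Lemma Ccont_mult f g : Ccont f -> Ccont g -> Ccont (fun s => f s * g s)%C.
Proof.
move=> Hf Hg x; have [a b] := Hf x; have [c d] := Hg x; split.
  exact: (continuous_minus _ _ _ (continuous_mult _ _ _ a c) (continuous_mult _ _ _ b d)).
exact: (continuous_plus _ _ _ (continuous_mult _ _ _ a d) (continuous_mult _ _ _ b c)).
Qed.

Lemma Ccont_big (I : Type) (r : seq I) (f : I -> R -> C) :
  (forall i, Ccont (f i)) -> Ccont (fun s => \sumC_(i <- r) f i s).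
Proof.
move=> H; elim: r => [|i r IH].
  apply: Ccont_ext (Ccont_const (RtoC 0)) => s; by rewrite big_nil.
apply: Ccont_ext (Ccont_plus (H i) IH) => s; by rewrite big_cons.
Qed.

Lemma Ccont_cis a b : Ccont (fun s => cis (a * s + b)).
Proof. exact: Cder_cont (fun x => Cder_cis a b x). Qed.

Definition CInt (f : R -> C) (a b : R) : C :=
  (RInt (fun s => Re (f s)) a b, RInt (fun s => Im (f s)) a b).

Lemma ex_RInt_Rcont (f : R -> R) a b : (forall x, continuous f x) -> ex_RInt f a b.
Proof. by move=> H; apply: (ex_RInt_continuous (V := R_CompleteNormedModule)) => z _. Qed.

Lemma Ccont_ex f a b : Ccont f ->
  ex_RInt (fun s => Re (f s)) a b /\ ex_RInt (fun s => Im (f s)) a b.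
Proof. by move=> H; split; apply: ex_RInt_Rcont => x; have [] := H x. Qed.

Lemma CInt_ext f g a b : (forall s, f s = g s) -> CInt f a b = CInt g a b.
Proof. by move=> E; congr pair; apply: RInt_ext => x _; rewrite E. Qed.

Lemma CInt_plus f g a b : Ccont f -> Ccont g ->
  CInt (fun s => f s + g s)%C a b = (CInt f a b + CInt g a b)%C.
Proof.
move=> /(Ccont_ex a b) [f1 f2] /(Ccont_ex a b) [g1 g2].
by apply: injective_projections; [exact: (RInt_plus _ _ _ _ f1 g1) | exact: (RInt_plus _ _ _ _ f2 g2)].
Qed.

Lemma CInt_scal c f a b : Ccont f -> CInt (fun s => c * f s)%C a b = (c * CInt f a b)%C.
Proof.
move=> /(Ccont_ex a b) [f1 f2].
have h r (g : R -> R) : ex_RInt g a b -> ex_RInt (fun s => r * g s) a b.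
  by move=> Hg; apply: (ex_RInt_scal g a b r Hg).
have e r (g : R -> R) : ex_RInt g a b -> RInt (fun s => r * g s) a b = r * RInt g a b.
  by move=> Hg; apply: (RInt_scal g a b r Hg).
apply: injective_projections => /=.
  rewrite -(e c.1) // -(e c.2) //.
  exact: (RInt_minus _ _ _ _ (h c.1 _ f1) (h c.2 _ f2)).
rewrite -(e c.1) // -(e c.2) //.
exact: (RInt_plus _ _ _ _ (h c.1 _ f2) (h c.2 _ f1)).
Qed.

Lemma CInt_0 a b : CInt (fun _ => RtoC 0) a b = RtoC 0.
Proof. by rewrite /CInt /= RInt_const /scal /= /mult /= Rmult_0_r. Qed.

Lemma CInt_big (I : Type) (r : seq I) (f : I -> R -> C) a b : (forall i, Ccont (f i)) ->
  CInt (fun s => \sumC_(i <- r) f i s) a b = \sumC_(i <- r) CInt (f i) a b.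
Proof.
move=> H; elim: r => [|i r IH].
  rewrite big_nil (@CInt_ext _ (fun _ => RtoC 0)) ?CInt_0 // => s; by rewrite big_nil.
rewrite big_cons -IH -CInt_plus //; last exact: Ccont_big.
by apply: CInt_ext => s; rewrite big_cons.
Qed.

Lemma is_derive_RInt_upper (f : R -> R) a x : (forall y, continuous f y) ->
  is_derive (fun s => RInt f a s) x (f x).
Proof.
move=> H; apply: (@is_derive_RInt R_NormedModule f (fun s => RInt f a s) a x) => //.
by exists (mkposreal _ Rlt_0_1) => y _; apply: RInt_correct; apply: ex_RInt_Rcont.
Qed.

Lemma is_derive_RInt_lower (f : R -> R) b x : (forall y, continuous f y) ->
  is_derive (fun s => RInt f s b) x (- f x).
Proof.
move=> H; apply: (@is_derive_RInt' R_NormedModule f (fun s => RInt f s b) x b) => //.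
by exists (mkposreal _ Rlt_0_1) => y _; apply: RInt_correct; apply: ex_RInt_Rcont.
Qed.

Lemma Cder_CInt_upper f a x : Ccont f -> Cder (fun s => CInt f a s) x (f x).
Proof. by move=> H; split; apply: is_derive_RInt_upper => y; have [] := H y. Qed.

Lemma Cder_CInt_lower f b x : Ccont f -> Cder (fun s => CInt f s b) x (- f x)%C.
Proof. by move=> H; split; apply: is_derive_RInt_lower => y; have [] := H y. Qed.

Lemma RInt_is_derive (F f : R -> R) a b : (forall x, is_derive F x (f x)) ->
  (forall x, continuous f x) -> RInt f a b = F b - F a.
Proof.
move=> HF Hf; apply: is_RInt_unique.
by apply: (@is_RInt_derive R_CompleteNormedModule F f a b).
Qed.

Lemma CInt_Cder F f a b : (forall x, Cder F x (f x)) -> Ccont f -> CInt f a b = (F b - F a)%C.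
Proof.
move=> HF Hf; rewrite /CInt.
rewrite (@RInt_is_derive (fun s => Re (F s)) (fun s => Re (f s))); first last.
- by move=> x; have [] := Hf x.
- by move=> x; have [] := HF x.
rewrite (@RInt_is_derive (fun s => Im (F s)) (fun s => Im (f s))) //.
- by move=> x; have [] := HF x.
- by move=> x; have [] := Hf x.
Qed.

Lemma CInt_point f a : CInt f a a = RtoC 0.
Proof. by rewrite /CInt !RInt_point. Qed.

Lemma unit_phase (z : C) : exists2 c, Cmod c = 1 & (c * z)%C = RtoC (Cmod z).
Proof.
case: (Req_dec (Cmod z) 0) => H.
  exists (RtoC 1); first by rewrite Cmod_1.
  by rewrite (Cmod_eq_0 _ H) Cmod_0; ring.
have z0 : z <> RtoC 0 by move=> E; apply: H; rewrite E Cmod_0.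
exists (RtoC (Cmod z) / z)%C.
  rewrite Cmod_div // Cmod_R Rabs_pos_eq; last exact: Cmod_ge_0.
  by field.
by field.
Qed.

(** The mean value theorem fails for complex values; it is applied to Re(c f) - g, where the unit c
    turns [f b - f a] onto the positive half-line. *)
Lemma Cder_le f l (g dg : R -> R) a b : a <= b ->
  (forall x, a <= x <= b -> Cder f x (l x)) ->
  (forall x, a <= x <= b -> is_derive g x (dg x)) ->
  (forall x, a <= x <= b -> Cmod (l x) <= dg x) ->
  Cmod (f b - f a)%C <= g b - g a.
Proof.
move=> ab Hf Hg Hl.
have [c c1 Ec] := unit_phase (f b - f a)%C.
pose h s := Re (c * f s)%C - g s.
have Hh x : a <= x <= b -> is_derive h x (Re (c * l x)%C - dg x).
  move=> Hx; apply: is_derive_Rminus (Hg x Hx).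
  by have [] := Cder_scal c (Hf x Hx).
have [|x Hx|z [Hz E]] := MVT_gen h a b (fun x => Re (c * l x)%C - dg x).
- by move=> x; rewrite Rmin_left // Rmax_right // => Hx; apply: Hh; lra.
- rewrite Rmin_left // Rmax_right // in Hx.
  apply/continuity_pt_filterlim; apply: ex_derive_continuous; eexists; exact: Hh.
rewrite Rmin_left // Rmax_right // in Hz.
have h1 : Re (c * l z)%C <= dg z.
  apply: Rle_trans (Hl z Hz); apply: Rle_trans (Rle_abs _) _.
  by apply: Rle_trans (Rabs_Re_le _) _; rewrite Cmod_mult c1; lra.
have : h b - h a <= 0 by rewrite E; nra.
have -> : h b - h a = Re (c * (f b - f a))%C - (g b - g a) by rewrite /h /Re /=; ring.
by rewrite Ec /=; lra.
Qed.

Lemma Cder_bound f l a b B : 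
  (forall x, Rmin a b <= x <= Rmax a b -> Cder f x (l x)) ->
  (forall x, Rmin a b <= x <= Rmax a b -> Cmod (l x) <= B) ->
  Cmod (f b - f a)%C <= B * Rabs (b - a).
Proof.
have main u v : u <= v -> (forall x, u <= x <= v -> Cder f x (l x)) ->
   (forall x, u <= x <= v -> Cmod (l x) <= B) -> Cmod (f v - f u)%C <= B * (v - u).
  move=> uv Hf Hl; rewrite Rmult_minus_distr_l.
  apply: (@Cder_le f l (fun s => B * s) (fun _ => B)) => // x _.
  by auto_derive => //; ring.
case: (Rle_dec a b) => ab.
  rewrite Rmin_left // Rmax_right // Rabs_pos_eq; [exact: main | lra].
rewrite Rmin_right ?Rmax_left; [|lra|lra] => Hf Hl.
rewrite -Rabs_Ropp Rabs_pos_eq; last lra.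
rewrite -Cmod_opp; have -> : (- (f b - f a) = f a - f b)%C by ring.
have -> : - (b - a) = a - b by ring.
by apply: main => //; lra.
Qed.

Lemma CInt_bound f a b B : Ccont f ->
  (forall x, Rmin a b <= x <= Rmax a b -> Cmod (f x) <= B) ->
  Cmod (CInt f a b) <= B * Rabs (b - a).
Proof.
move=> Hf HB; have -> : CInt f a b = (CInt f a b - CInt f a a)%C by rewrite CInt_point; ring.
by apply: (@Cder_bound (fun s => CInt f a s) f) => // x _; apply: Cder_CInt_upper.
Qed.

(** * Fourier series on the two-dimensional torus *)

Definition cont2 (g : R -> R -> R) : Prop := forall x y, continuity_2d_pt g x y.
Definition Ccont2 (g : R -> R -> C) : Prop :=
  cont2 (fun x y => Re (g x y)) /\ cont2 (fun x y => Im (g x y)).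

Lemma cont2_ext f g : (forall x y, f x y = g x y) -> cont2 f -> cont2 g.
Proof. by move=> E H x y; apply: continuity_2d_pt_ext (H x y). Qed.

Lemma Ccont2_ext f g : (forall x y, f x y = g x y) -> Ccont2 f -> Ccont2 g.
Proof. by move=> E [a b]; split; [apply: cont2_ext a | apply: cont2_ext b] => x y; rewrite E. Qed.

Lemma cont2_slice g x y : cont2 g -> continuous (g x) y.
Proof.
move=> H; apply/continuity_pt_filterlim/continuity_pt_locally => e.
have [d Hd] := H x y e; exists d => v Hv.
by apply: Hd => //; rewrite Rminus_diag Rabs_R0; apply: cond_pos.
Qed.

Lemma cont2_RInt g x : cont2 g -> continuous (fun x => RInt (g x) 0 1) x.
Proof.
move=> H; apply/continuity_pt_filterlim/continuity_pt_locally => e.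
have e2 : 0 < e / 2 by have := cond_pos e; lra.
have [d Hd] := @uniform_continuity_2d_1d' g 0 1 x (fun y _ => H x y) (mkposreal _ e2).
exists d => v Hv.
have ex z : ex_RInt (g z) 0 1 by apply: ex_RInt_Rcont => y; apply: cont2_slice.
have -> : RInt (g v) 0 1 - RInt (g x) 0 1 = RInt (fun y => g v y - g x y) 0 1.
  by symmetry; apply: (RInt_minus (g v) (g x) 0 1).
apply: (Rle_lt_trans _ ((1 - 0) * (e / 2))); last by lra.
apply: (@norm_RInt_le_const R_NormedModule (fun y => g v y - g x y)); first lra.
  move=> y Hy; apply: Rlt_le; move: Hv; rewrite /ball /= /AbsRing_ball /abs /minus /plus /opp /= => Hv.
  have d0 := cond_pos d.
  apply: (Hd y x y v) => //; try (by lra); try (rewrite Rminus_diag Rabs_R0 //).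
  by move: Hv => /Rabs_def2; lra.
apply: RInt_correct; apply: ex_RInt_Rcont => y.
by apply: (continuous_minus (g v) (g x)); apply: cont2_slice.
Qed.

Lemma cont2_const c : cont2 (fun _ _ => c).
Proof. by move=> x y; apply: continuity_2d_pt_const. Qed.

Lemma cont2_plus f g : cont2 f -> cont2 g -> cont2 (fun x y => f x y + g x y).
Proof. by move=> a b x y; apply: continuity_2d_pt_plus. Qed.

Lemma cont2_minus f g : cont2 f -> cont2 g -> cont2 (fun x y => f x y - g x y).
Proof. by move=> a b x y; apply: continuity_2d_pt_minus. Qed.

Lemma cont2_mult f g : cont2 f -> cont2 g -> cont2 (fun x y => f x y * g x y).
Proof. by move=> a b x y; apply: continuity_2d_pt_mult. Qed.

Lemma cont2_lin a b c : cont2 (fun x y => a * x + b * y + c).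
Proof.
apply: cont2_plus; last exact: cont2_const.
apply: cont2_plus; apply: cont2_mult; try exact: cont2_const; move=> x y.
  exact: continuity_2d_pt_id1.
exact: continuity_2d_pt_id2.
Qed.

Lemma cont2_comp h g : (forall x, continuity_pt h x) -> cont2 g -> cont2 (fun x y => h (g x y)).
Proof. by move=> Hh Hg x y; apply: continuity_1d_2d_pt_comp. Qed.

Lemma Ccont2_plus f g : Ccont2 f -> Ccont2 g -> Ccont2 (fun x y => f x y + g x y)%C.
Proof. by move=> [a b] [c d]; split; apply: cont2_plus. Qed.

Lemma Ccont2_mult f g : Ccont2 f -> Ccont2 g -> Ccont2 (fun x y => f x y * g x y)%C.
Proof.
move=> [a b] [c d]; split.
  by apply: (cont2_minus (cont2_mult a c) (cont2_mult b d)).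
by apply: (cont2_plus (cont2_mult a d) (cont2_mult b c)).
Qed.

Lemma Ccont2_const c : Ccont2 (fun _ _ => c).
Proof. by split; apply: cont2_const. Qed.

Lemma Ccont2_RtoC g : cont2 g -> Ccont2 (fun x y => RtoC (g x y)).
Proof. by move=> H; split => //; apply: cont2_const. Qed.

Lemma Ccont2_cis a b c : Ccont2 (fun x y => cis (a * x + b * y + c)).
Proof.
split; [apply: (@cont2_comp Rtrigo_def.cos) | apply: (@cont2_comp Rtrigo_def.sin)];
  try exact: cont2_lin; move=> x; [exact: continuity_cos | exact: continuity_sin].
Qed.

Lemma Ccont2_big (I : Type) (r : seq I) (f : I -> R -> R -> C) :
  (forall i, Ccont2 (f i)) -> Ccont2 (fun x y => \sumC_(i <- r) f i x y).
Proof.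
move=> H; elim: r => [|i r IH].
  apply: Ccont2_ext (Ccont2_const (RtoC 0)) => x y; by rewrite big_nil.
apply: Ccont2_ext (Ccont2_plus (H i) IH) => x y; by rewrite big_cons.
Qed.

Lemma Ccont2_unif_lim f :
  (forall e, 0 < e -> exists2 g, Ccont2 g & forall x y, Cmod (f x y - g x y)%C <= e) -> Ccont2 f.
Proof.
have main (pr : C -> R) : (forall z, Rabs (pr z) <= Cmod z) ->
    (forall a b, pr (a - b)%C = pr a - pr b) ->
    (forall e, 0 < e -> exists2 g, cont2 (fun x y => pr (g x y)) & forall x y, Cmod (f x y - g x y)%C <= e) ->
    cont2 (fun x y => pr (f x y)).
  (* Three-term comparison through [g], with e/4 + e/3 + e/4 < e. *)
  move=> Hpr prB H x y e; have e3 : 0 < e / 3 by have := cond_pos e; lra.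
  have e4 : 0 < e / 4 by lra.
  have [g gc Hg] := H _ e4; have [d Hd] := gc x y (mkposreal _ e3).
  exists d => u v hu hv; have /= := Hd u v hu hv.
  have bd s t : Rabs (pr (f s t) - pr (g s t)) <= e / 4 by rewrite -prB; apply: Rle_trans (Hpr _) _.
  have := bd u v; have := bd x y.
  move=> /Rabs_le_between h1 /Rabs_le_between h2 /Rabs_def2 h3.
  by apply: Rabs_def1; lra.
move=> H; split.
  by apply: main => [z|//|e /H [g [a b] h]]; [exact: Rabs_Re_le | exists g].
by apply: main => [z|//|e /H [g [a b] h]]; [exact: Rabs_Im_le | exists g].
Qed.

Lemma Ccont2_slice g x : Ccont2 g -> Ccont (g x).
Proof.
move=> [a b] y; split.
  exact: (@cont2_slice (fun x y => Re (g x y))).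
exact: (@cont2_slice (fun x y => Im (g x y))).
Qed.

Lemma Ccont2_CInt g : Ccont2 g -> Ccont (fun x => CInt (g x) 0 1).
Proof.
move=> [a b] x; split.
  exact: (@cont2_RInt (fun x y => Re (g x y))).
exact: (@cont2_RInt (fun x y => Im (g x y))).
Qed.

Definition I2 (g : R -> R -> C) : C := CInt (fun x => CInt (g x) 0 1) 0 1.

Lemma I2_ext f g : (forall x y, f x y = g x y) -> I2 f = I2 g.
Proof. by move=> E; apply: CInt_ext => x; apply: CInt_ext => y. Qed.

Lemma I2_plus f g : Ccont2 f -> Ccont2 g -> I2 (fun x y => f x y + g x y)%C = (I2 f + I2 g)%C.
Proof.
move=> Hf Hg; rewrite /I2 -CInt_plus; try exact: Ccont2_CInt.
by apply: CInt_ext => x; rewrite CInt_plus //; apply: Ccont2_slice.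
Qed.

Lemma I2_scal c f : Ccont2 f -> I2 (fun x y => c * f x y)%C = (c * I2 f)%C.
Proof.
move=> Hf; rewrite /I2 -CInt_scal; last exact: Ccont2_CInt.
by apply: CInt_ext => x; rewrite CInt_scal //; apply: Ccont2_slice.
Qed.

Lemma I2_big (I : Type) (r : seq I) (f : I -> R -> R -> C) : (forall i, Ccont2 (f i)) ->
  I2 (fun x y => \sumC_(i <- r) f i x y) = \sumC_(i <- r) I2 (f i).
Proof.
move=> H; rewrite /I2 -CInt_big; last by move=> i; apply: Ccont2_CInt.
by apply: CInt_ext => x; rewrite CInt_big // => i; apply: Ccont2_slice.
Qed.

Lemma I2_bound f B : Ccont2 f -> (forall x y, Cmod (f x y) <= B) -> Cmod (I2 f) <= B.
Proof.
move=> Hf HB.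
have -> : B = B * Rabs (1 - 0) * Rabs (1 - 0) by rewrite Rminus_0_r Rabs_R1; ring.
apply: CInt_bound => [|x _]; first exact: Ccont2_CInt.
by apply: CInt_bound => //; apply: Ccont2_slice.
Qed.

Definition phase (m : Z2) (x y : R) : R := 2 * PI * (IZR m.1 * x + IZR m.2 * y).

Lemma phaseE m x y : phase m x y = (2 * PI * IZR m.1) * x + (2 * PI * IZR m.2) * y + 0.
Proof. by rewrite /phase; ring. Qed.

Lemma phaseN m x y : - phase m x y = (- (2 * PI * IZR m.1)) * x + (- (2 * PI * IZR m.2)) * y + 0.
Proof. by rewrite /phase; ring. Qed.

Lemma Ccont2_cis_phase m : Ccont2 (fun x y => cis (phase m x y)).
Proof. by apply: Ccont2_ext (Ccont2_cis _ _ 0) => x y; rewrite phaseE. Qed.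

Lemma Ccont2_cis_Nphase m : Ccont2 (fun x y => cis (- phase m x y)).
Proof. by apply: Ccont2_ext (Ccont2_cis _ _ 0) => x y; rewrite phaseN. Qed.

Lemma cis_period a : cis (a + 2 * PI) = cis a.
Proof. by rewrite cis_add /cis cos_2PI sin_2PI; apply: injective_projections => /=; ring. Qed.

Lemma cis_2PI n : cis (2 * PI * IZR n) = RtoC 1.
Proof.
have pos k : cis (2 * PI * INR k) = RtoC 1.
  elim: k => [|k IH]; first by rewrite /= Rmult_0_r cis0.
  by rewrite S_INR Rmult_plus_distr_l Rmult_1_r cis_period.
case: (Z_le_dec 0 n) => Hn; first by rewrite -(Z2Nat.id n) // -INR_IZR_INZ.
have -> : 2 * PI * IZR n = - (2 * PI * INR (Z.to_nat (- n))).
  by rewrite INR_IZR_INZ Z2Nat.id ?opp_IZR; [ring | lia].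
by rewrite -Cconj_cis pos; apply: injective_projections => /=; ring.
Qed.

Lemma CInt_cis n c : CInt (fun s => cis (2 * PI * IZR n * s + c)) 0 1 =
  if (n == 0%ZZ) then cis c else RtoC 0.
Proof.
case: eqP => [->|Hn].
  rewrite (@CInt_ext _ (fun _ => cis c)); last by move=> s; congr cis; ring.
  rewrite /CInt !RInt_const /scal /= /mult /=; apply: injective_projections => /=; ring.
have n0 : 2 * PI * IZR n <> 0.
  by apply: Rmult_integral_contrapositive_currified; [have := PI_RGT_0; lra | apply: not_0_IZR].
pose z : C := (0, - / (2 * PI * IZR n)).
rewrite (@CInt_Cder (fun s => z * cis (2 * PI * IZR n * s + c))%C); first last.
- exact: Ccont_cis.
- move=> x; apply: Cder_eq (Cder_scal _ (Cder_cis _ _ _)) _.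
  rewrite Cmult_assoc; have -> : (z * imC (2 * PI * IZR n) = RtoC 1)%C.
    rewrite /z /imC; move: n0; set w := 2 * PI * IZR n => n0.
    by apply: injective_projections => /=; field; exact: n0.
  by ring.
rewrite Rmult_0_r Rplus_0_l Rmult_1_r cis_add cis_2PI; ring.
Qed.

Lemma I2_cis_phase m : I2 (fun x y => cis (phase m x y)) =
  if (m == (0%ZZ, 0%ZZ)) then RtoC 1 else RtoC 0.
Proof.
rewrite /I2 (@CInt_ext _ (fun x => (if m.2 == 0%ZZ then RtoC 1 else RtoC 0) * cis (2 * PI * IZR m.1 * x + 0))%C).
  rewrite CInt_scal; last exact: Ccont_cis.
  rewrite CInt_cis cis0; case: m => a b; rewrite xpair_eqE /=.
  by case: (a == _); case: (b == _) => /=; ring.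
move=> x; rewrite (@CInt_ext _ (fun y => cis (2 * PI * IZR m.2 * y + 2 * PI * IZR m.1 * x))).
  by rewrite CInt_cis; case: ifP => _; rewrite ?Rplus_0_r; ring.
by move=> y; congr cis; rewrite /phase; ring.
Qed.

Definition fhat (g : R -> R -> C) (m : Z2) : C := I2 (fun x y => g x y * cis (- phase m x y))%C.

Lemma RInt_extR (f g : R -> R) a b : (forall x, f x = g x) -> RInt f a b = RInt g a b.
Proof. by move=> E; apply: RInt_ext => x _. Qed.

Lemma RInt_opp_cont (f : R -> R) a b : (forall x, continuous f x) ->
  RInt (fun x => - f x) a b = - RInt f a b.
Proof. by move=> H; apply: (RInt_opp f a b); apply: ex_RInt_Rcont. Qed.

Lemma fourier2E V m : cont2 V -> fourier2 V m = fhat (fun x y => RtoC (V x y)) m.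
Proof.
move=> HV.
have c2 : cont2 (fun x y => V x y * Rtrigo_def.sin (phase m x y)).
  by apply: cont2_mult => //; have [] := Ccont2_cis_phase m.
rewrite /fourier2 /fhat /I2 /CInt /=; congr pair.
  apply: RInt_extR => x; apply: RInt_extR => y.
  by rewrite cos_neg -/(phase m x y); ring.
rewrite -RInt_opp_cont; last by move=> x; apply: (@cont2_RInt _ x c2).
apply: RInt_extR => x; rewrite -RInt_opp_cont; last by move=> y; apply: (@cont2_slice (fun x y => V x y * Rtrigo_def.sin (phase m x y)) x y c2).
by apply: RInt_extR => y; rewrite sin_neg -/(phase m x y); ring.
Qed.

Lemma Cder_CInt_param (g gx : R -> R -> C) x :
  (forall x y, Cder (fun s => g s y) x (gx x y)) -> Ccont2 g -> Ccont2 gx ->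
  Cder (fun x => CInt (g x) 0 1) x (CInt (gx x) 0 1).
Proof.
have main (f fx : R -> R -> R) : (forall x y, is_derive (fun s => f s y) x (fx x y)) ->
    cont2 f -> cont2 fx -> is_derive (fun x => RInt (f x) 0 1) x (RInt (fx x) 0 1).
  move=> Hd Hf Hfx.
  have E u v : Derive (fun s => f s v) u = fx u v by apply: is_derive_unique.
  have := @is_derive_RInt_param f 0 1 x.
  rewrite (@RInt_extR (fun t => Derive (fun s => f s t) x) (fx x)) //; apply.
  - by exists (mkposreal _ Rlt_0_1) => y _ t _; exists (fx y t).
  - move=> t _; apply: (continuity_2d_pt_ext fx) => //.
  - exists (mkposreal _ Rlt_0_1) => y _; apply: ex_RInt_Rcont => t; exact: cont2_slice.
move=> Hd [a b] [c d]; split.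
  apply: (main (fun x y => Re (g x y)) (fun x y => Re (gx x y))) => // u v; by have [] := Hd u v.
apply: (main (fun x y => Im (g x y)) (fun x y => Im (gx x y))) => // u v; by have [] := Hd u v.
Qed.

Lemma Cder_cis_Nphase_x m x y :
  Cder (fun s => cis (- phase m s y)) x (imC (- (2 * PI * IZR m.1)) * cis (- phase m x y))%C.
Proof.
apply: Cder_ext (Cder_eq (Cder_cis (- (2 * PI * IZR m.1)) (- (2 * PI * IZR m.2) * y) x) _).
  by move=> s; rewrite phaseN Rplus_0_r.
by rewrite phaseN Rplus_0_r.
Qed.

Lemma Cder_cis_Nphase_y m x y :
  Cder (fun s => cis (- phase m x s)) y (imC (- (2 * PI * IZR m.2)) * cis (- phase m x y))%C.
Proof.
apply: Cder_ext (Cder_eq (Cder_cis (- (2 * PI * IZR m.2)) (- (2 * PI * IZR m.1) * x) y) _).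
  by move=> s; congr cis; rewrite phaseN; ring.
by congr (_ * cis _)%C; rewrite phaseN; ring.
Qed.

Lemma cis_phase_addx m x y : cis (- phase m (x + 1) y) = cis (- phase m x y).
Proof.
have -> : - phase m (x + 1) y = - phase m x y + 2 * PI * IZR (- m.1) by rewrite /phase opp_IZR; ring.
by rewrite cis_add cis_2PI Cmult_1_r.
Qed.

Lemma cis_phase_addy m x y : cis (- phase m x (y + 1)) = cis (- phase m x y).
Proof.
have -> : - phase m x (y + 1) = - phase m x y + 2 * PI * IZR (- m.2) by rewrite /phase opp_IZR; ring.
by rewrite cis_add cis_2PI Cmult_1_r.
Qed.

(* Integration by parts; the boundary terms cancel by periodicity. *)
Lemma fhat_dx (g gx : R -> R -> C) m :
  (forall x y, Cder (fun s => g s y) x (gx x y)) -> Ccont2 g -> Ccont2 gx ->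
  (forall x y, g (x + 1) y = g x y) -> fhat gx m = (imC (2 * PI * IZR m.1) * fhat g m)%C.
Proof.
move=> Hd Hg Hgx per; set z : C := imC _.
pose e x y := cis (- phase m x y).
have He : Ccont2 e := Ccont2_cis_Nphase m.
have Hge : Ccont2 (fun x y => g x y * e x y)%C by apply: Ccont2_mult.
have Hgxe : Ccont2 (fun x y => gx x y * e x y)%C by apply: Ccont2_mult.
have Hz : Ccont2 (fun x y => - z * (g x y * e x y))%C by apply: Ccont2_mult => //; apply: Ccont2_const.
pose dge x y := (gx x y * e x y + - z * (g x y * e x y))%C.
have Hdge : Ccont2 dge by apply: Ccont2_plus.
have : I2 dge = RtoC 0.
  rewrite /I2 (@CInt_Cder (fun x => CInt (fun y => g x y * e x y)%C 0 1)); first last.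
  - exact: Ccont2_CInt.
  - move=> x; apply: (@Cder_CInt_param (fun x y => g x y * e x y)%C) => // u v.
    apply: Cder_eq (Cder_mult (Hd u v) (Cder_cis_Nphase_x m u v)) _.
    rewrite /dge -/(e u v) /z; rewrite imC_opp; ring.
  rewrite (@CInt_ext (fun y => g 1 y * e 1 y)%C (fun y => g 0 y * e 0 y)%C); first by ring.
  move=> y; rewrite -{1 2}(Rplus_0_l 1) per /e cis_phase_addx //.
rewrite I2_plus // I2_scal // -/(fhat gx m) -/(fhat g m) => E.
have -> : fhat gx m = (fhat gx m + - z * fhat g m + z * fhat g m)%C by ring.
by rewrite E; ring.
Qed.

Lemma fhat_dy (g gy : R -> R -> C) m :
  (forall x y, Cder (g x) y (gy x y)) -> Ccont2 g -> Ccont2 gy ->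
  (forall x y, g x (y + 1) = g x y) -> fhat gy m = (imC (2 * PI * IZR m.2) * fhat g m)%C.
Proof.
move=> Hd Hg Hgy per; set z : C := imC _.
pose e x y := cis (- phase m x y).
have He : Ccont2 e := Ccont2_cis_Nphase m.
have Hge : Ccont2 (fun x y => g x y * e x y)%C by apply: Ccont2_mult.
have Hgye : Ccont2 (fun x y => gy x y * e x y)%C by apply: Ccont2_mult.
have Hz : Ccont2 (fun x y => - z * (g x y * e x y))%C by apply: Ccont2_mult => //; apply: Ccont2_const.
pose dge x y := (gy x y * e x y + - z * (g x y * e x y))%C.
have Hdge : Ccont2 dge by apply: Ccont2_plus.
have : I2 dge = RtoC 0.
  rewrite /I2 (@CInt_ext _ (fun _ => RtoC 0)) ?CInt_0 // => x.
  rewrite (@CInt_Cder (fun y => g x y * e x y)%C); first last.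
  - exact: Ccont2_slice.
  - move=> y; apply: Cder_eq (Cder_mult (Hd x y) (Cder_cis_Nphase_y m x y)) _.
    rewrite /dge -/(e x y) /z; rewrite imC_opp; ring.
  rewrite -{1 2}(Rplus_0_l 1) per /e cis_phase_addy //; ring.
rewrite I2_plus // I2_scal // -/(fhat gy m) -/(fhat g m) => E.
have -> : fhat gy m = (fhat gy m + - z * fhat g m + z * fhat g m)%C by ring.
by rewrite E; ring.
Qed.

Lemma Cmod_CInt_le f a b : a <= b -> Ccont f -> Cmod (CInt f a b) <= RInt (fun s => Cmod (f s)) a b.
Proof.
move=> ab Hf.
have Hc y : continuous (fun s => Cmod (f s)) y.
  have [h1 h2] := Hf y; rewrite /Cmod.
  apply: (continuous_comp (fun s => (f s).1 ^ 2 + (f s).2 ^ 2) sqrt); last exact: continuous_sqrt.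
  have sq u : continuous u y -> continuous (fun s : R => u s ^ 2) y.
    by move=> Hu; apply: (continuous_ext (fun s => u s * u s)) => [s|]; [by rewrite /= Rmult_1_r | apply: (continuous_mult u u)].
  by apply: (continuous_plus (fun s => (f s).1 ^ 2) (fun s => (f s).2 ^ 2)); apply: sq.
have := @Cder_le (fun s => CInt f a s) f (fun s => RInt (fun s => Cmod (f s)) a s) (fun s => Cmod (f s)) a b ab.
rewrite CInt_point RInt_point; have -> : (CInt f a b - RtoC 0 = CInt f a b)%C by ring.
rewrite [X in _ <= X]Rminus_0_r; apply => x _.
- exact: Cder_CInt_upper.
- exact: is_derive_RInt_upper.
- by lra.
Qed.

(** Compactness is used in one variable only: the bound is the maximum over x of the integral of
    |V(x, .)|, a continuous function of x. *)
Lemma fhat_bounded V : cont2 V -> exists B, forall m, Cmod (fhat (fun x y => RtoC (V x y)) m) <= B.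
Proof.
move=> HV.
have Habs : cont2 (fun x y => Rabs (V x y)) by apply: (@cont2_comp Rabs) => // x; apply: Rcontinuity_abs.
pose h (x : R) : R := RInt (fun y => Rabs (V x y)) 0 1.
have hc x : continuous h x by exact: (@cont2_RInt _ x Habs).
have [|c _|xm [Hm _]] := @continuity_ab_maj h 0 1; first by lra.
  by apply/continuity_pt_filterlim; apply: hc.
exists (h xm) => m.
have -> : h xm = h xm * Rabs (1 - 0) by rewrite Rminus_0_r Rabs_R1; ring.
have cc : Ccont2 (fun x y => RtoC (V x y) * cis (- phase m x y))%C.
  by apply: Ccont2_mult; [apply: Ccont2_RtoC | apply: Ccont2_cis_Nphase].
apply: CInt_bound; first by apply: (Ccont2_CInt cc).
move=> x; rewrite Rmin_left ?Rmax_right; [|lra|lra] => Hx.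
apply: Rle_trans (Hm x Hx).
apply: Rle_trans (Cmod_CInt_le _ _) _; first lra.
  by apply: (@Ccont2_slice _ x cc).
apply: Req_le; apply: RInt_extR => y.
by rewrite Cmod_mult Cmod_cis Cmod_R Rmult_1_r.
Qed.

Lemma dR2_periodic V ds : smooth2 V -> periodic2 V -> periodic2 (dR2 ds V).
Proof.
move=> HS HP; elim: ds => [//|b ds IH].
have D (f : R -> R) x : ex_derive f (x + 1) -> (forall s, f (s + 1) = f s) -> Derive f (x + 1) = Derive f x.
  move=> Hf per; symmetry; apply: is_derive_unique.
  apply: (is_derive_ext (fun s => f (s + 1))) => //.
  apply: is_derive_eq (is_derive_comp f (fun s => s + 1) x _ 1 (Derive_correct _ _ Hf) _) _.
    by auto_derive => //; ring.
  by rewrite /scal /= /mult /= Rmult_1_l.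
have [hd _] := HS ds.
move=> x y; case: b => /=; split.
- by apply: D => [|s]; [have [] := hd (x + 1) y | have [] := IH s y].
- by apply: Derive_ext => s; have [] := IH s y.
- by apply: Derive_ext => s; have [] := IH x s.
- by apply: D => [|s]; [have [] := hd x (y + 1) | have [] := IH x s].
Qed.

Lemma dR2_cont2 V ds : smooth2 V -> cont2 (dR2 ds V).
Proof. by move=> H x y; apply/continuity_2d_pt_filterlim; have [_] := H ds; apply. Qed.

Lemma Cder_RtoC (f : R -> R) x l : is_derive f x l -> Cder (fun s => RtoC (f s)) x (RtoC l).
Proof. by move=> H; split => //; apply: (is_derive_const (V := R_NormedModule)). Qed.

Lemma fhat_dR2 V b ds m : smooth2 V -> periodic2 V ->
  Cmod (fhat (fun x y => RtoC (dR2 (b :: ds) V x y)) m) =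
  2 * PI * Rabs (IZR (if b then m.1 else m.2)) * Cmod (fhat (fun x y => RtoC (dR2 ds V x y)) m).
Proof.
move=> HS HP; have [hd _] := HS ds; have per := dR2_periodic ds HS HP.
have c1 := Ccont2_RtoC (dR2_cont2 ds HS); have c2 := Ccont2_RtoC (dR2_cont2 (b :: ds) HS).
have Cm r : Cmod (imC (2 * PI * r)) = 2 * PI * Rabs r.
  have pi0 := PI_RGT_0.
  have -> : imC (2 * PI * r) = (RtoC (2 * PI * r) * Ci)%C by apply: injective_projections => /=; ring.
  rewrite Cmod_mult Cmod_R Rabs_mult (Rabs_pos_eq (2 * PI)); last lra.
  have -> : Cmod Ci = 1 by rewrite /Cmod /= -[RHS]sqrt_1; congr sqrt; ring.
  by rewrite Rmult_1_r.
case: b c2 => c2.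
  rewrite (@fhat_dx (fun x y => RtoC (dR2 ds V x y))) ?Cmod_mult ?Cm //.
  - by move=> x y; apply: Cder_RtoC; apply: Derive_correct; have [] := hd x y.
  - by move=> x y; have [->] := per x y.
rewrite (@fhat_dy (fun x y => RtoC (dR2 ds V x y))) ?Cmod_mult ?Cm //.
- by move=> x y; apply: Cder_RtoC; apply: Derive_correct; have [] := hd x y.
- by move=> x y; have [_ ->] := per x y.
Qed.

(** Telescoping: each of the new terms at N+1 and -(N+1) is at most 2/(N+1) - 2/(N+2). The constant
    5 makes the case N = 0 an equality. *)
Lemma sum_zrange_inv N : \sumR_(x <- zrange N) (/ (1 + IZR x ^ 2)) <= 5 - 4 / (INR N + 1).
Proof.
elim: N => [|N IH].
  by rewrite /zrange /= big_cons big_nil /ofsq /=; lra.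
have -> : \sumR_(x <- zrange N.+1) (/ (1 + IZR x ^ 2)) =
   \sumR_(x <- [:: Z.of_nat N.+1, Z.opp (Z.of_nat N.+1) & zrange N]) (/ (1 + IZR x ^ 2)).
  apply: perm_big; apply: uniq_perm.
  - exact: zrange_uniq.
  - rewrite 2!cons_uniq zrange_uniq inE andbT; apply/andP; split.
      apply/negP => /orP[/eqP|/mem_zrange]; lia.
    apply/negP => /mem_zrange; lia.
  - move=> x; apply/idP/idP.
      move=> /mem_zrange Hx; rewrite 2!in_cons.
      case: (Z.eq_dec x (Z.of_nat N.+1)) => [->|h1]; first by rewrite eqxx.
      case: (Z.eq_dec x (- Z.of_nat N.+1)) => [->|h2]; first by rewrite eqxx orbT.
      by apply/orP; right; apply/orP; right; apply/mem_zrange; lia.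
    rewrite 2!in_cons => /orP[/eqP ->|/orP[/eqP ->|/mem_zrange Hx]]; apply/mem_zrange; lia.
rewrite 2!big_cons opp_IZR -INR_IZR_INZ S_INR.
set S := \big[_/_]_(_ <- _) _ in IH *.
have n0 := pos_INR N; set n := INR N in IH n0 *.
have h : / (1 + (n + 1) ^ 2) <= 2 / (n + 1) - 2 / (n + 1 + 1).
  have -> : 2 / (n + 1) - 2 / (n + 1 + 1) = / ((n + 1) * (n + 1 + 1) / 2) by field; lra.
  by apply: Rinv_le_contravar; nra.
have -> : (- (n + 1)) ^ 2 = (n + 1) ^ 2 by ring.
have e2 : 4 / (n + 1) = 2 * (2 / (n + 1)) by field; lra.
rewrite e2 in IH.
have -> : 4 / (n + 1 + 1) = 2 * (2 / (n + 1 + 1)) by field; lra.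
lra.
Qed.

Lemma sum_box_prod (u v : Z -> R) N :
  \sumR_(k <- box N) (u k.1 * v k.2) = (\sumR_(x <- zrange N) u x) * (\sumR_(y <- zrange N) v y).
Proof.
have H (l l' : seq Z) : \sumR_(x <- l) (\sumR_(y <- l') (u x * v y)) =
    (\sumR_(x <- l) u x) * (\sumR_(y <- l') v y).
  elim: l => [|a l IH]; first by rewrite !big_nil Rmult_0_l.
  by rewrite !big_cons IH -rsum_scal_l; ring.
by rewrite /box big_allpairs /= -H.
Qed.

(** Bounds on the coefficients of V, of its second derivatives in x and in y, and of the mixed
    fourth derivative are the four terms of (1 + m1^2)(1 + m2^2); the resulting majorant is a
    product, summed one coordinate at a time. *)
Lemma fhat_summable V : smooth2 V -> periodic2 V ->
  exists A, forall L, uniq L -> \sumR_(m <- L) Cmod (fhat (fun x y => RtoC (V x y)) m) <= A.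
Proof.
move=> HS HP.
have bd ds : exists B, forall m, Cmod (fhat (fun x y => RtoC (dR2 ds V x y)) m) <= B.
  by apply: fhat_bounded; apply: dR2_cont2.
have [B0 H0] := bd [::]; have [B1 H1] := bd [:: true; true].
have [B2 H2] := bd [:: false; false]; have [B3 H3] := bd [:: true; true; false; false].
pose B := B0 + B1 + B2 + B3.
have main m : Cmod (fhat (fun x y => RtoC (V x y)) m) <= B * (/ (1 + IZR m.1 ^ 2) * / (1 + IZR m.2 ^ 2)).
  have := H3 m; have := H2 m; have := H1 m; have := H0 m.
  rewrite (fhat_dR2 true [:: true] m HS HP) (fhat_dR2 true [::] m HS HP).
  rewrite (fhat_dR2 false [:: false] m HS HP) (fhat_dR2 false [::] m HS HP).
  rewrite (fhat_dR2 true [:: true; false; false] m HS HP) (fhat_dR2 true [:: false; false] m HS HP).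
  rewrite (fhat_dR2 false [:: false] m HS HP) (fhat_dR2 false [::] m HS HP).
  have := Cmod_ge_0 (fhat (fun x y => RtoC (dR2 [::] V x y)) m).
  change (fhat (fun x y => RtoC (dR2 [::] V x y)) m) with (fhat (fun x y => RtoC (V x y)) m).
  set c := Cmod _ => c0.
  have pi1 : 1 <= 2 * PI by have := PI2_1; lra.
  have a0 := Rabs_pos (IZR m.1); have b0 := Rabs_pos (IZR m.2).
  rewrite -(pow2_abs (IZR m.1)) -(pow2_abs (IZR m.2)).
  set a := Rabs (IZR m.1) in a0 *; set b := Rabs (IZR m.2) in b0 *; set p := 2 * PI in pi1 *.
  have p2 x y : 0 <= x -> 0 <= y -> x * x * y <= p * x * (p * x * y).
    move=> x0 y0; have -> : p * x * (p * x * y) = (p * p) * (x * x * y) by ring.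
    have h : 0 <= x * x * y by apply: Rmult_le_pos => //; apply: Rmult_le_pos.
    have hp : 1 <= p * p by nra.
    by nra.
  move=> h0 h1 h2 h3.
  have k1 := p2 a c a0 c0; have k2 := p2 b c b0 c0.
  have k3 : a * a * (b * b * c) <= B3.
    apply: Rle_trans h3; apply: Rle_trans (p2 a _ a0 _).
      by apply: Rmult_le_compat_l => //; nra.
    by apply: Rmult_le_pos; [nra | apply: Rmult_le_pos; [nra|lra]].
  apply: (Rmult_le_reg_r ((1 + a ^ 2) * (1 + b ^ 2))); first by nra.
  have -> : B * (/ (1 + a ^ 2) * / (1 + b ^ 2)) * ((1 + a ^ 2) * (1 + b ^ 2)) = B by field; nra.
  rewrite /B; nra.
exists (B * (5 * 5)) => L uL.
have B0' : 0 <= B.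
  have := main (0, 0)%ZZ; have := Cmod_ge_0 (fhat (fun x y => RtoC (V x y)) (0, 0)%ZZ) => /=; lra.
have [N HN] := subset_box L.
apply: Rle_trans (rsum_subset _ uL HN) _ => [k|]; first exact: Cmod_ge_0.
apply: Rle_trans (rsum_le _ main) _; rewrite -rsum_scal_l.
apply: Rmult_le_compat_l => //.
rewrite (sum_box_prod (fun x => / (1 + IZR x ^ 2)) (fun x => / (1 + IZR x ^ 2))).
have h := sum_zrange_inv N.
have h' : \sumR_(x <- zrange N) (/ (1 + IZR x ^ 2)) <= 5.
  apply: Rle_trans h _; have := pos_INR N => n0.
  have : 0 < 4 / (INR N + 1) by apply: Rdiv_lt_0_compat; lra.
  lra.
have h0 : 0 <= \sumR_(x <- zrange N) (/ (1 + IZR x ^ 2)).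
  by apply: rsum_ge0 => k; apply: Rlt_le; apply: Rinv_0_lt_compat; nra.
by apply: Rmult_le_compat.
Qed.

(** * Fourier inversion *)

Lemma usum_tail (g : Z2 -> R) A : (forall k, 0 <= g k) ->
  (forall L, uniq L -> \sumR_(k <- L) g k <= A) ->
  forall e, 0 < e -> exists N, forall n, (N <= n)%N -> forall L, uniq L ->
    (forall k, k \in L -> k \notin box n) -> \sumR_(k <- L) g k <= e.
Proof.
move=> g0 HA e e0.
have [||G HG] := @ex_finite_lim_seq_incr (fun n => \sumR_(k <- box n) g k) A.
- by move=> n; apply: rsum_subset => //; [exact: box_uniq | apply: box_subset].
- by move=> n; apply: HA; exact: box_uniq.
have incr n : \sumR_(k <- box n) g k <= \sumR_(k <- box n.+1) g k.
  by apply: rsum_subset => //; [exact: box_uniq | apply: box_subset].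
have HGle N : \sumR_(k <- box N) g k <= G by apply: (is_lim_seq_incr_compare _ _ HG incr).
move/is_lim_seq_spec: (HG) => /(_ (mkposreal _ e0)) [N HN].
exists N => n Hn L uL Ld.
have /= := HN n; move/leP: Hn => Hn /(_ Hn)/Rabs_def2 [_ h].
have [N' HN'] := subset_box (box n ++ L).
have u : uniq (box n ++ L).
  rewrite cat_uniq box_uniq uL andbT /=; apply/hasPn => x xL; exact: Ld.
have := Rle_trans _ _ _ (rsum_subset g0 u HN') (HGle N').
rewrite big_cat /=.
set X := \big[Rplus/0]_(k <- box n) _ in h *; set Y := \big[Rplus/0]_(k <- L) _ => h2.
rewrite -/X in h; lra.
Qed.

(** * Uniqueness of Fourier coefficients in one variable *)

Section Uniqueness.
Variable f : R -> C.
Hypothesis fc : Ccont f.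
Hypothesis fper : forall s, f (s + 1) = f s.

Let Z (h : R -> C) := Ccont h /\ forall n, CInt (fun s => h s * cis (2 * PI * IZR n * s + 0))%C 0 1 = RtoC 0.

(** Multiplication by a cosine of period 1 only moves frequencies by one, so vanishing of all
    coefficients is preserved; iterating allows powers of a trigonometric polynomial. *)
Lemma coef_zero_mult_cos (h : R -> C) a b : Z h ->
  Z (fun s => h s * RtoC (a + Rtrigo_def.cos (2 * PI * s + b)))%C.
Proof.
move=> [hc Hh].
have E s n : (h s * RtoC (a + Rtrigo_def.cos (2 * PI * s + b)) * cis (2 * PI * IZR n * s + 0) =
   RtoC a * (h s * cis (2 * PI * IZR n * s + 0)) +
   ((RtoC (/ 2) * cis b) * (h s * cis (2 * PI * IZR (n + 1) * s + 0)) +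
    (RtoC (/ 2) * cis (- b)) * (h s * cis (2 * PI * IZR (n - 1) * s + 0))))%C.
  have E1 : cis (2 * PI * IZR (n + 1) * s + 0) = (cis (2 * PI * IZR n * s + 0) * cis (2 * PI * s))%C.
    by rewrite -cis_add; congr cis; rewrite plus_IZR; ring.
  have E2 : cis (2 * PI * IZR (n - 1) * s + 0) = (cis (2 * PI * IZR n * s + 0) * cis (- (2 * PI * s)))%C.
    by rewrite -cis_add; congr cis; rewrite minus_IZR; ring.
  have E3 : RtoC (Rtrigo_def.cos (2 * PI * s + b)) =
      (RtoC (/ 2) * (cis b * cis (2 * PI * s) + cis (- b) * cis (- (2 * PI * s))))%C.
    rewrite -!cis_add; have -> : - b + - (2 * PI * s) = - (b + 2 * PI * s) by ring.
    rewrite /cis cos_neg sin_neg Rplus_comm; apply: injective_projections => /=; field.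
  by rewrite RtoC_plus E3 E1 E2; ring.
have cc n : Ccont (fun s => h s * cis (2 * PI * IZR n * s + 0))%C.
  by apply: Ccont_mult => //; apply: Ccont_cis.
have cs c n : Ccont (fun s => c * (h s * cis (2 * PI * IZR n * s + 0)))%C.
  by apply: Ccont_mult; [apply: Ccont_const | apply: cc].
split.
  apply: Ccont_mult => // x; split; last exact: continuous_const.
  apply: (continuous_plus (fun _ => a)); first exact: continuous_const.
  by have [] := Ccont_cis (2 * PI) b x.
move=> n; rewrite (CInt_ext _ _ (fun s => E s n)) !CInt_plus //; last by apply: Ccont_plus.
by rewrite !CInt_scal // !Hh; ring.
Qed.

Lemma coef_zero_mult_pow (h : R -> C) a b q : Z h ->
  Z (fun s => h s * RtoC ((a + Rtrigo_def.cos (2 * PI * s + b)) ^ q))%C.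
Proof.
move=> Hh; elim: q => [|q IH].
  by have -> : (fun s => h s * RtoC ((a + Rtrigo_def.cos (2 * PI * s + b)) ^ 0))%C = h
    by apply: funext => s /=; ring.
have -> : (fun s => h s * RtoC ((a + Rtrigo_def.cos (2 * PI * s + b)) ^ q.+1))%C =
  (fun s => h s * RtoC ((a + Rtrigo_def.cos (2 * PI * s + b)) ^ q) * RtoC (a + Rtrigo_def.cos (2 * PI * s + b)))%C.
  by apply: funext => s; rewrite -tech_pow_Rmult RtoC_mult; ring.
exact: coef_zero_mult_cos.
Qed.

Hypothesis fZ : forall n, CInt (fun s => f s * cis (2 * PI * IZR n * s + 0))%C 0 1 = RtoC 0.

(* If f x0 <> 0, the powers of a trigonometric polynomial that exceeds 1 only near
   x0 concentrate the integral there, contradicting the vanishing of all moments. *)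
Lemma coef_zero_interior x0 : 0 < x0 < 1 -> f x0 = RtoC 0.
Proof.
move=> x01; apply: contrapT => fx0.
pose g s := (Cconj (f x0) * f s)%C.
have Zg : Z g.
  split; first by apply: Ccont_mult => //; apply: Ccont_const.
  move=> n; rewrite -(Cmult_0_r (Cconj (f x0))) -(fZ n) -CInt_scal.
    by apply: CInt_ext => s; rewrite /g; ring.
  by apply: Ccont_mult => //; apply: Ccont_cis.
pose r s := Re (g s).
have rc x : continuous r x by have [gc _] := Zg; have [] := gc x.
have r0 : 0 < r x0.
  have -> : r x0 = Cmod (f x0) ^ 2.
    rewrite /Cmod pow2_sqrt; last by nra.
    by rewrite /r /g /Re /=; ring.
  have : 0 < Cmod (f x0) by apply/Cmod_gt_0.
  by move=> h; nra.
pose c := r x0 / 2; have c0 : 0 < c by rewrite /c; lra.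
have [d0 Hd0] : exists d : posreal, forall s, Rabs (s - x0) < d -> c <= r s.
  have /continuity_pt_filterlim/continuity_pt_locally := rc x0.
  move=> /(_ (mkposreal _ c0)) [d Hd]; exists d => s Hs.
  have /= := Hd s Hs; move=> /Rabs_def2; rewrite /c; lra.
pose d := Rmin (d0 / 2) (Rmin (x0 / 2) ((1 - x0) / 2)).
have dpos : 0 < d by rewrite /d; repeat apply: Rmin_pos; have := cond_pos d0; lra.
have dd0 : d < d0 by have := Rmin_l (d0 / 2) (Rmin (x0 / 2) ((1 - x0) / 2)); have := cond_pos d0; rewrite -/d; lra.
have dx0 : d <= x0 / 2.
  by apply: Rle_trans (Rmin_r _ _) _; apply: Rmin_l.
have dx1 : d <= (1 - x0) / 2.
  by apply: Rle_trans (Rmin_r _ _) _; apply: Rmin_r.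
(* [T] equals 1 exactly at distance [d] from [x0]: it stays in [-1, 1] farther away, is at least 1
   closer, and at least [q] > 1 within distance d/2. *)
pose a := 1 - Rtrigo_def.cos (2 * PI * d).
pose T s := a + Rtrigo_def.cos (2 * PI * s + - (2 * PI * x0)).
pose q := 1 - Rtrigo_def.cos (2 * PI * d) + Rtrigo_def.cos (PI * d).
have pi0 := PI_RGT_0.
have q1 : 1 < q.
  have : Rtrigo_def.cos (2 * PI * d) < Rtrigo_def.cos (PI * d) by apply: cos_decreasing_1; nra.
  by rewrite /q; lra.
have a0 : 0 <= a by rewrite /a; have [_] := COS_bound (2 * PI * d); lra.
have cosabs s : Rtrigo_def.cos (2 * PI * s + - (2 * PI * x0)) = Rtrigo_def.cos (2 * PI * Rabs (s - x0)).
  have -> : 2 * PI * s + - (2 * PI * x0) = 2 * PI * (s - x0) by ring.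
  by rewrite /Rabs; case: Rcase_abs => _ //; rewrite -cos_neg; congr Rtrigo_def.cos; ring.
have Tout s : 0 <= s <= 1 -> d <= Rabs (s - x0) -> Rabs (T s) <= 1.
  move=> Hs Hd; rewrite /T cosabs.
  have ub : Rtrigo_def.cos (2 * PI * Rabs (s - x0)) <= Rtrigo_def.cos (2 * PI * d).
    have h1 : Rabs (s - x0) <= 1 - d by apply: Rabs_le; lra.
    case: (Rle_dec (Rabs (s - x0)) (1 / 2)) => h2.
      by apply: cos_decr_1; nra.
    (* Beyond 1/2 the distance is folded by periodicity; it remains at least [d] because [d] is at
       most half the distance from [x0] to either end of the interval. *)
    have -> : Rtrigo_def.cos (2 * PI * Rabs (s - x0)) = Rtrigo_def.cos (2 * PI * (1 - Rabs (s - x0))).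
      by rewrite Rmult_minus_distr_l Rmult_1_r cos_minus cos_2PI sin_2PI; ring.
    by apply: cos_decr_1; nra.
  have [lb _] := COS_bound (2 * PI * Rabs (s - x0)).
  by apply: Rabs_le; rewrite /a in a0 *; lra.
have Tin s : Rabs (s - x0) <= d -> 1 <= T s.
  move=> Hs; rewrite /T cosabs /a; have := Rabs_pos (s - x0) => h.
  have : Rtrigo_def.cos (2 * PI * d) <= Rtrigo_def.cos (2 * PI * Rabs (s - x0)) by apply: cos_decr_1; nra.
  by lra.
have Tin2 s : Rabs (s - x0) <= d / 2 -> q <= T s.
  move=> Hs; rewrite /T cosabs /a /q; have := Rabs_pos (s - x0) => h.
  have : Rtrigo_def.cos (PI * d) <= Rtrigo_def.cos (2 * PI * Rabs (s - x0)) by apply: cos_decr_1; nra.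
  by lra.
have [M HM] : exists M, forall s, 0 <= s <= 1 -> Rabs (r s) <= M.
  have [|s _|xm [Hm _]] := @continuity_ab_maj (fun s => Rabs (r s)) 0 1; first by lra.
    apply/continuity_pt_filterlim; apply: (continuous_comp r Rabs) => //; exact: continuous_Rabs.
  by exists (Rabs (r xm)).
have M0 : 0 <= M by apply: Rle_trans (HM 0 _); [apply: Rabs_pos | lra].
have low n s : 0 <= s <= 1 -> - M <= r s * T s ^ n.
  move=> Hs; case: (Rle_dec d (Rabs (s - x0))) => Hd.
    have h : Rabs (r s * T s ^ n) <= M.
      rewrite Rabs_mult -RPow_abs -(Rmult_1_r M); apply: Rmult_le_compat; try exact: Rabs_pos.
      - by apply: pow_le; apply: Rabs_pos.
      - exact: HM.
      - by rewrite -(pow1 n); apply: pow_incr; split; [apply: Rabs_pos | apply: Tout].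
    by move: h => /Rabs_le_between; lra.
  have h1 : 0 < r s by apply: Rlt_le_trans c0 _; apply: Hd0; lra.
  have h2 : 0 <= T s ^ n by apply: pow_le; have := Tin s; lra.
  by have := Rmult_le_pos _ _ (Rlt_le _ _ h1) h2; lra.
have low2 n s : Rabs (s - x0) <= d / 2 -> c * q ^ n <= r s * T s ^ n.
  move=> Hs; apply: Rmult_le_compat; try lra.
  - by apply: pow_le; lra.
  - by apply: Hd0; lra.
  - by apply: pow_incr; have := Tin2 s Hs; lra.
have Tc n x : continuous (fun s => r s * T s ^ n) x.
  apply: (continuous_mult r (fun s => T s ^ n)) => //.
  have : ex_derive (fun s => T s ^ n) x by rewrite /T; auto_derive.
  exact: ex_derive_continuous.
have int0 n : RInt (fun s => r s * T s ^ n) 0 1 = 0.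
  have [_ /(_ 0%ZZ) h] := coef_zero_mult_pow a (- (2 * PI * x0)) n Zg.
  transitivity (Re (RtoC 0)); last by [].
  rewrite -h; apply: RInt_extR => s.
  have -> : 2 * PI * IZR 0 * s + 0 = 0 by ring.
  rewrite cis0 Cmult_1_r /r /T /Re /=; ring.
have ex n u v : ex_RInt (fun s => r s * T s ^ n) u v by apply: ex_RInt_Rcont.
(* The middle interval has length [d] and contributes at least c q^n d, the rest at least -M. Since
   the total vanishes, q^n stays bounded, which is absurd. *)
have key n : c * q ^ n * d <= M.
  pose u := x0 - d / 2; pose v := x0 + d / 2.
  have := RInt_Chasles (fun s => r s * T s ^ n) 0 u 1 (ex n _ _) (ex n _ _).
  have := RInt_Chasles (fun s => r s * T s ^ n) u v 1 (ex n _ _) (ex n _ _).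
  rewrite int0 /plus /=.
  have lowI x y : 0 <= x -> x <= y -> y <= 1 -> (y - x) * - M <= RInt (fun s => r s * T s ^ n) x y.
    move=> x0' xy y1; have -> : (y - x) * - M = RInt (fun _ => - M) x y.
      by rewrite RInt_const.
    apply: RInt_le => //; first exact: ex_RInt_const.
    by move=> s Hs; apply: low; lra.
  have lowI2 : (v - u) * (c * q ^ n) <= RInt (fun s => r s * T s ^ n) u v.
    have -> : (v - u) * (c * q ^ n) = RInt (fun _ => c * q ^ n) u v.
      by rewrite RInt_const.
    apply: RInt_le; rewrite /u /v; try lra; try exact: ex_RInt_const; try exact: ex.
    by move=> s Hs; apply: low2; apply: Rabs_le; lra.
  have := lowI 0 u; have := lowI v 1; rewrite /u /v in lowI2 *.
  set I1 := RInt _ _ _; set I2 := RInt _ _ _; set I3 := RInt _ _ _ in lowI2 *; nra.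
have q1' : Rabs q > 1 by rewrite Rabs_pos_eq; lra.
have [n Hn] := Pow_x_infinity q q1' (M / (c * d) + 1).
have := Hn n (le_n _); rewrite Rabs_pos_eq; last by apply: pow_le; lra.
have cd : 0 < c * d by apply: Rmult_lt_0_compat.
move=> h; have := key n.
have : c * d * (M / (c * d) + 1) <= c * d * q ^ n by apply: Rmult_le_compat_l; lra.
have -> : c * d * (M / (c * d) + 1) = M + c * d by field; lra.
lra.
Qed.

(** Periodicity reduces to [0, 1); the point 0, where the concentration argument has no room on the
    left, is reached by continuity. *)
Lemma coef_zero_eq0 x : f x = RtoC 0.
Proof.
have nat_shift k y : f (y + INR k) = f y.
  elim: k => [|k IH]; first by rewrite /= Rplus_0_r.
  by rewrite S_INR -Rplus_assoc fper IH.
have Z_shift n y : f (y + IZR n) = f y.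
  case: (Z_le_dec 0 n) => Hn; first by rewrite -(Z2Nat.id n) // -INR_IZR_INZ nat_shift.
  have := nat_shift (Z.to_nat (- n)) (y + IZR n).
  rewrite INR_IZR_INZ Z2Nat.id ?opp_IZR; last lia.
  by have -> : y + IZR n + - IZR n = y by ring.
have lim0 (r : R -> R) : continuous r 0 -> (forall s, 0 < s < 1 -> r s = 0) -> r 0 = 0.
  move=> /continuity_pt_filterlim/continuity_pt_locally Hc Hr; apply: contrapT => r0.
  have p : 0 < Rabs (r 0) by apply: Rabs_pos_lt.
  have [d Hd] := Hc (mkposreal _ p); have d0 := cond_pos d.
  have m1 := Rmin_l (d / 2) (1 / 2); have m2 := Rmin_r (d / 2) (1 / 2).
  have m0 : 0 < Rmin (d / 2) (1 / 2) by apply: Rmin_pos; lra.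
  have := Hd (Rmin (d / 2) (1 / 2)); rewrite Hr /=; last lra.
  have -> : 0 - r 0 = - r 0 by ring.
  rewrite Rabs_Ropp /ball /= /AbsRing_ball /abs /minus /plus /opp /= => h.
  have : Rabs (r 0) < Rabs (r 0) by apply: h; apply: Rabs_def1; lra.
  lra.
have [h1 h2] := archimed x.
have -> : x = (x - IZR (up x - 1)) + IZR (up x - 1) by ring.
rewrite Z_shift; set y := x - _.
have y1 : 0 <= y < 1 by rewrite /y minus_IZR; lra.
case: (Req_dec y 0) => [->|y0]; last by apply: coef_zero_interior; lra.
have [c1 c2] := fc 0.
by apply: injective_projections; [apply: (lim0 (fun s => Re (f s))) | apply: (lim0 (fun s => Im (f s)))] => // s /coef_zero_interior ->.
Qed.
End Uniqueness.

Lemma cis_phase_split m x y : cis (- phase m x y) =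
  (cis (2 * PI * IZR (- m.1) * x + 0) * cis (2 * PI * IZR (- m.2) * y + 0))%C.
Proof. by rewrite -cis_add; congr cis; rewrite /phase !opp_IZR; ring. Qed.

(** One-variable uniqueness is used twice: in x for each partial coefficient in y, which is
    therefore zero, and then in y for each slice of [f]. *)
Lemma fhat_eq0 (f : R -> R -> C) : Ccont2 f ->
  (forall x y, f (x + 1) y = f x y) -> (forall x y, f x (y + 1) = f x y) ->
  (forall m, fhat f m = RtoC 0) -> forall x y, f x y = RtoC 0.
Proof.
move=> fc px py Hf.
pose G n x := CInt (fun y => f x y * cis (2 * PI * IZR n * y + 0))%C 0 1.
have cG n : Ccont2 (fun x y => f x y * cis (2 * PI * IZR n * y + 0))%C.
  apply: Ccont2_mult => //; apply: Ccont2_ext (Ccont2_cis 0 (2 * PI * IZR n) 0) => x y.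
  by congr cis; ring.
have G0 n x : G n x = RtoC 0.
  apply: (@coef_zero_eq0 (G n)).
  - exact: Ccont2_CInt (cG n).
  - by move=> s; apply: CInt_ext => y; rewrite px.
  - move=> m; rewrite -(Hf (Z.opp m, Z.opp n)); apply: CInt_ext => s.
    rewrite Cmult_comm -CInt_scal; last exact: (@Ccont2_slice _ s (cG n)).
    by apply: CInt_ext => y; rewrite cis_phase_split /= !Z.opp_involutive; ring.
move=> x y; apply: (@coef_zero_eq0 (f x)).
- exact: Ccont2_slice.
- exact: py.
- by move=> n; apply: G0.
Qed.

(** Weierstrass test: the tail is bounded by that of |c|, which is independent of the point. *)
Lemma usum_em_cont (c : Z2 -> C) (l : R -> R -> C) A :
  (forall L, uniq L -> \sumR_(m <- L) Cmod (c m) <= A) ->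
  (forall x y, usum (fun m => c m * cis (phase m x y))%C (l x y)) ->
  forall e, 0 < e -> exists N, forall n, (N <= n)%N -> forall x y,
    Cmod (l x y - \sumC_(m <- box n) (c m * cis (phase m x y)))%C <= e.
Proof.
move=> HA Hl e e0.
have [N HN] := usum_tail (fun m => Cmod_ge_0 (c m)) HA e0.
exists N => n Hn x y; apply: le_epsilon => e' e'0.
have [N' HN'] := Hl x y e' e'0.
pose q := maxn n N'.
have sub : {subset box N' <= box q} by apply: box_subset; rewrite /q; lia.
have := HN' (box q) (box_uniq q) sub.
have sub2 : {subset box n <= box q} by apply: box_subset; rewrite /q; lia.
rewrite (csum_subset_diff _ (box_uniq n) (box_uniq q) sub2).
set X := \big[_/_]_(_ <- box n) _; set Y := \big[_/_]_(_ <- _) _ => h.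
have -> : (l x y - X = (- (X + Y - l x y)) + Y)%C by ring.
apply: Rle_trans (Cmod_triangle _ _) _; rewrite Cmod_opp Rplus_comm.
apply: Rplus_le_compat => //.
apply: Rle_trans (Cmod_csum _ _) _.
apply: (Rle_trans _ (\sumR_(m <- [seq m <- box q | m \notin box n]) Cmod (c m))).
  by apply: rsum_le => m; rewrite Cmod_mult Cmod_cis; lra.
apply: (HN n Hn); first by rewrite filter_uniq // box_uniq.
by move=> k; rewrite mem_filter => /andP[].
Qed.

Lemma phase_sub m k x y : phase m x y + - phase k x y = phase (Z2sub m k) x y.
Proof. by rewrite /phase /Z2sub /= !minus_IZR; ring. Qed.

Lemma Z2sub_eq0 (m k : Z2) : (Z2sub m k == (0%ZZ, 0%ZZ)) = (m == k).
Proof.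
apply/eqP/eqP => [|->]; last by rewrite /Z2sub !Z.sub_diag.
by case: m k => a b [c d] [] /= h1 h2; congr pair; lia.
Qed.

(** The series converges uniformly to a continuous periodic function with the coefficients of V; the
    difference with V has zero coefficients, hence vanishes. *)
Lemma fourier_inversion V x y : smooth2 V -> periodic2 V ->
  usum (fun m => fourier2 V m * cis (phase m x y))%C (RtoC (V x y)).
Proof.
move=> HS HP; have HV : cont2 V := dR2_cont2 [::] HS.
have [A HA] := fhat_summable HS HP.
pose c m := fourier2 V m.
have HA' L : uniq L -> \sumR_(m <- L) Cmod (c m) <= A.
  by move=> uL; rewrite /c; under eq_bigr => m _ do rewrite fourier2E //; exact: HA.
pose l u v := zsumC (fun m => c m * cis (phase m u v))%C.
have Hl u v : usum (fun m => c m * cis (phase m u v))%C (l u v).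
  have [||z Hz] := @usum_dominated (fun m => c m * cis (phase m u v))%C (fun m => Cmod (c m)) A.
  - by move=> m; rewrite Cmod_mult Cmod_cis; lra.
  - by move=> N; apply: HA'; exact: box_uniq.
  by rewrite /l (usum_zsumC Hz).
have unif := usum_em_cont HA' Hl.
pose S n u v := \sumC_(m <- box n) (c m * cis (phase m u v)).
have Sc n : Ccont2 (S n).
  by apply: Ccont2_big => m; apply: Ccont2_mult; [apply: Ccont2_const | apply: Ccont2_cis_phase].
have lc : Ccont2 l.
  by apply: Ccont2_unif_lim => e /unif [N HN]; exists (S N) => // u v; apply: HN.
pose f u v := (RtoC (V u v) + RtoC (-1) * l u v)%C.
have l1c : Ccont2 (fun u v => RtoC (-1) * l u v)%C by apply: Ccont2_mult => //; apply: Ccont2_const.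
have fc : Ccont2 f by apply: Ccont2_plus => //; apply: Ccont2_RtoC.
have cper m u v : cis (phase m (u + 1) v) = cis (phase m u v) /\ cis (phase m u (v + 1)) = cis (phase m u v).
  have e1 : phase m (u + 1) v = phase m u v + 2 * PI * IZR m.1 by rewrite /phase; ring.
  have e2 : phase m u (v + 1) = phase m u v + 2 * PI * IZR m.2 by rewrite /phase; ring.
  by rewrite e1 e2 !cis_add !cis_2PI !Cmult_1_r.
have fhatS n k : k \in box n -> fhat (S n) k = c k.
  move=> kn; rewrite /fhat.
  have -> : I2 (fun u v => S n u v * cis (- phase k u v))%C =
      I2 (fun u v => \sumC_(m <- box n) (c m * cis (phase (Z2sub m k) u v))).
    apply: I2_ext => u v; rewrite Cmult_comm /S csum_scal_l; apply: eq_bigr => m _.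
    by rewrite -phase_sub cis_add; ring.
  rewrite I2_big; last first.
    by move=> m; apply: Ccont2_mult; [apply: Ccont2_const | apply: Ccont2_cis_phase].
  rewrite (bigD1_seq k) ?box_uniq //= I2_scal; last exact: Ccont2_cis_phase.
  rewrite I2_cis_phase Z2sub_eq0 eqxx big1; first by ring.
  move=> m mk; rewrite I2_scal; last exact: Ccont2_cis_phase.
  by rewrite I2_cis_phase Z2sub_eq0 (negbTE mk); ring.
have fl k : fhat l k = c k.
  have [N0 HN0] := subset_box [:: k].
  have : Cmod (fhat l k - c k)%C <= 0.
    apply: le_epsilon => e e0; rewrite Rplus_0_l.
    have [N HN] := unif e e0; pose n := maxn N N0.
    have kn : k \in box n.
      by apply: (@box_subset N0); [rewrite /n; lia | apply: HN0; rewrite inE].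
    have ec := Ccont2_cis_Nphase k.
    have -> : (fhat l k - c k = I2 (fun u v => (l u v + RtoC (-1) * S n u v) * cis (- phase k u v)))%C.
      have c1 : Ccont2 (fun u v => l u v * cis (- phase k u v))%C by apply: Ccont2_mult.
      have c2 : Ccont2 (fun u v => S n u v * cis (- phase k u v))%C by apply: Ccont2_mult.
      have c3 : Ccont2 (fun u v => RtoC (-1) * (S n u v * cis (- phase k u v)))%C.
        by apply: Ccont2_mult => //; apply: Ccont2_const.
      have -> : c k = fhat (S n) k by rewrite fhatS.
      rewrite (I2_ext (g := fun u v => l u v * cis (- phase k u v) + RtoC (-1) * (S n u v * cis (- phase k u v)))%C).
        rewrite I2_plus // I2_scal // /fhat; ring.
      by move=> u v; ring.
    apply: I2_bound.
      apply: Ccont2_mult => //; apply: Ccont2_plus => //; apply: Ccont2_mult => //; exact: Ccont2_const.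
    move=> u v; rewrite Cmod_mult Cmod_cis Rmult_1_r.
    have -> : (l u v + RtoC (-1) * S n u v = l u v - S n u v)%C by ring.
    by apply: HN; rewrite /n; lia.
  move=> h; have h0 := Cmod_ge_0 (fhat l k - c k)%C.
  have : (fhat l k - c k)%C = RtoC 0 by apply: Cmod_eq_0; lra.
  by move=> h1; rewrite -(Cplus_0_l (c k)) -h1; ring.
have lper u v : l (u + 1) v = l u v /\ l u (v + 1) = l u v.
  by split; congr zsumC; apply: funext => m; have [h1 h2] := cper m u v; rewrite ?h1 ?h2.
have f0 := @fhat_eq0 f fc _ _ _ x y.
have : f x y = RtoC 0.
  apply: f0 => [u v|u v|k]; rewrite /f.
  - by have [-> _] := lper u v; have [-> _] := HP u v.
  - by have [_ ->] := lper u v; have [_ ->] := HP u v.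
  have ec := Ccont2_cis_Nphase k; have Vc := Ccont2_RtoC HV.
  have c1 : Ccont2 (fun u v => l u v * cis (- phase k u v))%C by apply: Ccont2_mult.
  rewrite /fhat (I2_ext (g := fun u v => RtoC (V u v) * cis (- phase k u v) + RtoC (-1) * (l u v * cis (- phase k u v)))%C).
    rewrite I2_plus; first last.
    - by apply: Ccont2_mult => //; apply: Ccont2_const.
    - by apply: Ccont2_mult.
    by rewrite I2_scal // -/(fhat l k) fl /c fourier2E // /fhat; ring.
  by move=> u v; ring.
rewrite /f => h; have -> : RtoC (V x y) = l x y.
  by rewrite -(Cplus_0_l (l x y)) -h; ring.
exact: Hl.
Qed.

(** * Iterated oscillatory integrals *)

(* [Iw t [:: o1; ..; on] s] is the integral of exp(i(o1 s1 + .. + on sn)) over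
   s < s1 < .. < sn < t; these are the coefficients of the Dyson expansion. *)
Fixpoint Iw (t : R) (w : seq R) (s : R) : C :=
  match w with
  | [::] => RtoC 1
  | o :: w' => CInt (fun sg => cis (o * sg + 0) * Iw t w' sg)%C s t
  end.

Lemma Iw_cont t w : Ccont (Iw t w).
Proof.
elim: w => [|o w IH] /=; first exact: Ccont_const.
apply: (@Cder_cont _ (fun s => - (cis (o * s + 0) * Iw t w s))%C) => s.
by apply: Cder_CInt_lower; apply: Ccont_mult => //; apply: Ccont_cis.
Qed.

Lemma Iw_step_cont t o w : Ccont (fun sg => cis (o * sg + 0) * Iw t w sg)%C.
Proof. by apply: Ccont_mult; [apply: Ccont_cis | apply: Iw_cont]. Qed.

Lemma Cder_Iw t o w s : Cder (Iw t (o :: w)) s (- (cis (o * s + 0) * Iw t w s))%C.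
Proof. by apply: Cder_CInt_lower; apply: Iw_step_cont. Qed.

Lemma Iw_end t o w : Iw t (o :: w) t = RtoC 0.
Proof. by rewrite /= CInt_point. Qed.

Lemma is_derive_powfact (n : nat) (a b x : R) :
  is_derive (fun s => (a * s + b) ^ n.+1 / INR (fact n.+1)) x (a * ((a * x + b) ^ n / INR (fact n))).
Proof.
have f0 := INR_fact_neq_0 n; have n0 : INR n.+1 <> 0 by apply: not_0_INR.
have h : is_derive (fun s => a * s + b) x a by auto_derive => //; ring.
apply: is_derive_eq (is_derive_ext _ _ _ _ _ (is_derive_scal _ _ (/ INR (fact n.+1)) _ (is_derive_pow _ n.+1 _ _ h))) _.
  by move=> s; rewrite /Rdiv Rmult_comm.
by rewrite fact_simpl mult_INR /=; field.
Qed.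

Lemma is_derive_npowfact (n : nat) (t x : R) :
  is_derive (fun s => - ((-1 * s + t) ^ n.+1 / INR (fact n.+1))) x ((-1 * x + t) ^ n / INR (fact n)).
Proof.
apply: is_derive_eq (is_derive_ext _ _ _ _ _ (is_derive_scal _ _ (-1) _ (is_derive_powfact n (-1) t x))) _.
  by move=> y; rewrite Ropp_mult_distr_l_reverse Rmult_1_l.
by ring.
Qed.

(** One integration from t raises a bound |t-s|^n/n! to the next order. It serves both iterated
    integrals and Taylor remainders; s may lie on either side of t, so two primitives of opposite
    sign are needed. *)
Lemma Cder_le_powfact f l t (n : nat) s : f t = RtoC 0 ->
  (forall x, Cder f x (l x)) -> (forall x, Cmod (l x) <= Rabs (t - x) ^ n / INR (fact n)) ->
  Cmod (f s) <= Rabs (t - s) ^ n.+1 / INR (fact n.+1).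
Proof.
move=> ft Hf Hl.
case: (Rle_dec s t) => st.
  have := @Cder_le f l (fun x => - ((-1 * x + t) ^ n.+1 / INR (fact n.+1)))
    (fun x => (-1 * x + t) ^ n / INR (fact n)) s t st (fun x _ => Hf x).
  rewrite ft; have -> : (RtoC 0 - f s = - f s)%C by ring.
  rewrite Cmod_opp Rabs_pos_eq; last lra.
  have -> : - ((-1 * t + t) ^ n.+1 / INR (fact n.+1)) - - ((-1 * s + t) ^ n.+1 / INR (fact n.+1)) =
     (t - s) ^ n.+1 / INR (fact n.+1).
    have -> : -1 * t + t = 0 by ring.
    by have -> : -1 * s + t = t - s by [ring]; rewrite pow_i; [field; apply: INR_fact_neq_0 | lia].
  apply=> x Hx.
    exact: is_derive_npowfact.
  apply: Rle_trans (Hl x) _; rewrite Rabs_pos_eq; last lra.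
  by have -> : -1 * x + t = t - x by [ring]; lra.
have st' : t <= s by lra.
have := @Cder_le f l (fun x => (1 * x + - t) ^ n.+1 / INR (fact n.+1))
    (fun x => (1 * x + - t) ^ n / INR (fact n)) t s st' (fun x _ => Hf x).
rewrite ft; have -> : (f s - RtoC 0 = f s)%C by ring.
rewrite -Rabs_Ropp Rabs_pos_eq; last lra.
have -> : (1 * s + - t) ^ n.+1 / INR (fact n.+1) - (1 * t + - t) ^ n.+1 / INR (fact n.+1) =
     (- (t - s)) ^ n.+1 / INR (fact n.+1).
  have -> : 1 * t + - t = 0 by ring.
  by have -> : 1 * s + - t = - (t - s) by [ring]; rewrite [0 ^ _]pow_i; [field; apply: INR_fact_neq_0 | lia].
apply=> x Hx.
  by apply: is_derive_eq (is_derive_powfact n 1 (- t) x) _; ring.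
apply: Rle_trans (Hl x) _; rewrite -Rabs_Ropp Rabs_pos_eq; last lra.
by have -> : 1 * x + - t = - (t - x) by [ring]; lra.
Qed.

Lemma Iw_bound_fact t w s : Cmod (Iw t w s) <= Rabs (t - s) ^ size w / INR (fact (size w)).
Proof.
elim: w s => [|o w IH] s; first by rewrite /= Cmod_1; lra.
apply: (@Cder_le_powfact (Iw t (o :: w)) _ t (size w) s (Iw_end t o w) (fun x => Cder_Iw t o w x)) => x.
by rewrite Cmod_opp Cmod_mult Cmod_cis Rmult_1_l.
Qed.

Lemma pow_fact_le x T n : 0 <= x <= T -> x ^ n / INR (fact n) <= (1 + T) ^ n.
Proof.
move=> Hx; have f1 : 1 <= INR (fact n) by apply: (le_INR 1); apply: lt_O_fact.
have h1 : x ^ n <= (1 + T) ^ n by apply: pow_incr; lra.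
have h0 : 0 <= x ^ n by apply: pow_le; lra.
apply: Rle_trans h1; apply: (Rmult_le_reg_r (INR (fact n))); first lra.
rewrite /Rdiv Rmult_assoc Rinv_l; last lra.
nra.
Qed.

(** Powers of 1+T increase with the length, so this form also absorbs the bounds of the shorter
    words produced by differentiation. *)
Lemma Iw_bound t w s T : Rabs (t - s) <= T -> Cmod (Iw t w s) <= (1 + T) ^ size w.
Proof.
move=> H; apply: Rle_trans (Iw_bound_fact _ _ _) _; apply: pow_fact_le.
by split => //; apply: Rabs_pos.
Qed.

Lemma segment_dist s t x T : Rmin s t <= x <= Rmax s t -> Rabs (t - s) <= T -> Rabs (t - x) <= T.
Proof.
rewrite /Rmin /Rmax; case: Rle_dec => h Hx; move=> /Rabs_le_between H; apply: Rabs_le; lra.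
Qed.

(** If the fast letter is not the first one, the outer integration costs at most a factor T. If it
    is, one integration by parts gains 1/Om: two boundary terms and an integral of the derivative of
    the inner factor give 2 + T <= 3(1 + T). *)
Lemma Iw_fast t w s T Om : 0 < Om -> Rabs (t - s) <= T ->
  (exists2 o, o \in w & Om <= Rabs o) ->
  Cmod (Iw t w s) <= 3 * (1 + T) ^ size w / Om.
Proof.
move=> Om0; elim: w s => [|o w IH] s HT; first by case.
have T0 : 0 <= T by apply: Rle_trans HT; apply: Rabs_pos.
have p0 : 0 < (1 + T) ^ size w by apply: pow_lt; lra.
case=> o1; rewrite in_cons; case/orP => [/eqP ->|ow] Ho; last first.
  apply: Rle_trans (CInt_bound (B := 3 * (1 + T) ^ size w / Om) _ _) _.
  - exact: Iw_step_cont.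
  - move=> x Hx; rewrite Cmod_mult Cmod_cis Rmult_1_l; apply: IH; last by exists o1.
    exact: segment_dist Hx HT.
  have -> : 3 * (1 + T) ^ size (o :: w) / Om = 3 * (1 + T) ^ size w / Om * (1 + T) by rewrite /=; field; lra.
  apply: Rmult_le_compat_l; last lra.
  by apply: Rmult_le_pos; [lra | apply: Rlt_le; apply: Rinv_0_lt_compat].
have o0 : o <> 0 by move=> E; move: Ho; rewrite E Rabs_R0; lra.
pose z : C := imC (- / o).
have zo : (z * imC o = RtoC 1)%C by apply: injective_projections => /=; field.
have Cz : Cmod z = / Rabs o.
  have -> : z = (RtoC (- / o) * Ci)%C by apply: injective_projections => /=; ring.
  rewrite Cmod_mult Cmod_R Rabs_Ropp Rabs_inv.
  by have -> : Cmod Ci = 1 by [rewrite /Cmod /= -[RHS]sqrt_1; congr sqrt; ring]; ring.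
have Czle : Cmod z <= / Om by rewrite Cz; apply: Rinv_le_contravar.
have [dI [dIder [dIc dIb]]] : exists dI, (forall x, Cder (Iw t w) x (dI x)) /\ Ccont dI /\
    (forall x, Rabs (t - x) <= T -> Cmod (dI x) <= (1 + T) ^ size w).
  case: w {IH p0} => [|o' w'].
    exists (fun _ => RtoC 0); split; first by move=> x; apply: Cder_const.
    by split; [apply: Ccont_const | move=> x _; rewrite Cmod_0 /=; lra].
  exists (fun x => - (cis (o' * x + 0) * Iw t w' x))%C; split; first by move=> x; apply: Cder_Iw.
  split.
    apply: (@Ccont_ext (fun x => RtoC (-1) * (cis (o' * x + 0) * Iw t w' x))%C); first by move=> x; ring.
    by apply: Ccont_mult; [apply: Ccont_const | apply: Iw_step_cont].
  move=> x Hx; rewrite Cmod_opp Cmod_mult Cmod_cis Rmult_1_l.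
  apply: Rle_trans (Iw_bound _ Hx) _; rewrite /=.
  have : 0 <= (1 + T) ^ size w' by apply: pow_le; lra.
  set u := (1 + T) ^ _; nra.
pose Fp x := (z * cis (o * x + 0) * Iw t w x)%C.
pose g x := (cis (o * x + 0) * Iw t w x)%C.
pose r x := (z * cis (o * x + 0) * dI x)%C.
have rc : Ccont r by apply: Ccont_mult => //; apply: Ccont_mult; [apply: Ccont_const | apply: Ccont_cis].
have gc : Ccont g by apply: Iw_step_cont.
have E : (CInt g s t + CInt r s t = Fp t - Fp s)%C.
  rewrite -CInt_plus //; apply: CInt_Cder; last exact: Ccont_plus.
  move=> x; apply: Cder_eq (Cder_mult (Cder_scal z (Cder_cis o 0 x)) (dIder x)) _.
  rewrite /g /r !Cmult_assoc zo; ring.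
have -> : Iw t (o :: w) s = (Fp t + (- Fp s + - CInt r s t))%C.
  have -> : Iw t (o :: w) s = (CInt g s t + CInt r s t - CInt r s t)%C by rewrite /= -/g; ring.
  by rewrite E; ring.
have Fb x : Rabs (t - x) <= T -> Cmod (Fp x) <= / Om * (1 + T) ^ size w.
  move=> Hx; rewrite /Fp !Cmod_mult Cmod_cis Rmult_1_r.
  by apply: Rmult_le_compat; try exact: Cmod_ge_0; [|apply: Iw_bound].
have tt : Rabs (t - t) <= T by rewrite Rminus_diag Rabs_R0.
have rb : Cmod (CInt r s t) <= / Om * (1 + T) ^ size w * T.
  apply: (Rle_trans _ (/ Om * (1 + T) ^ size w * Rabs (t - s))).
    apply: CInt_bound => // x Hx; rewrite /r !Cmod_mult Cmod_cis Rmult_1_r.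
    apply: Rmult_le_compat; try exact: Cmod_ge_0; [by []|].
    by apply: dIb; apply: segment_dist Hx HT.
  apply: Rmult_le_compat_l => //; apply: Rmult_le_pos; last lra.
  by apply: Rlt_le; apply: Rinv_0_lt_compat.
apply: Rle_trans (Cmod_triangle _ _) _.
apply: Rle_trans (Rplus_le_compat_l _ _ _ (Cmod_triangle _ _)) _.
rewrite !Cmod_opp.
have := Fb t tt; have := Fb s HT.
have -> : 3 * (1 + T) ^ size (o :: w) / Om = 3 * (/ Om * (1 + T) ^ size w) * (1 + T) by rewrite /=; field; lra.
have u0 : 0 <= / Om * (1 + T) ^ size w.
  by apply: Rmult_le_pos; [apply: Rlt_le; apply: Rinv_0_lt_compat | lra].
nra.
Qed.

Lemma Iw_zero t w s : (forall o, o \in w -> o = 0) ->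
  Iw t w s = RtoC ((t - s) ^ size w / INR (fact (size w))).
Proof.
elim: w s => [|o w IH] s Hw; first by rewrite /=; congr RtoC; field.
have -> : o = 0 by apply: Hw; rewrite mem_head.
have {}Hw o' : o' \in w -> o' = 0 by move=> h; apply: Hw; rewrite in_cons h orbT.
rewrite [LHS]/= -[size (0 :: w)]/(size w).+1.
rewrite (@CInt_ext _ (fun x => RtoC ((-1 * x + t) ^ size w / INR (fact (size w))))); last first.
  move=> x; rewrite IH //.
  have -> : 0 * x + 0 = 0 by ring.
  by rewrite cis0 Cmult_1_l; congr RtoC; congr (_ / _); congr pow; ring.
have f0 := INR_fact_neq_0 (size w).+1.
rewrite (@CInt_Cder (fun x => RtoC (- ((-1 * x + t) ^ (size w).+1 / INR (fact (size w).+1))))).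
- rewrite -RtoC_minus; congr RtoC.
  have -> : -1 * t + t = 0 by ring.
  have -> : -1 * s + t = t - s by ring.
  rewrite pow_i; last lia.
  by rewrite /Rdiv; ring.
- move=> x; apply: Cder_RtoC.
  exact: is_derive_npowfact.
- move=> x; split; last exact: continuous_const.
  apply: (@ex_derive_continuous _ _ (fun s => (-1 * s + t) ^ size w * / INR (fact (size w)))).
  move: (Rinv (INR (fact (size w)))) (size w) => c n; by auto_derive.
Qed.

(** * Words and the Dyson expansion *)

Fixpoint words (T : Type) (M : seq T) (n : nat) : seq (seq T) :=
  match n with
  | 0%N => [:: [::]]
  | n'.+1 => [seq a :: w | a <- M, w <- words M n']
  end.

Definition cprod (T : Type) (c : T -> C) (w : seq T) : C := foldr (fun a z => c a * z)%C (RtoC 1) w.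

Lemma csum_words (T : Type) (M : seq T) n (g : seq T -> C) :
  \sumC_(w <- words M n.+1) g w = \sumC_(a <- M) (\sumC_(w <- words M n) g (a :: w)).
Proof. by rewrite /= big_allpairs_dep. Qed.

Lemma rsum_words (T : Type) (M : seq T) n (g : seq T -> R) :
  \sumR_(w <- words M n.+1) g w = \sumR_(a <- M) (\sumR_(w <- words M n) g (a :: w)).
Proof. by rewrite /= big_allpairs_dep. Qed.

Lemma size_words (T : eqType) (M : seq T) n w : w \in words M n -> size w = n.
Proof.
elim: n w => [|n IH] w /=; first by rewrite mem_seq1 => /eqP ->.
by case/allpairsP => [[a v] /= [_ /IH <- ->]].
Qed.

Lemma all_words (T : eqType) (M : seq T) n w : w \in words M n -> {subset w <= M}.
Proof.
elim: n w => [|n IH] w /=; first by rewrite mem_seq1 => /eqP ->.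
case/allpairsP => [[a v] /= [aM /IH Hv ->]] x.
by rewrite in_cons => /orP[/eqP ->|/Hv].
Qed.

Lemma Cpow_S z n : Cpow z n.+1 = (z * Cpow z n)%C.
Proof. by []. Qed.

Lemma Cder_pow f x l n : Cder f x l ->
  Cder (fun s => Cpow (f s) n.+1) x (RtoC (INR n.+1) * Cpow (f x) n * l)%C.
Proof.
move=> Hf; elim: n => [|n IH].
  apply: Cder_ext (Cder_eq Hf _) => [s|]; rewrite /=; ring.
apply: Cder_ext (Cder_eq (Cder_mult Hf IH) _) => [s|]; first by rewrite Cpow_S.
rewrite !Cpow_S (S_INR n.+1) RtoC_plus; ring.
Qed.

Lemma RtoC_inv_fact n : (RtoC (/ INR (fact n.+1)) * RtoC (INR n.+1))%C = RtoC (/ INR (fact n)).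
Proof.
rewrite -RtoC_mult fact_simpl mult_INR; congr RtoC; field; split.
  exact: INR_fact_neq_0.
exact: not_0_INR.
Qed.

(* As functions of [s], both sides satisfy [f_(n+1)' = - g f_n] and [f_(n+1) t = 0]. *)
Lemma words_power (T : Type) (M : seq T) (c : T -> C) (o : T -> R) t n s :
  \sumC_(w <- words M n) (cprod c w * Iw t (map o w) s) =
  (Cpow (\sumC_(a <- M) (c a * CInt (fun sg => cis (o a * sg + 0)) s t)) n * RtoC (/ INR (fact n)))%C.
Proof.
pose g sg := \sumC_(a <- M) (c a * cis (o a * sg + 0)).
pose Gam s := \sumC_(a <- M) (c a * CInt (fun sg => cis (o a * sg + 0)) s t).
have gc : Ccont g.
  by apply: Ccont_big => a; apply: Ccont_mult; [apply: Ccont_const | apply: Ccont_cis].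
have Gd x : Cder Gam x (- g x)%C.
  apply: Cder_eq (Cder_big _ (fun a => Cder_scal (c a) (Cder_CInt_lower t x (Ccont_cis (o a) 0)))) _.
  have -> : (- g x = RtoC (-1) * g x)%C by ring.
  by rewrite csum_scal_l; apply: eq_bigr => a _; ring.
have Gt : Gam t = RtoC 0.
  by rewrite /Gam big1 // => a _; rewrite CInt_point; ring.
rewrite -/(Gam s); elim: n s => [|n IH] s.
  by rewrite /= big_seq1 /=; have -> : / 1 = 1 by [field]; ring.
rewrite csum_words.
have cW w : Ccont (fun x => cprod c w * Iw t (map o w) x)%C.
  by apply: Ccont_mult; [apply: Ccont_const | apply: Iw_cont].
have -> : \sumC_(a <- M) (\sumC_(w <- words M n) (cprod c (a :: w) * Iw t (map o (a :: w)) s)) =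
   CInt (fun x => g x * (Cpow (Gam x) n * RtoC (/ INR (fact n))))%C s t.
  rewrite (CInt_ext (g := fun x => \sumC_(a <- M) (\sumC_(w <- words M n)
      (c a * cprod c w * (cis (o a * x + 0) * Iw t (map o w) x))))); last first.
    move=> x; rewrite -IH /g Cmult_comm csum_scal_l; apply: eq_bigr => a _.
    rewrite Cmult_comm csum_scal_l; apply: eq_bigr => w _; ring.
  rewrite CInt_big; last first.
    move=> a; apply: Ccont_big => w; apply: Ccont_mult; [exact: Ccont_const | exact: Iw_step_cont].
  apply: eq_bigr => a _; rewrite CInt_big; last first.
    by move=> w; apply: Ccont_mult; [exact: Ccont_const | exact: Iw_step_cont].
  by apply: eq_bigr => w _; rewrite CInt_scal //; apply: Iw_step_cont.
have pc : Ccont (fun x => Cpow (Gam x) n * RtoC (/ INR (fact n)))%C.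
  have Gc := Cder_cont Gd; apply: Ccont_mult; last exact: Ccont_const.
  by elim: n {IH} => [|n IH] /=; [exact: Ccont_const | apply: Ccont_mult].
rewrite (@CInt_Cder (fun x => RtoC (- / INR (fact n.+1)) * Cpow (Gam x) n.+1)%C).
- by rewrite Gt Cpow_S RtoC_opp; ring.
- move=> x; apply: Cder_eq (Cder_scal _ (Cder_pow n (Gd x))) _.
  by rewrite -RtoC_inv_fact RtoC_opp; ring.
- exact: Ccont_mult.
Qed.

(** The derivative of each remainder is i times the preceding one, and the chain starts from [cis]
    itself, of modulus 1. *)
Lemma cis_taylor N x : Cmod (cis x - \sumC_(n <- seq.iota 0 N.+1)
    (Cpow (Ci * RtoC x) n * RtoC (/ INR (fact n))))%C <= Rabs x ^ N.+1 / INR (fact N.+1).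
Proof.
pose P N x := \sumC_(n <- seq.iota 0 N) (Cpow (Ci * RtoC x) n * RtoC (/ INR (fact n))).
have PS N' y : P N'.+1 y = (P N' y + Cpow (Ci * RtoC y) N' * RtoC (/ INR (fact N')))%C.
  by rewrite /P -addn1 iotaD big_cat /= big_seq1 add0n.
have dP N' y : Cder (P N'.+1) y (Ci * P N' y)%C.
  elim: N' => [|N' IH].
    apply: (@Cder_ext (fun _ => RtoC 1)); first by move=> s; rewrite PS /P /= big_nil Rinv_1; ring.
    by apply: Cder_eq (Cder_const _ _) _; rewrite /P big_nil; ring.
  have hd : Cder (fun s => Ci * RtoC s)%C y (Ci * RtoC 1)%C.
    by apply: Cder_scal; apply: Cder_RtoC; auto_derive.
  apply: Cder_ext (Cder_eq (Cder_plus IH (Cder_mult (Cder_pow N' hd) (Cder_const (RtoC (/ INR (fact N'.+1))) y))) _).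
    by move=> s; rewrite -PS.
  rewrite [in RHS]PS -(RtoC_inv_fact N'); ring.
have d0 N' y : Cder (fun s => cis s - P N'.+1 s)%C y (Ci * (cis y - P N' y))%C.
  have hc := Cder_cis 1 0 y.
  apply: Cder_ext (Cder_eq (Cder_plus hc (Cder_scal (RtoC (-1)) (dP N' y))) _).
    by move=> s; rewrite Rmult_1_l Rplus_0_r; ring.
  rewrite Rmult_1_l Rplus_0_r; have -> : imC 1 = Ci by []; ring.
have z0 N' : (cis 0 - P N'.+1 0)%C = RtoC 0.
  rewrite cis0 /P; have -> : seq.iota 0 N'.+1 = 0%N :: seq.iota 1 N' by [].
  rewrite big_cons big1_seq; first by rewrite /= Rinv_1; ring.
  move=> n /andP[_]; rewrite mem_iota; case: n => [//|n] _; rewrite Cpow_S; ring.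
have CCi : Cmod Ci = 1 by rewrite /Cmod /= -[RHS]sqrt_1; congr sqrt; ring.
have R0 y : Rabs (0 - y) = Rabs y by rewrite Rminus_0_l Rabs_Ropp.
rewrite -/(P N.+1 x) -R0; elim: N x => [|N IH] x.
  apply: (@Cder_le_powfact (fun s => cis s - P 1%N s)%C _ 0 0%N x (z0 0%N) (fun y => d0 0%N y)) => y.
  rewrite Cmod_mult CCi /P big_nil /=.
  have -> : (cis y - 0 = cis y)%C by ring.
  by rewrite Cmod_cis; lra.
apply: (@Cder_le_powfact (fun s => cis s - P N.+2 s)%C _ 0 N.+1 x (z0 N.+1) (fun y => d0 N.+1 y)) => y.
by rewrite Cmod_mult CCi Rmult_1_l; apply: IH.
Qed.

(** * Approximation of the iterated integrals by exponential sums *)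

Definition expsum (Q : seq (C * R)) (eta : R) : C := \sumC_(q <- Q) (q.1 * cis (q.2 * eta)).

Lemma expsum_cat P Q eta : expsum (P ++ Q) eta = (expsum P eta + expsum Q eta)%C.
Proof. by rewrite /expsum big_cat. Qed.

Lemma expsum_scal c k Q eta :
  expsum [seq ((c * q.1)%C, k + q.2) | q <- Q] eta = (c * cis (k * eta) * expsum Q eta)%C.
Proof.
rewrite /expsum big_map csum_scal_l; apply: eq_bigr => q _ /=.
by rewrite Rmult_plus_distr_r cis_add; ring.
Qed.

Lemma CInt_Chasles f a b c : Ccont f -> (CInt f a b + CInt f b c = CInt f a c)%C.
Proof.
move=> H; have h u v := Ccont_ex u v H.
by apply: injective_projections => /=;
  [apply: (RInt_Chasles (fun s => Re (f s))) | apply: (RInt_Chasles (fun s => Im (f s)))];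
  [have [] := h a b | have [] := h b c | have [] := h a b | have [] := h b c].
Qed.

(** Exponential sums in eta are what the cut-off trigonometric test symbols can represent. The outer
    integral is replaced by a Riemann sum: at each node the factor cis(c eta s_j) is already
    exponential in eta, and the inner integral is approximated by induction. Uniformity needs |eta|
    <= K, since the Lipschitz constant in time grows with eta. *)
Lemma Iw_expsum_approx t (w : seq R) T K : 0 <= T -> 0 <= K -> forall e s, 0 < e -> Rabs (t - s) <= T ->
  exists Q, forall eta, Rabs eta <= K ->
    Cmod (Iw t [seq (c * eta)%Re | c <- w] s - expsum Q eta)%C <= e.
Proof.
move=> T0 K0; elim: w => [|c w IH] e s e0 HT.
  exists [:: (RtoC 1, 0)] => eta _; rewrite /expsum big_seq1 /= Rmult_0_l cis0.
  have -> : (1 - 1 * 1 = 0)%C by ring.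
  by rewrite Cmod_0; lra.
(* [Lp] is the Lipschitz constant in time of the integrand: |c| K comes from its exponential factor,
   1 from the inner iterated integral. *)
pose n := size w; pose Lp := (Rabs c * K + 1) * (1 + T) ^ n.
have p0 : 1 <= (1 + T) ^ n by apply: pow_R1_Rle; lra.
have Lp0 : 0 <= Lp by apply: Rmult_le_pos; [have := Rabs_pos c; nra | lra].
(* The quadrature error is Lp T^2 / NN and the inner approximations, of precision 1/((1+T) NN), add
   at most 1/NN in all. *)
have [N HN] : exists N, Lp * T * T + 2 * 1 <= e * INR N.+1.
  have [N HN] := INR_unbounded ((Lp * T * T + 2) / e); exists N.
  have : (Lp * T * T + 2) / e <= INR N.+1 by rewrite S_INR; lra.
  move=> h; have -> : Lp * T * T + 2 * 1 = e * ((Lp * T * T + 2) / e) by field; lra.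
  by apply: Rmult_le_compat_l; lra.
pose NN := INR N.+1; have NN0 : 0 < NN by apply: lt_0_INR; lia.
pose D := (t - s) / NN.
have DT : Rabs D <= T / NN.
  by rewrite /D Rabs_mult Rabs_inv (Rabs_pos_eq NN); [apply: Rmult_le_compat_r => //; apply: Rlt_le; apply: Rinv_0_lt_compat | lra].
pose sj j := s + INR j * D.
have sjT j : (j <= N.+1)%N -> Rabs (t - sj j) <= T.
  move=> Hj; have j0 := pos_INR j; have jN : INR j <= NN by apply: le_INR; apply/leP.
  have -> : t - sj j = (t - s) * (1 - INR j / NN) by rewrite /sj /D; field; lra.
  have jq : 0 <= INR j / NN <= 1.
    split; first by apply: Rmult_le_pos => //; apply: Rlt_le; apply: Rinv_0_lt_compat.
    by apply: (Rmult_le_reg_r NN) => //; rewrite /Rdiv Rmult_assoc Rinv_l; lra.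
  rewrite Rabs_mult (Rabs_pos_eq (1 - _)); last lra.
  have := Rabs_pos (t - s); nra.
pose g eta sg := (cis (c * eta * sg + 0) * Iw t [seq (c * eta)%Re | c <- w] sg)%C.
have gc eta : Ccont (g eta) by apply: Iw_step_cont.
have gLip eta x y : Rabs eta <= K -> Rabs (t - x) <= T -> Rabs (t - y) <= T ->
    Cmod (g eta y - g eta x)%C <= Lp * Rabs (y - x).
  move=> He Hx Hy.
  have [dI [dIder dIb]] : exists dI, (forall z, Cder (Iw t [seq (c * eta)%Re | c <- w]) z (dI z)) /\
    (forall z, Rabs (t - z) <= T -> Cmod (dI z) <= (1 + T) ^ n).
    rewrite /n; case: (w) => [|o' w'] /=.
      exists (fun _ => RtoC 0); split; first by move=> z; apply: Cder_const.
      by move=> z _; rewrite Cmod_0; lra.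
    exists (fun z => - (cis ((o' * eta)%Re * z + 0) * Iw t [seq (c * eta)%Re | c <- w'] z))%C; split; first by move=> z; apply: Cder_Iw.
    move=> z Hz; rewrite Cmod_opp Cmod_mult Cmod_cis Rmult_1_l.
    apply: Rle_trans (Iw_bound _ Hz) _; rewrite size_map.
    have : 0 <= (1 + T) ^ size w' by apply: pow_le; lra.
    set u := (1 + T) ^ _; nra.
  apply: (@Cder_bound (g eta) (fun z => imC (c * eta) * cis (c * eta * z + 0) * Iw t [seq (c * eta)%Re | c <- w] z + cis (c * eta * z + 0) * dI z)%C) => z Hz.
    by apply: Cder_eq (Cder_mult (Cder_cis (c * eta)%Re 0 z) (dIder z)) _.
  have zT : Rabs (t - z) <= T.
    move: Hz Hx Hy; rewrite /Rmin /Rmax; case: Rle_dec => _ Hz /Rabs_le_between Hx /Rabs_le_between Hy; apply: Rabs_le; lra.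
  apply: Rle_trans (Cmod_triangle _ _) _; rewrite !Cmod_mult !Cmod_cis Rmult_1_l Rmult_1_r.
  have Cim r : Cmod (imC r) = Rabs r.
    have -> : imC r = (RtoC r * Ci)%C by apply: injective_projections => /=; ring.
    rewrite Cmod_mult Cmod_R; have -> : Cmod Ci = 1 by [rewrite /Cmod /= -[RHS]sqrt_1; congr sqrt; ring]; ring.
  rewrite Cim Rabs_mult /Lp Rmult_plus_distr_r Rmult_1_l.
  apply: Rplus_le_compat; last exact: dIb.
  apply: Rmult_le_compat; try exact: Cmod_ge_0.
  - by apply: Rmult_le_pos; apply: Rabs_pos.
  - by apply: Rmult_le_compat_l => //; apply: Rabs_pos.
  - by have := Iw_bound [seq (c * eta)%Re | c <- w] zT; rewrite size_map.
pose e1 := / (1 + T); have e10 : 0 < e1 by apply: Rinv_0_lt_compat; lra.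
have step j : (j <= N.+1)%N -> exists Q, forall eta, Rabs eta <= K ->
    Cmod (CInt (g eta) s (sj j) - expsum Q eta)%C <= INR j * (Lp * (T / NN) * (T / NN) + (T / NN) * (e1 / NN)).
  elim: j => [|j IHj] Hj.
    exists [::] => eta _; rewrite /expsum big_nil /sj /= Rmult_0_l Rplus_0_r CInt_point.
    have -> : (0 - 0 = 0)%C by ring.
    by rewrite Cmod_0; lra.
  have [|Q HQ] := IHj; first by lia.
  have [||Q' HQ'] := IH (e1 / NN) (sj j).
  - by apply: Rdiv_lt_0_compat.
  - by apply: sjT; lia.
  exists (Q ++ [seq ((RtoC D * q.1)%C, c * sj j + q.2) | q <- Q']) => eta He.
  rewrite expsum_cat expsum_scal.
  rewrite -(CInt_Chasles s (sj j) (sj j.+1) (gc eta)).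
  have sjS : sj j.+1 - sj j = D by rewrite /sj S_INR; ring.
  set A := CInt _ s _; set B := CInt _ _ _.
  pose G0 := g eta (sj j).
  have -> : (A + B - (expsum Q eta + RtoC D * cis (c * sj j * eta) * expsum Q' eta) =
     (A - expsum Q eta) + ((B - RtoC D * G0) + RtoC D * cis (c * sj j * eta) * (Iw t [seq (c * eta)%Re | c <- w] (sj j) - expsum Q' eta)))%C.
    rewrite /G0 /g; have -> : c * eta * sj j + 0 = c * sj j * eta by ring.
    ring.
  apply: Rle_trans (Cmod_triangle _ _) _.
  rewrite S_INR Rmult_plus_distr_r Rmult_1_l; apply: Rplus_le_compat; first exact: HQ.
  apply: Rle_trans (Cmod_triangle _ _) _; apply: Rplus_le_compat; last first.
    rewrite !Cmod_mult Cmod_cis Cmod_R Rmult_1_r.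
    by apply: Rmult_le_compat => //; [exact: Rabs_pos | exact: Cmod_ge_0 | apply: HQ'].
  have gc2 : Ccont (fun x => g eta x + - G0)%C by apply: Ccont_plus => //; apply: Ccont_const.
  have -> : (B - RtoC D * G0 = CInt (fun x => g eta x + - G0) (sj j) (sj j.+1))%C.
    rewrite CInt_plus //; last exact: Ccont_const.
    rewrite -/B; congr Cplus.
    rewrite (@CInt_Cder (fun x => RtoC x * - G0)%C); first last.
    - exact: Ccont_const.
    - move=> x; apply: Cder_eq (Cder_mult (Cder_RtoC (l := 1) _) (Cder_const (- G0)%C x)) _; last by ring.
      by auto_derive.
    by rewrite -sjS RtoC_minus; ring.
  apply: Rle_trans (CInt_bound (B := Lp * (T / NN)) gc2 _) _; last first.
    rewrite sjS; apply: Rmult_le_compat_l => //.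
    by apply: Rmult_le_pos => //; apply: Rle_trans DT; apply: Rabs_pos.
  move=> x Hx.
  have xT : Rabs (t - x) <= T.
    have h1 := sjT j; have h2 := sjT j.+1 Hj.
    have {}h1 : Rabs (t - sj j) <= T by apply: h1; lia.
    move: Hx h1 h2; rewrite /Rmin /Rmax; case: Rle_dec => _ Hz /Rabs_le_between Hx /Rabs_le_between Hy; apply: Rabs_le; lra.
  apply: Rle_trans (gLip eta (sj j) x He _ xT) _; first by apply: sjT; lia.
  apply: Rmult_le_compat_l => //; apply: Rle_trans DT; rewrite -sjS.
  move: Hx; rewrite /Rmin /Rmax; case: Rle_dec => h Hx; last first.
    by rewrite -Rabs_Ropp Rabs_pos_eq; [rewrite -Rabs_Ropp Rabs_pos_eq; lra | lra].
  by rewrite !Rabs_pos_eq; lra.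
have [Q HQ] := step N.+1 (leqnn _).
exists Q => eta He; have := HQ eta He.
have -> : sj N.+1 = t by rewrite /sj /D -/NN; field; lra.
rewrite -/(g eta) => h; apply: Rle_trans h _.
have -> : INR N.+1 * (Lp * (T / NN) * (T / NN) + T / NN * (e1 / NN)) = (Lp * T * T + T * e1) / NN.
  by rewrite -/NN; field; lra.
have h2 : T * e1 <= 1.
  by apply: (Rmult_le_reg_r (1 + T)); rewrite ?/e1 ?Rmult_assoc ?Rinv_l; lra.
apply: (Rmult_le_reg_r NN) => //; rewrite /Rdiv Rmult_assoc Rinv_l; last lra.
rewrite -/NN in HN; lra.
Qed.

(** * Duhamel estimate for the truncated Dyson expansion *)

Definition dot (k m : Z2) : R := IZR k.1 * IZR m.1 + IZR k.2 * IZR m.2.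

Definition wsum (v : seq Z2) : Z2 := foldr Z2add (0%ZZ, 0%ZZ) v.

Lemma Z2addC k m : Z2add k m = Z2add m k.
Proof. by rewrite /Z2add; congr pair; lia. Qed.

Lemma Z2addA k m p : Z2add k (Z2add m p) = Z2add (Z2add k m) p.
Proof. by rewrite /Z2add /=; congr pair; lia. Qed.

Lemma Z2add0 k : Z2add k (0%ZZ, 0%ZZ) = k.
Proof. by case: k => a b; rewrite /Z2add /=; congr pair; lia. Qed.

Lemma dotDl k p m : dot (Z2add k p) m = dot k m + dot p m.
Proof. by rewrite /dot /Z2add /= !plus_IZR; ring. Qed.

Lemma cis_Lipschitz a b : Cmod (cis a - cis b)%C <= Rabs (a - b).
Proof.
have Cim : Cmod (imC 1) = 1 by rewrite /Cmod /= -[RHS]sqrt_1; congr sqrt; ring.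
have := @Cder_bound (fun s => cis (1 * s + 0)) (fun s => imC 1 * cis (1 * s + 0))%C b a 1.
rewrite !Rmult_1_l !Rplus_0_r; apply => x _; first exact: Cder_cis.
by rewrite Cmod_mult Cmod_cis Cim; lra.
Qed.

Lemma finite_bound (T : eqType) (l : seq T) (f : T -> R) :
  exists B, 0 <= B /\ forall x, x \in l -> f x <= B.
Proof.
elim: l => [|a l [B [B0 HB]]]; first by exists 0; split; [lra|].
exists (Rmax B (f a)); split; first by apply: Rle_trans (Rmax_l _ _).
move=> x; rewrite in_cons => /orP[/eqP ->|/HB h]; first exact: Rmax_r.
by apply: Rle_trans h (Rmax_l _ _).
Qed.

Lemma rsum_seq_le (T : eqType) (l : seq T) (f g : T -> R) :
  (forall k, k \in l -> f k <= g k) -> \sumR_(k <- l) f k <= \sumR_(k <- l) g k.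
Proof.
elim: l => [|a l IH] H; first by rewrite !big_nil; lra.
rewrite !big_cons; apply: Rplus_le_compat; first by apply: H; rewrite mem_head.
by apply: IH => k kl; apply: H; rewrite in_cons kl orbT.
Qed.

Lemma rsum_scal_r (T : Type) (c : R) (l : seq T) (f : T -> R) :
  (\sumR_(k <- l) f k) * c = \sumR_(k <- l) (f k * c).
Proof. by rewrite Rmult_comm rsum_scal_l; apply: eq_bigr => k _; ring. Qed.

Lemma exp_partial_le x n : 0 <= x -> \sumR_(k <- seq.iota 0 n) (x ^ k / INR (fact k)) <= exp x.
Proof.
move=> x0; have H := is_exp_Reals x.
have Hs : is_series (fun k => x ^ k / INR (fact k)) (exp x).
  apply: is_series_ext H => k; rewrite /scal /= /mult /= pow_n_pow; rewrite /Rdiv; ring.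
case: n => [|n]; first by rewrite big_nil; apply: Rlt_le; apply: exp_pos.
rewrite -sum_n_bigR; apply: (is_lim_seq_incr_compare (sum_n (fun k => x ^ k / INR (fact k)))).
  exact: Hs.
move=> k; rewrite sum_Sn /plus /=.
have : 0 <= x ^ k.+1 / INR (fact k.+1).
  apply: Rmult_le_pos; first exact: pow_le.
  by apply: Rlt_le; apply: Rinv_0_lt_compat; apply: INR_fact_lt_0.
by rewrite /=; lra.
Qed.

Lemma csum_iotaS (f : nat -> C) n :
  \sumC_(k <- seq.iota 0 n.+1) f k = (\sumC_(k <- seq.iota 0 n) f k + f n)%C.
Proof. by rewrite -(addn1 n) iotaD big_cat /= big_seq1 add0n. Qed.

Section Dynamics.
Variables (c : Z2 -> C) (A th T : R) (N : nat).
Hypothesis c_sum : forall L, uniq L -> \sumR_(m <- L) Cmod (c m) <= A.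
Hypothesis th0 : 0 <= th.
Hypothesis T0 : 0 <= T.

(** This is theta (|k+m|^2 - |k|^2) s, the exact phase coupling k to k+m; [freq] keeps only its part
    linear in k. *)
Definition osc (k m : Z2) (s : R) : R := th * (2 * dot k m + knorm2 m) * s.
Definition freq (k m : Z2) : R := 2 * th * dot k m.
Definition coefw (v : seq Z2) : C := cprod (fun m => Ci * c m)%C v.

Lemma dyson_A0 : 0 <= A.
Proof. by have := c_sum (L := [::]) isT; rewrite big_nil. Qed.

Lemma Cmod_Ci : Cmod Ci = 1.
Proof. by rewrite /Cmod /= -[RHS]sqrt_1; congr sqrt; ring. Qed.

Lemma coefw_sum (M : seq Z2) n : uniq M ->
  \sumR_(v <- words M n) Cmod (coefw v) <= A ^ n.
Proof.
move=> uM; have A0 := dyson_A0; elim: n => [|n IH].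
  by rewrite /= big_seq1 /coefw /= Cmod_1; lra.
rewrite rsum_words.
have -> : \sumR_(a <- M) (\sumR_(v <- words M n) Cmod (coefw (a :: v))) =
   \sumR_(a <- M) (Cmod (c a) * (\sumR_(v <- words M n) Cmod (coefw v))).
  apply: eq_bigr => a _; rewrite rsum_scal_l; apply: eq_bigr => v _.
  by rewrite /coefw /= !Cmod_mult Cmod_Ci Rmult_1_l.
have s0 : 0 <= \sumR_(v <- words M n) Cmod (coefw v) by apply: rsum_ge0 => v; apply: Cmod_ge_0.
rewrite -rsum_scal_r /=; apply: Rmult_le_compat => //; last exact: c_sum.
by apply: rsum_ge0 => m; apply: Cmod_ge_0.
Qed.

Variable y : R -> Z2 -> C.
Variable dy : R -> Z2 -> C.
Hypothesis y_l2 : forall s, is_l2 (y s).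
Hypothesis y_sum : forall s k, usum (fun m => c m * cis (osc k m s) * y s (Z2add k m))%C (dy s k).
Hypothesis y_der : forall s k, Cder (fun s => y s k) s (Ci * dy s k)%C.

Variables (t : R) (L : seq Z2) (phi : Z2 -> C).
Hypothesis tT : Rabs t <= T.
Hypothesis L_uniq : uniq L.
Let M := box N.
Let nphi := sqrt (\sumR_(k <- L) Cmod (phi k) ^ 2).

Lemma phi_pairing s q : \sumR_(k <- L) (Cmod (phi k) * Cmod (y s (Z2add q k))) <= nphi * sqrt (nrm2 (y s)).
Proof.
apply: Rle_trans (rsum_CauchySchwarz _ _ _) _; try by move=> k; apply: Cmod_ge_0.
apply: Rmult_le_compat_l; first exact: sqrt_pos.
apply: sqrt_le_1_alt.
have := @is_l2_sum_le (y s) [seq Z2add q k | k <- L] (y_l2 s); rewrite map_inj_uniq ?big_map.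
  by apply.
exact: Z2add_inj.
Qed.

Definition Iwk (s : R) (k : Z2) (v : seq Z2) : C := Iw t [seq freq k m | m <- v] s.

(** The n-th Dyson term stopped at time s: letters are integrated over [s, t] and the solution is
    still taken at s. At s = t only n = 0 survives and is the tested solution; at s = 0 one finds
    the expansion in the initial data. Differentiating in s compares the two. *)
Definition level (s : R) (n : nat) : C :=
  \sumC_(v <- words M n) (coefw v * (\sumC_(k <- L) (phi k * Iwk s k v * y s (Z2add k (wsum v))))).

(** [pterm] comes from differentiating the solution in level n, [dterm] (with a minus sign) from
    differentiating the iterated integral of a word of level n+1 with first letter m. They differ
    only in the phase: exact at the shifted frequency in the first, frozen at k in the second. *)
Definition pterm (s : R) (n : nat) (m : Z2) : C :=
  \sumC_(v <- words M n) (Ci * c m * coefw v *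
    (\sumC_(k <- L) (phi k * Iwk s k v * (cis (osc (Z2add k (wsum v)) m s) * y s (Z2add (Z2add k (wsum v)) m))))).

Definition dterm (s : R) (n : nat) (m : Z2) : C :=
  \sumC_(v <- words M n) (Ci * c m * coefw v *
    (\sumC_(k <- L) (phi k * Iwk s k v * (cis (freq k m * s + 0) * y s (Z2add (Z2add k (wsum v)) m))))).

Definition psum (s : R) (n : nat) : C :=
  \sumC_(v <- words M n) (coefw v *
    (\sumC_(k <- L) (phi k * Iwk s k v * (Ci * dy s (Z2add k (wsum v)))))).

Lemma usum_pterm s n : usum (pterm s n) (psum s n).
Proof.
apply: usum_ext (usum_big _ _) => [m|v]; last first.
  apply: (usum_scal (coefw v)); apply: usum_big => k.
  apply: (usum_scal (phi k * Iwk s k v)); apply: (usum_scal Ci); exact: y_sum.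
rewrite /=; apply: eq_bigr => v _; rewrite !csum_scal_l; apply: eq_bigr => k _; ring.
Qed.

Definition dlevel (s : R) (n : nat) : C :=
  match n with 0%N => RtoC 0 | n'.+1 => (- \sumC_(m <- M) dterm s n' m)%C end.

Lemma Cder_level s n : Cder (fun s => level s n) s (dlevel s n + psum s n)%C.
Proof.
pose dI s k v := match v with [::] => RtoC 0 | m :: v' => (- (cis (freq k m * s + 0) * Iwk s k v'))%C end.
have HI k v : Cder (fun s => Iwk s k v) s (dI s k v).
  by case: v => [|m v]; [apply: Cder_const | apply: Cder_Iw].
have key : Cder (fun s => level s n) s (\sumC_(v <- words M n) (coefw v *
    (\sumC_(k <- L) (phi k * dI s k v * y s (Z2add k (wsum v)) + phi k * Iwk s k v * (Ci * dy s (Z2add k (wsum v))))))).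
  apply: Cder_big => v; apply: Cder_scal; apply: Cder_big => k.
  by apply: Cder_mult; [apply: Cder_scal | apply: y_der].
apply: Cder_eq key _.
rewrite /psum.
have -> : dlevel s n = \sumC_(v <- words M n) (coefw v * (\sumC_(k <- L) (phi k * dI s k v * y s (Z2add k (wsum v))))).
  case: n => [|n].
    rewrite /= big_seq1 big1 ?Cmult_0_r // => k _; rewrite /dI; ring.
  rewrite /dlevel csum_words.
  have -> : forall z : C, (- z = RtoC (-1) * z)%C by move=> z; ring.
  rewrite csum_scal_l; apply: eq_bigr => m _.
  rewrite /dterm csum_scal_l; apply: eq_bigr => v _.
  rewrite !csum_scal_l; apply: eq_bigr => k _.
  rewrite /coefw /= -Z2addA (Z2addC (wsum v)); ring.
rewrite -big_split /=; apply: eq_bigr => v _.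
by rewrite -Cmult_plus_distr_l -big_split.
Qed.

Lemma level_end n : level t n = if n is 0%N then \sumC_(k <- L) (phi k * y t k) else RtoC 0.
Proof.
case: n => [|n].
  rewrite /level /= big_seq1 /coefw /= Cmult_1_l; apply: eq_bigr => k _.
  by rewrite /Iwk /= /wsum /= Z2add0; ring.
rewrite /level big1_seq // => v /andP[_ /size_words]; case: v => [//|m v] _.
rewrite big1 ?Cmult_0_r // => k _; rewrite /Iwk /= CInt_point; ring.
Qed.

Variable B Cst : R.
Hypothesis s_bound : forall s, Rabs s <= T -> sqrt (nrm2 (y s)) <= B.

(** Common to all error terms: A^n from the coefficients, T^n/n! from the iterated integrals, and
    Cauchy-Schwarz in k, which ignores the shift [q v]; [gam] measures what is special to a
    block. *)
Lemma block_bound s n (z : seq Z2 -> Z2 -> C) (q : seq Z2 -> Z2) gam : Rabs s <= T -> Rabs (t - s) <= T -> 0 <= gam ->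
  (forall v k, v \in words M n -> Cmod (z v k) <= gam * Cmod (y s (Z2add (q v) k))) ->
  \sumR_(v <- words M n) (Cmod (coefw v) * Cmod (\sumC_(k <- L) (phi k * Iwk s k v * z v k))) <=
   gam * ((A * T) ^ n / INR (fact n)) * (nphi * B).
Proof.
move=> Hs Hts g0 Hz; have f0 := INR_fact_lt_0 n.
have i0 : 0 <= / INR (fact n) by apply: Rlt_le; apply: Rinv_0_lt_compat.
have n0 : 0 <= nphi by apply: sqrt_pos.
have Tn0 : 0 <= T ^ n / INR (fact n) by apply: Rmult_le_pos => //; apply: pow_le.
apply: (Rle_trans _ (\sumR_(v <- words M n) (Cmod (coefw v) * (T ^ n / INR (fact n) * gam * (nphi * B))))).
  apply: rsum_seq_le => v vw; apply: Rmult_le_compat_l; first exact: Cmod_ge_0.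
  apply: Rle_trans (Cmod_csum _ _) _.
  apply: (Rle_trans _ (\sumR_(k <- L) (T ^ n / INR (fact n) * gam * (Cmod (phi k) * Cmod (y s (Z2add (q v) k)))))).
    apply: rsum_le => k; rewrite !Cmod_mult.
    have Ib : Cmod (Iwk s k v) <= T ^ n / INR (fact n).
      apply: Rle_trans (Iw_bound_fact _ _ _) _; rewrite size_map (size_words vw).
      by apply: Rmult_le_compat_r => //; apply: pow_incr; split => //; apply: Rabs_pos.
    have -> : T ^ n / INR (fact n) * gam * (Cmod (phi k) * Cmod (y s (Z2add (q v) k))) =
       Cmod (phi k) * (T ^ n / INR (fact n)) * (gam * Cmod (y s (Z2add (q v) k))) by ring.
    apply: Rmult_le_compat; try exact: Cmod_ge_0.
    - by apply: Rmult_le_pos; apply: Cmod_ge_0.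
    - by apply: Rmult_le_compat_l => //; apply: Cmod_ge_0.
    - exact: Hz.
  rewrite -rsum_scal_l; apply: Rmult_le_compat_l; first exact: Rmult_le_pos.
  apply: Rle_trans (phi_pairing s (q v)) _; apply: Rmult_le_compat_l => //; exact: s_bound.
have B0 : 0 <= B by apply: Rle_trans (s_bound Hs); apply: sqrt_pos.
rewrite -rsum_scal_r.
have -> : gam * ((A * T) ^ n / INR (fact n)) * (nphi * B) =
   A ^ n * (T ^ n / INR (fact n) * gam * (nphi * B)) by rewrite Rpow_mult_distr /Rdiv; ring.
apply: Rmult_le_compat_r; last by apply: coefw_sum; apply: box_uniq.
by repeat apply: Rmult_le_pos => //; apply: pow_le.
Qed.

Lemma psum_bound s n : Rabs s <= T -> Rabs (t - s) <= T ->
  Cmod (psum s n) <= A * ((A * T) ^ n / INR (fact n)) * (nphi * B).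
Proof.
move=> Hs Hts; apply: usum_bound (usum_pterm s n) _ => L' uL'.
set W := (A * T) ^ n / _ ; have -> : A * W * (nphi * B) = A * (1 * W * (nphi * B)) by ring.
apply: (Rle_trans _ (\sumR_(m <- L') (Cmod (c m) * (1 * W * (nphi * B))))).
  apply: rsum_le => m.
  apply: Rle_trans (Cmod_csum _ _) _.
  have -> : \sumR_(v <- words M n) Cmod (Ci * c m * coefw v *
      (\sumC_(k <- L) (phi k * Iwk s k v * (cis (osc (Z2add k (wsum v)) m s) * y s (Z2add (Z2add k (wsum v)) m)))))%C =
    Cmod (c m) * \sumR_(v <- words M n) (Cmod (coefw v) * Cmod
      (\sumC_(k <- L) (phi k * Iwk s k v * (cis (osc (Z2add k (wsum v)) m s) * y s (Z2add (Z2add k (wsum v)) m))))%C).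
    by rewrite rsum_scal_l; apply: eq_bigr => v _; rewrite !Cmod_mult Cmod_Ci; ring.
  apply: Rmult_le_compat_l; first exact: Cmod_ge_0.
  apply: (@block_bound s n _ (fun v => Z2add (wsum v) m)) => // [|v k _]; first lra.
  rewrite Cmod_mult Cmod_cis -Z2addA (Z2addC k); lra.
rewrite -rsum_scal_r; apply: Rmult_le_compat_r; last exact: c_sum.
have B0 : 0 <= B by apply: Rle_trans (s_bound Hs); apply: sqrt_pos.
have A0 := dyson_A0.
have i0 : 0 <= / INR (fact n) by apply: Rlt_le; apply: Rinv_0_lt_compat; apply: INR_fact_lt_0.
apply: Rmult_le_pos; last by apply: Rmult_le_pos => //; apply: sqrt_pos.
by rewrite Rmult_1_l; apply: Rmult_le_pos => //; apply: pow_le; apply: Rmult_le_pos.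
Qed.

Variable rho : R.
Hypothesis c_tail : forall L', uniq L' -> (forall m, m \in L' -> m \notin box N) -> \sumR_(m <- L') Cmod (c m) <= rho.

(** A mode in the box meets its partner, and the two phases differ by theta (2 wsum.m + |m|^2) s; a
    mode outside the box has no partner and is charged to the tail [rho]. *)
Lemma psum_dterm_bound s n : Rabs s <= T -> Rabs (t - s) <= T -> 0 <= Cst ->
  (forall v m, v \in words M n -> m \in M -> Rabs (2 * dot (wsum v) m + knorm2 m) <= Cst) ->
  Cmod (psum s n - \sumC_(m <- M) dterm s n m)%C <=
    (rho + A * (th * T * Cst)) * ((A * T) ^ n / INR (fact n)) * (nphi * B).
Proof.
move=> Hs Hts C0 HC.
set W := (A * T) ^ n / _.
have B0 : 0 <= B by apply: Rle_trans (s_bound Hs); apply: sqrt_pos.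
have A0 := dyson_A0.
have i0 : 0 <= / INR (fact n) by apply: Rlt_le; apply: Rinv_0_lt_compat; apply: INR_fact_lt_0.
have W0 : 0 <= W by apply: Rmult_le_pos => //; apply: pow_le; apply: Rmult_le_pos.
have nB0 : 0 <= nphi * B by apply: Rmult_le_pos => //; apply: sqrt_pos.
have eps0 : 0 <= th * T * Cst by repeat apply: Rmult_le_pos.
pose G m := (pterm s n m + (if m \in M then - dterm s n m else 0))%C.
have HG : usum G (psum s n - \sumC_(m <- M) dterm s n m)%C.
  have Hd : usum (fun m => if m \in M then - dterm s n m else 0)%C (- \sumC_(m <- M) dterm s n m)%C.
    have -> : (- \sumC_(m <- M) dterm s n m)%C = \sumC_(m <- M) (if m \in M then - dterm s n m else 0).
      have -> : forall z : C, (- z = RtoC (-1) * z)%C by move=> z; ring.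
      rewrite csum_scal_l big_seq [RHS]big_seq; apply: eq_bigr => m ->; ring.
    by apply: usum_finite => [|m /negbTE ->]; [apply: box_uniq|].
  exact: usum_plus (usum_pterm s n) Hd.
apply: usum_bound HG _ => L' uL'.
have Gin m : m \in M -> Cmod (G m) <= Cmod (c m) * (th * T * Cst * W * (nphi * B)).
  move=> mM; rewrite /G mM.
  have -> : (pterm s n m + - dterm s n m)%C = \sumC_(v <- words M n) (Ci * c m * coefw v *
    (\sumC_(k <- L) (phi k * Iwk s k v * ((cis (osc (Z2add k (wsum v)) m s) - cis (freq k m * s + 0)) * y s (Z2add (Z2add k (wsum v)) m))))).
    have -> : forall a b : C, (a + - b = a + RtoC (-1) * b)%C by move=> a b; ring.
    rewrite /pterm /dterm csum_scal_l -big_split; apply: eq_bigr => v _ /=.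
    rewrite !csum_scal_l -big_split; apply: eq_bigr => k _ /=; ring.
  apply: Rle_trans (Cmod_csum _ _) _.
  rewrite (eq_bigr (fun v => Cmod (c m) * (Cmod (coefw v) * Cmod (\sumC_(k <- L) (phi k * Iwk s k v * ((cis (osc (Z2add k (wsum v)) m s) - cis (freq k m * s + 0)) * y s (Z2add (Z2add k (wsum v)) m))))%C))); last first.
    by move=> v _; rewrite !Cmod_mult Cmod_Ci; ring.
  rewrite -rsum_scal_l; apply: Rmult_le_compat_l; first exact: Cmod_ge_0.
  apply: (@block_bound s n _ (fun v => Z2add (wsum v) m)) => // v k vw.
  have Ek : Z2add (Z2add k (wsum v)) m = Z2add (Z2add (wsum v) m) k by rewrite -Z2addA (Z2addC k).
  rewrite Ek Cmod_mult; apply: Rmult_le_compat_r; first exact: Cmod_ge_0.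
  apply: Rle_trans (cis_Lipschitz _ _) _.
  have -> : th * T * Cst = th * Cst * T by ring.
  have E : osc (Z2add k (wsum v)) m s - (freq k m * s + 0) = th * (2 * dot (wsum v) m + knorm2 m) * s.
    by rewrite /osc /freq dotDl; ring.
  rewrite E !Rabs_mult (Rabs_pos_eq th) //.
  apply: Rmult_le_compat => //; try exact: Rabs_pos.
    by apply: Rmult_le_pos => //; apply: Rabs_pos.
  by apply: Rmult_le_compat_l => //; apply: HC.
have Gout m : m \notin M -> Cmod (G m) <= Cmod (c m) * (1 * W * (nphi * B)).
  move=> mM; rewrite /G (negbTE mM) Cplus_0_r /pterm.
  apply: Rle_trans (Cmod_csum _ _) _.
  rewrite (eq_bigr (fun v => Cmod (c m) * (Cmod (coefw v) * Cmod (\sumC_(k <- L) (phi k * Iwk s k v * (cis (osc (Z2add k (wsum v)) m s) * y s (Z2add (Z2add k (wsum v)) m))))%C))); last first.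
    by move=> v _; rewrite !Cmod_mult Cmod_Ci; ring.
  rewrite -rsum_scal_l; apply: Rmult_le_compat_l; first exact: Cmod_ge_0.
  apply: (@block_bound s n _ (fun v => Z2add (wsum v) m)) => // [|v k _]; first lra.
  rewrite Cmod_mult Cmod_cis -Z2addA (Z2addC k); lra.
rewrite (bigID (fun m => m \in M)) /=.
have -> : (rho + A * (th * T * Cst)) * W * (nphi * B) = A * (th * T * Cst * W * (nphi * B)) + rho * (1 * W * (nphi * B)) by ring.
apply: Rplus_le_compat; rewrite -big_filter.
  apply: (Rle_trans _ (\sumR_(m <- [seq m <- L' | m \in M]) (Cmod (c m) * (th * T * Cst * W * (nphi * B))))).
    by apply: rsum_seq_le => m; rewrite mem_filter => /andP[/Gin].
  rewrite -rsum_scal_r; apply: Rmult_le_compat_r; last by apply: c_sum; rewrite filter_uniq.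
  by repeat apply: Rmult_le_pos => //; apply: sqrt_pos.
apply: (Rle_trans _ (\sumR_(m <- [seq m <- L' | m \notin M]) (Cmod (c m) * (1 * W * (nphi * B))))).
  by apply: rsum_seq_le => m; rewrite mem_filter => /andP[/Gout].
rewrite -rsum_scal_r; apply: Rmult_le_compat_r; first by rewrite Rmult_1_l; apply: Rmult_le_pos.
apply: c_tail; first by rewrite filter_uniq.
by move=> m; rewrite mem_filter => /andP[].
Qed.

(** Tail of the potential and frozen phases, summed over the levels into an exponential, plus the
    last level, which has no successor to cancel it. *)
Definition dyson_err (n : nat) : R :=
  (rho + A * (th * T * Cst)) * exp (A * T) + A * ((A * T) ^ n / INR (fact n)).

(** The derivatives telescope across levels: the sum over m produced at one level is matched by the
    words of the next. The bound sees the finite set [L] only through the norm of [phi], which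
    allows both infinite sums and test functions depending on the solution. *)
Lemma duhamel n : 0 <= Cst -> 0 <= rho ->
  (forall n' v m, (n' < n)%N -> v \in words M n' -> m \in M -> Rabs (2 * dot (wsum v) m + knorm2 m) <= Cst) ->
  Cmod (\sumC_(k <- L) (phi k * y t k) - \sumC_(n' <- seq.iota 0 n.+1) level 0 n')%C <=
    T * (dyson_err n * (nphi * B)).
Proof.
move=> C0 r0 HC.
pose f s := \sumC_(n' <- seq.iota 0 n.+1) level s n'.
pose df s := \sumC_(n' <- seq.iota 0 n.+1) (dlevel s n' + psum s n').
have Hf s : Cder f s (df s) by apply: Cder_big => n'; apply: Cder_level.
have ft : f t = \sumC_(k <- L) (phi k * y t k).
  have -> : f t = (level t 0 + \sumC_(n' <- seq.iota 1 n) level t n')%C by rewrite /f /= big_cons.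
  rewrite (level_end 0) [X in Cplus _ X]big1_seq ?Cplus_0_r // => n' /andP[_]; rewrite mem_iota level_end.
  by case: n'.
rewrite -ft -/(f 0).
have T0' : Rabs 0 <= T by rewrite Rabs_R0.
have B0 : 0 <= B by apply: Rle_trans (s_bound T0'); apply: sqrt_pos.
have A0 := dyson_A0.
have nB0 : 0 <= nphi * B by apply: Rmult_le_pos => //; apply: sqrt_pos.
have eps0 : 0 <= rho + A * (th * T * Cst).
  have : 0 <= A * (th * T * Cst) by repeat apply: Rmult_le_pos.
  lra.
have dfE s : df s = (\sumC_(n' <- seq.iota 0 n) (psum s n' - \sumC_(m <- M) dterm s n' m) + psum s n)%C.
  rewrite /df; move: (n) => q; elim: q => [|q IH]; first by rewrite /= big_seq1 big_nil /=; ring.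
  rewrite (csum_iotaS _ q.+1) IH (csum_iotaS _ q).
  have -> : dlevel s q.+1 = (- \sumC_(m <- M) dterm s q m)%C by [].
  ring.
have dfb s : Rmin 0 t <= s <= Rmax 0 t -> Cmod (df s) <= dyson_err n * (nphi * B).
  move=> Hs.
  have sT : Rabs s <= T.
    move: Hs tT; rewrite /Rmin /Rmax; case: Rle_dec => h Hs /Rabs_le_between h2; apply: Rabs_le; lra.
  have tsT : Rabs (t - s) <= T.
    move: Hs tT; rewrite /Rmin /Rmax; case: Rle_dec => h Hs /Rabs_le_between h2; apply: Rabs_le; lra.
  rewrite dfE /dyson_err Rmult_plus_distr_r.
  apply: Rle_trans (Cmod_triangle _ _) _; apply: Rplus_le_compat; last exact: psum_bound.
  apply: Rle_trans (Cmod_csum _ _) _.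
  apply: (Rle_trans _ (\sumR_(n' <- seq.iota 0 n) ((rho + A * (th * T * Cst)) * ((A * T) ^ n' / INR (fact n')) * (nphi * B)))).
    apply: rsum_seq_le => n'; rewrite mem_iota => /andP[_ Hn'].
    by apply: psum_dterm_bound => // v m; apply: HC; lia.
  rewrite -rsum_scal_r; apply: Rmult_le_compat_r => //.
  rewrite -rsum_scal_l; apply: Rmult_le_compat_l => //.
  by apply: exp_partial_le; apply: Rmult_le_pos.
have := Cder_bound (fun x _ => Hf x) dfb; rewrite Rminus_0_r => h.
apply: Rle_trans h _; rewrite Rmult_comm; apply: Rmult_le_compat_r => //.
apply: Rmult_le_pos => //; rewrite /dyson_err.
have e0 := exp_pos (A * T).
have i0 : 0 <= / INR (fact n) by apply: Rlt_le; apply: Rinv_0_lt_compat; apply: INR_fact_lt_0.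
apply: Rplus_le_le_0_compat; apply: Rmult_le_pos => //; first lra.
by apply: Rmult_le_pos => //; apply: pow_le; apply: Rmult_le_pos.
Qed.

(** Boundedness uniform in the order n and in [L]; it provides the source term of the norm
    bootstrap. *)
Lemma level0_bound n :
  Cmod (\sumC_(n' <- seq.iota 0 n) level 0 n') <= exp (A * T) * (nphi * sqrt (nrm2 (y 0))).
Proof.
have nn : 0 <= nphi * sqrt (nrm2 (y 0)) by apply: Rmult_le_pos; apply: sqrt_pos.
apply: Rle_trans (Cmod_csum _ _) _.
apply: (Rle_trans _ (\sumR_(n' <- seq.iota 0 n) ((A * T) ^ n' / INR (fact n') * (nphi * sqrt (nrm2 (y 0)))))); last first.
  rewrite -rsum_scal_r; apply: Rmult_le_compat_r => //; apply: exp_partial_le.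
  by apply: Rmult_le_pos => //; apply: dyson_A0.
apply: rsum_le => n'.
have f0 := INR_fact_lt_0 n'.
have i0 : 0 <= / INR (fact n') by apply: Rlt_le; apply: Rinv_0_lt_compat.
apply: Rle_trans (Cmod_csum _ _) _.
apply: (Rle_trans _ (\sumR_(v <- words M n') (Cmod (coefw v) * (T ^ n' / INR (fact n') * (nphi * sqrt (nrm2 (y 0))))))).
  apply: rsum_seq_le => v vw; rewrite Cmod_mult; apply: Rmult_le_compat_l; first exact: Cmod_ge_0.
  apply: Rle_trans (Cmod_csum _ _) _.
  apply: (Rle_trans _ (\sumR_(k <- L) (T ^ n' / INR (fact n') * (Cmod (phi k) * Cmod (y 0 (Z2add (wsum v) k)))))).
    apply: rsum_le => k; rewrite !Cmod_mult Z2addC.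
    have Ib : Cmod (Iwk 0 k v) <= T ^ n' / INR (fact n').
      apply: Rle_trans (Iw_bound_fact _ _ _) _; rewrite size_map (size_words vw).
      apply: Rmult_le_compat_r => //; apply: pow_incr; split; [exact: Rabs_pos | by rewrite Rminus_0_r].
    have := Cmod_ge_0 (phi k); have := Cmod_ge_0 (y 0 (Z2add (wsum v) k)).
    set a := Cmod _; set b := Cmod _ => a0 b0.
    have : b * a * Cmod (Iwk 0 k v) <= b * a * (T ^ n' / INR (fact n')).
      by apply: Rmult_le_compat_l => //; apply: Rmult_le_pos.
    lra.
  rewrite -rsum_scal_l; apply: Rmult_le_compat_l; last exact: phi_pairing.
  by apply: Rmult_le_pos => //; apply: pow_le.
rewrite -rsum_scal_r.
have -> : (A * T) ^ n' / INR (fact n') * (nphi * sqrt (nrm2 (y 0))) =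
  A ^ n' * (T ^ n' / INR (fact n') * (nphi * sqrt (nrm2 (y 0)))) by rewrite Rpow_mult_distr /Rdiv; ring.
apply: Rmult_le_compat_r; last by apply: coefw_sum; apply: box_uniq.
by apply: Rmult_le_pos => //; apply: Rmult_le_pos => //; apply: pow_le.
Qed.
End Dynamics.

(** * The Schroedinger evolution in the interaction picture *)

(** The equation is differentiated in [C] as a real normed module; Re and Im are bounded real-linear
    maps, so composing with them gives the componentwise derivatives. *)
Lemma is_derive_Cder (f : R -> C) (x : R) (l : C) :
  is_derive (K := R_AbsRing) (V := C_R_NormedModule) f x l -> Cder f x l.
Proof.
move=> H.
have lin (pr : C -> R) : (forall a b, pr (a + b)%C = pr a + pr b) -> (forall r a, pr (RtoC r * a)%C = r * pr a) ->
    (forall z, Rabs (pr z) <= Cmod z) -> is_derive (fun s => pr (f s)) x (pr l).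
  move=> ha hs hn.
  have sE (r : R) (a : C) : @scal R_AbsRing C_R_NormedModule r a = (RtoC r * a)%C.
    by rewrite /scal /= /prod_scal /scal /= /mult /=; apply: injective_projections => /=; ring.
  have L : is_linear (U := C_R_NormedModule) (V := R_NormedModule) pr.
    split.
    - by move=> a b; apply: ha.
    - by move=> r a; rewrite sE hs.
    - exists 1; split; first lra.
      move=> z; rewrite Rmult_1_l; apply: Rle_trans (hn z) _; apply: Req_le.
      by rewrite /Cmod -(pow2_abs z.1) -(pow2_abs z.2).
  have := @filterdiff_comp' R_AbsRing _ C_R_NormedModule R_NormedModule f pr x _ _ H (@filterdiff_linear R_AbsRing C_R_NormedModule R_NormedModule _ pr L).
  move=> D; apply: (filterdiff_ext_lin _ _ _ D) => s.
  by rewrite sE hs.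
split; apply: lin.
- by []. 
- by move=> r a; rewrite /Re /=; ring.
- exact: Rabs_Re_le.
- by [].
- by move=> r a; rewrite /Im /=; ring.
- exact: Rabs_Im_le.
Qed.

Lemma Cder_zero_const f a b : (forall x, Cder f x (RtoC 0)) -> f a = f b.
Proof.
move=> H; have := @Cder_bound f (fun _ => RtoC 0) a b 0 (fun x _ => H x).
rewrite Cmod_0 Rmult_0_l => /(_ (fun _ _ => Rle_refl 0)) h.
have : (f b - f a)%C = RtoC 0 by apply: Cmod_eq_0; apply: Rle_antisym => //; apply: Cmod_ge_0.
move=> E; have -> : f b = (f b - f a + f a)%C by ring.
by rewrite E; ring.
Qed.

Lemma usum_conj f l : usum f l -> usum (fun k => Cconj (f k)) (Cconj l).
Proof.
move=> H e e0; have [N HN] := H e e0; exists N => L u s.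
by rewrite -csum_conj -Cminus_conj Cmod_Cconj; apply: HN.
Qed.

Lemma fourier2_scal r V m : cont2 V -> fourier2 (fun x y => r * V x y) m = (RtoC r * fourier2 V m)%C.
Proof.
move=> HV; have HrV : cont2 (fun x y => r * V x y) by apply: cont2_mult => //; apply: cont2_const.
rewrite !fourier2E // /fhat -I2_scal.
  by apply: I2_ext => x y; rewrite RtoC_mult; ring.
by apply: Ccont2_mult; [apply: Ccont2_RtoC | apply: Ccont2_cis_Nphase].
Qed.

Lemma fourier2_conj V m k : cont2 V -> Cconj (fourier2 V (Z2sub m k)) = fourier2 V (Z2sub k m).
Proof.
move=> HV.
have E x y : phase (Z2sub k m) x y = - phase (Z2sub m k) x y.
  by rewrite /phase /Z2sub /= !minus_IZR; ring.
have c2 : cont2 (fun x y => V x y * Rtrigo_def.sin (phase (Z2sub m k) x y)).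
  by apply: cont2_mult => //; have [] := Ccont2_cis_phase (Z2sub m k).
rewrite /fourier2 /Cconj; congr pair.
  apply: RInt_extR => x; apply: RInt_extR => y.
  by rewrite -/(phase (Z2sub m k) x y) -/(phase (Z2sub k m) x y) E cos_neg.
rewrite [LHS]/=; congr Ropp; rewrite -RInt_opp_cont; last by move=> x; apply: (@cont2_RInt _ x c2).
apply: RInt_extR => x; rewrite -RInt_opp_cont; last first.
  by move=> y; apply: (@cont2_slice (fun x y => V x y * Rtrigo_def.sin (phase (Z2sub m k) x y)) x y c2).
apply: RInt_extR => y.
by rewrite -/(phase (Z2sub m k) x y) -/(phase (Z2sub k m) x y) E sin_neg; ring.
Qed.

Lemma Cder_comp_scal (f : R -> C) (l : C) a s : Cder f (a * s) l -> Cder (fun s => f (a * s)) s (RtoC a * l)%C.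
Proof.
have D (g : R -> R) r : is_derive g (a * s) r -> is_derive (fun s => g (a * s)) s (a * r).
  move=> H; apply: (is_derive_comp g (fun s => a * s) s r a H).
  by auto_derive => //; ring.
move=> [h1 h2]; split.
  by apply: is_derive_eq (D _ _ h1) _; rewrite /Re /=; ring.
by apply: is_derive_eq (D _ _ h2) _; rewrite /Im /=; ring.
Qed.

Lemma free_solution h psi u : SchrSol h (fun _ _ => 0) psi u -> h <> 0 ->
  forall s k, u s k = (cis (- (2 * PI ^ 2 * h * knorm2 k) * s) * psi k)%C.
Proof.
move=> [u0 [_ [_ ud]]] h0 s k.
pose om := 2 * PI ^ 2 * h * knorm2 k.
have z0 : zsumC (fun j => (fourier2 (fun _ _ => 0) (Z2sub k j) * u s j)%C) = RtoC 0.
  apply: usum_zsumC; apply: usum_ext usum_0 => j.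
  have -> : fourier2 (fun _ _ => 0) (Z2sub k j) = RtoC 0; last by ring.
  (* Writing 0 as 0 times 0 makes the scaling rule for Fourier coefficients give the vanishing of
     the coupling. *)
  have -> : (fun _ _ : R => 0) = (fun x y : R => 0 * 0) by apply: funext => x; apply: funext => y; ring.
  by rewrite (@fourier2_scal 0 (fun _ _ => 0)); [ring | apply: cont2_const].
pose f s := (cis (om * s + 0) * u s k)%C.
have fd x : Cder f x (RtoC 0).
  have zx : zsumC (fun j => (fourier2 (fun _ _ => 0) (Z2sub k j) * u x j)%C) = RtoC 0.
    apply: usum_zsumC; apply: usum_ext usum_0 => j.
    have -> : fourier2 (fun _ _ => 0) (Z2sub k j) = RtoC 0; last by ring.
    have -> : (fun _ _ : R => 0) = (fun x y : R => 0 * 0) by apply: funext => y; apply: funext => y'; ring.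
    by rewrite (@fourier2_scal 0 (fun _ _ => 0)); [ring | apply: cont2_const].
  have := is_derive_Cder (ud x k); rewrite zx => hd.
  apply: Cder_eq (Cder_mult (Cder_cis om 0 x) hd) _.
  have E : (imC om + mIoh h * RtoC (2 * PI ^ 2 * h ^ 2 * knorm2 k) = 0)%C.
    by rewrite /om; apply: injective_projections => /=; field.
  have -> : (imC om * cis (om * x + 0) * u x k + cis (om * x + 0) *
     (mIoh h * (RtoC (2 * PI ^ 2 * h ^ 2 * knorm2 k) * u x k + 0)) =
     (imC om + mIoh h * RtoC (2 * PI ^ 2 * h ^ 2 * knorm2 k)) * (cis (om * x + 0) * u x k))%C by ring.
  by rewrite E; ring.
have := Cder_zero_const s 0 fd; rewrite /f u0 !Rplus_0_r Rmult_0_r cis0 Cmult_1_l => E.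
have -> : u s k = (cis (- (om * s)) * (cis (om * s) * u s k))%C.
  rewrite Cmult_assoc -cis_add; have -> : - (om * s) + om * s = 0 by ring.
  by rewrite cis0; ring.
by rewrite E -/om; have -> : - om * s = - (om * s) by [ring]; ring.
Qed.

Section Interaction.
Variables (V : R -> R -> R) (h ep : R) (psi : Z2 -> C) (u : R -> Z2 -> C).
Hypothesis V_smooth : smooth2 V.
Hypothesis V_per : periodic2 V.
Hypothesis h0 : 0 < h.
Hypothesis ep0 : 0 < ep.
Hypothesis u_sol : SchrSol h (fun x y => ep * V x y) psi u.

Let c := fourier2 V.
Let th := 2 * PI ^ 2 * h ^ 2 / ep.

(** The free phase is undone and time is counted in units of h/eps. The conjugate is taken because
    the perturbed solution sits in the antilinear slot of the overlap. *)
Definition inter (s : R) (k : Z2) : C := Cconj (cis (th * knorm2 k * s) * u (s * (h / ep)) k).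

Definition dinter (s : R) (k : Z2) : C :=
  Cconj (cis (th * knorm2 k * s) * zsumC (fun j => c (Z2sub k j) * u (s * (h / ep)) j))%C.

Lemma inter_nrm2 s : is_l2 (inter s) /\ nrm2 (inter s) = nrm2 (u (s * (h / ep))).
Proof.
have [_ [ul _]] := u_sol.
have E : (fun k => Cmod (inter s k) ^ 2) = (fun k => Cmod (u (s * (h / ep)) k) ^ 2).
  by apply: funext => k; rewrite /inter Cmod_Cconj Cmod_mult Cmod_cis Rmult_1_l.
by have := ul (s * (h / ep)); rewrite /is_l2 /nrm2 E.
Qed.

Lemma conv_sum s k : usum (fun j => c (Z2sub k j) * u s j)%C (zsumC (fun j => c (Z2sub k j) * u s j)%C).
Proof.
have [_ [ul _]] := u_sol; have HV : cont2 V := dR2_cont2 [::] V_smooth.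
have [A HA] := fhat_summable V_smooth V_per.
pose B := sqrt (nrm2 (u s)).
have [j|N|l Hl] := @usum_dominated (fun j => c (Z2sub k j) * u s j)%C (fun j => Cmod (c (Z2sub k j)) * B) (A * B).
- rewrite Cmod_mult; apply: Rmult_le_compat_l; [exact: Cmod_ge_0 | exact: is_l2_pointwise].
- rewrite -rsum_scal_r; apply: Rmult_le_compat_r; first exact: sqrt_pos.
  have inj : injective (Z2sub k).
    by move=> [a b] [a' b']; rewrite /Z2sub /= => -[? ?]; congr pair; lia.
  have := HA [seq Z2sub k j | j <- box N]; rewrite map_inj_uniq // box_uniq big_map => /(_ isT).
  by under eq_bigr => j _ do rewrite -fourier2E //.
by rewrite (usum_zsumC Hl).
Qed.

(** V being real, conjugation reverses the index of its coefficients; the sum over j is then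
    translated to j = k + m, where the free phases combine into [osc]. *)
Lemma inter_sum s k : usum (fun m => c m * cis (osc th k m s) * inter s (Z2add k m))%C (dinter s k).
Proof.
have HV : cont2 V := dR2_cont2 [::] V_smooth.
have H := usum_shift k (usum_conj (usum_scal (cis (th * knorm2 k * s)) (conv_sum (s * (h / ep)) k))).
apply: usum_ext H => m.
rewrite /inter !Cmult_conj !Cconj_cis /c fourier2_conj //.
have -> : Z2sub (Z2add k m) k = m by case: m k => a b [a' b']; rewrite /Z2sub /Z2add /=; congr pair; lia.
have -> : cis (- (th * knorm2 k * s)) = (cis (osc th k m s) * cis (- (th * knorm2 (Z2add k m) * s)))%C.
  by rewrite -cis_add; congr cis; rewrite /osc /knorm2 /dot /Z2add /= !plus_IZR; ring.
ring.
Qed.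

Lemma inter_der s k : Cder (fun s => inter s k) s (Ci * dinter s k)%C.
Proof.
have [_ [_ [_ ud]]] := u_sol; have HV : cont2 V := dR2_cont2 [::] V_smooth.
have hd := is_derive_Cder (ud (s * (h / ep)) k).
have hd2 : Cder (fun s => u (s * (h / ep)) k) s (RtoC (h / ep) * (mIoh h *
  (RtoC (2 * PI ^ 2 * h ^ 2 * knorm2 k) * u (s * (h / ep)) k
            + zsumC (fun j => (fourier2 (fun x y => (ep * V x y)%Re) (Z2sub k j) * u (s * (h / ep)) j)%C))))%C.
  apply: Cder_ext (@Cder_comp_scal (fun s => u s k) _ (h / ep) s _) => [s'|]; first by rewrite Rmult_comm.
  by rewrite (Rmult_comm (h / ep) s).
have Ez : zsumC (fun j => (fourier2 (fun x y => (ep * V x y)%Re) (Z2sub k j) * u (s * (h / ep)) j)%C) =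
    (RtoC ep * zsumC (fun j => c (Z2sub k j) * u (s * (h / ep)) j))%C.
  apply: usum_zsumC; apply: usum_ext (usum_scal (RtoC ep) (conv_sum (s * (h / ep)) k)) => j.
  by rewrite fourier2_scal // /c; ring.
rewrite Ez in hd2.
have hc := Cder_cis (th * knorm2 k) 0 s.
apply: Cder_ext (Cder_eq (Cder_conj (Cder_mult hc hd2)) _) => [s'|]; first by rewrite /inter Rplus_0_r.
rewrite /dinter Rplus_0_r.
have -> : (Ci = Cconj (- Ci))%C by apply: injective_projections => /=; ring.
rewrite -Cmult_conj; congr Cconj.
set z := zsumC _; set a := u _ _; set e := cis _.
have E1 : (imC (th * knorm2 k) + RtoC (h / ep) * mIoh h * RtoC (2 * PI ^ 2 * h ^ 2 * knorm2 k) = 0)%C.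
  by rewrite /th; apply: injective_projections => /=; field; split; lra.
have E2 : (RtoC (h / ep) * mIoh h * RtoC ep = - Ci)%C.
  by apply: injective_projections => /=; field; split; lra.
have -> : (imC (th * knorm2 k) * e * a + e * (RtoC (h / ep) * (mIoh h * (RtoC (2 * PI ^ 2 * h ^ 2 * knorm2 k) * a + RtoC ep * z))) =
  (imC (th * knorm2 k) + RtoC (h / ep) * mIoh h * RtoC (2 * PI ^ 2 * h ^ 2 * knorm2 k)) * (e * a) +
  (RtoC (h / ep) * mIoh h * RtoC ep) * (e * z))%C by ring.
by rewrite E1 E2; ring.
Qed.

Lemma rsum_plus (T : Type) (l : seq T) (f g : T -> R) :
  \sumR_(k <- l) (f k + g k) = (\sumR_(k <- l) f k) + (\sumR_(k <- l) g k).
Proof. exact: big_split. Qed.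

Lemma is_l2_box (a : Z2 -> C) N : is_l2 a -> \sumR_(k <- box N) Cmod (a k) ^ 2 <= nrm2 a.
Proof. by move=> H; apply: is_l2_sum_le => //; apply: box_uniq. Qed.

(** The bound involves only the norm of [b] and of the difference, as suits continuity at a fixed
    time, where [b] is fixed. *)
Lemma nrm2_diff (a b : Z2 -> C) : is_l2 a -> is_l2 b ->
  is_l2 (fun k => a k - b k)%C /\
  Rabs (nrm2 a - nrm2 b) <= nrm2 (fun k => a k - b k)%C + 2 * (sqrt (nrm2 (fun k => a k - b k)%C) * sqrt (nrm2 b)).
Proof.
move=> Ha Hb.
have Hd : is_l2 (fun k => a k - b k)%C.
  have [] // := @is_l2_le (fun k => a k - b k)%C (2 * nrm2 a + 2 * nrm2 b) => N.
  apply: (Rle_trans _ (\sumR_(k <- box N) (2 * Cmod (a k) ^ 2 + 2 * Cmod (b k) ^ 2))).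
    apply: rsum_le => k.
    have : Cmod (a k - b k)%C <= Cmod (a k) + Cmod (b k).
      by apply: Rle_trans (Cmod_triangle _ _) _; rewrite Cmod_opp; lra.
    have := Cmod_ge_0 (a k - b k)%C; have := Cmod_ge_0 (a k); have := Cmod_ge_0 (b k).
    set p := Cmod (a k); set q := Cmod (b k); set r := Cmod _ => q0 p0 r0 h1.
    have : 0 <= (p - q) ^ 2 by apply: pow2_ge_0.
    nra.
  rewrite rsum_plus -!rsum_scal_l.
  have := is_l2_box N Ha; have := is_l2_box N Hb; lra.
split => //.
set d := fun k => (a k - b k)%C in Hd *; set D := nrm2 d.
have tri k : Cmod (a k) <= Cmod (d k) + Cmod (b k) /\ Cmod (b k) <= Cmod (d k) + Cmod (a k).
  split.
    by have -> : a k = (d k + b k)%C; [rewrite /d; ring | apply: Cmod_triangle].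
  have -> : b k = (- d k + a k)%C by rewrite /d; ring.
  by apply: Rle_trans (Cmod_triangle _ _) _; rewrite Cmod_opp; lra.
have pr N : \sumR_(k <- box N) (Cmod (d k) * Cmod (b k)) <= sqrt D * sqrt (nrm2 b).
  have := @l2_pairing d b (0%ZZ, 0%ZZ) (box N) Hd Hb (box_uniq N).
  by under eq_bigr => k _ do rewrite Z2addC Z2add0.
have up H := proj2 (@is_l2_le a (nrm2 b + (D + 2 * (sqrt D * sqrt (nrm2 b)))) H).
have dn H := proj2 (@is_l2_le b (nrm2 a + (D + 2 * (sqrt D * sqrt (nrm2 b)))) H).
have D0 : 0 <= D by apply: nrm2_ge0.
apply: Rabs_le; split.
  suff : nrm2 b <= nrm2 a + (D + 2 * (sqrt D * sqrt (nrm2 b))) by lra.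
  apply: dn => N.
  apply: (Rle_trans _ (\sumR_(k <- box N) (Cmod (a k) ^ 2 + 2 * (Cmod (d k) * Cmod (b k))))).
    apply: rsum_le => k; have [_] := tri k.
    have := Cmod_ge_0 (a k); have := Cmod_ge_0 (b k); have := Cmod_ge_0 (d k).
    (* If |b| <= |d| then |b|^2 <= |d||b|; otherwise the nonnegative number |b| - |d| is at most |a|
       and may be squared. *)
    case: (Rle_dec (Cmod (b k)) (Cmod (d k))) => h1; nra.
  rewrite rsum_plus -rsum_scal_l.
  have := is_l2_box N Ha; have := pr N; lra.
suff : nrm2 a <= nrm2 b + (D + 2 * (sqrt D * sqrt (nrm2 b))) by lra.
apply: up => N.
apply: (Rle_trans _ (\sumR_(k <- box N) (Cmod (b k) ^ 2 + (Cmod (d k) ^ 2 + 2 * (Cmod (d k) * Cmod (b k)))))).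
  apply: rsum_le => k; have [h1 _] := tri k.
  have := Cmod_ge_0 (a k); have := Cmod_ge_0 (b k); have := Cmod_ge_0 (d k); nra.
rewrite !rsum_plus -rsum_scal_l.
have := is_l2_box N Hd; have := is_l2_box N Hb; have := pr N; rewrite -/D; lra.
Qed.

(** A qualitative bound, depending on h, from continuity in L^2 on a compact interval; it starts the
    bootstrap that removes this dependence. *)
Lemma evolution_bounded T : 0 <= T -> exists B, forall s, Rabs s <= T -> sqrt (nrm2 (inter s)) <= B.
Proof.
move=> T0; have [_ [ul [uc _]]] := u_sol.
have cont s : continuity_pt (fun s => nrm2 (u s)) s.
  apply/continuity_pt_filterlim/filterlim_locally => e.
  pose q := sqrt (nrm2 (u s)); have q0 : 0 <= q := sqrt_pos _.
  have e0 := cond_pos e.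
  (* With sqrt D < d <= 1, the increment D + 2 q sqrt D is at most d(1 + 2q) <= e/2. *)
  pose d := Rmin 1 (e / (2 * (1 + 2 * q))).
  have r0 : 0 < e / (2 * (1 + 2 * q)) by apply: Rdiv_lt_0_compat; lra.
  have d0 : 0 < d by apply: Rmin_pos; lra.
  have d20 : 0 < d ^ 2 by nra.
  have /filterlim_locally/(_ (mkposreal _ d20)) := uc s.
  apply: filter_imp => s'; rewrite /ball /= /AbsRing_ball /abs /minus /plus /opp /= => hs.
  have [Hl hb] := nrm2_diff (ul s') (ul s).
  apply: Rle_lt_trans hb _.
  set D := nrm2 _ in hs *.
  have D0 : 0 <= D by apply: nrm2_ge0.
  have Dd : D < d ^ 2 by move: hs; rewrite Ropp_0 Rplus_0_r Rabs_pos_eq //; lra.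
  have sD : sqrt D < d by rewrite -(sqrt_pow2 d); [apply: sqrt_lt_1_alt; lra | lra].
  have d1 : d <= 1 by apply: Rmin_l.
  have dr : d <= e / (2 * (1 + 2 * q)) by apply: Rmin_r.
  have h1 : d * (1 + 2 * q) <= e / 2.
    have -> : e / 2 = e / (2 * (1 + 2 * q)) * (1 + 2 * q) by field; lra.
    by apply: Rmult_le_compat_r => //; lra.
  have := sqrt_pos D; rewrite -/q; nra.
have [|s _|xm [Hm _]] := @continuity_ab_maj (fun s => nrm2 (u s)) (- (T * (h / ep))) (T * (h / ep)).
- by have : 0 <= T * (h / ep); [apply: Rmult_le_pos => //; apply: Rlt_le; apply: Rdiv_lt_0_compat | lra].
- exact: cont.
exists (sqrt (nrm2 (u xm))) => s Hs; have [_ ->] := inter_nrm2 s.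
apply: sqrt_le_1_alt; apply: Hm.
have hp : 0 < h / ep by apply: Rdiv_lt_0_compat.
by move: Hs => /Rabs_le_between; nra.
Qed.
End Interaction.

(** * Norm bound and Dyson expansion of the overlap *)

Lemma usum_close a b l l' B : usum a l -> usum b l' ->
  (forall L, uniq L -> Cmod (\sumC_(k <- L) a k - \sumC_(k <- L) b k)%C <= B) -> Cmod (l - l')%C <= B.
Proof.
move=> Ha Hb HB; apply: le_epsilon => e e0.
have H := usum_plus Ha (usum_scal (RtoC (-1)) Hb).
have [N HN] := H e e0; have := HN (box N) (box_uniq N) (fun x h => h).
rewrite big_split /= -csum_scal_l; set X := \big[_/_]_(_ <- _) _; set Y := \big[_/_]_(_ <- _) _ => h.
have -> : (l - l' = (X - Y) + - (X + RtoC (-1) * Y - (l + RtoC (-1) * l')))%C by ring.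
apply: Rle_trans (Cmod_triangle _ _) _; rewrite Cmod_opp; apply: Rplus_le_compat => //.
by apply: HB; apply: box_uniq.
Qed.

Lemma zsumC_pairing (a b c : Z2 -> C) p B : is_l2 a -> is_l2 b -> (forall k, Cmod (c k) <= B) ->
  usum (fun k => a k * b (Z2add p k) * c k)%C (zsumC (fun k => a k * b (Z2add p k) * c k)%C) /\
  Cmod (zsumC (fun k => a k * b (Z2add p k) * c k)%C) <= B * (sqrt (nrm2 a) * sqrt (nrm2 b)).
Proof.
by move=> Ha Hb Hc; have [l Hl Hb'] := usum_pairing p Ha Hb Hc; rewrite (usum_zsumC Hl).
Qed.

Lemma is_l2_conj psi : is_l2 psi -> is_l2 (fun k => Cconj (psi k)) /\ nrm2 (fun k => Cconj (psi k)) = nrm2 psi.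
Proof.
have E : (fun k => Cmod (Cconj (psi k)) ^ 2) = (fun k => Cmod (psi k) ^ 2).
  by apply: funext => k; rewrite Cmod_Cconj.
by rewrite /is_l2 /nrm2 E.
Qed.

(* Matrix element of one Dyson word: <psi, Op psi> with the iterated integral as symbol. *)
Definition wordQ (th t : R) (psi : Z2 -> C) (v : seq Z2) : C :=
  zsumC (fun k => psi k * Cconj (psi (Z2add (wsum v) k)) * Iwk th t 0 k v)%C.

Section Overlap.
Variables (V : R -> R -> R) (h ep t T A rho Cst : R) (N n : nat) (psi : Z2 -> C) (ue u0 : R -> Z2 -> C).
Hypothesis V_smooth : smooth2 V.
Hypothesis V_per : periodic2 V.
Hypothesis h0 : 0 < h.
Hypothesis ep0 : 0 < ep.
Hypothesis psi_l2 : is_l2 psi.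
Hypothesis psi_nrm : nrm2 psi = 1.
Hypothesis ue_sol : SchrSol h (fun x y => ep * V x y) psi ue.
Hypothesis u0_sol : SchrSol h (fun _ _ => 0) psi u0.
Hypothesis tT : Rabs t <= T.
Let c := fourier2 V.
Let th := 2 * PI ^ 2 * h ^ 2 / ep.
Hypothesis c_sum : forall L, uniq L -> \sumR_(m <- L) Cmod (c m) <= A.
Hypothesis c_tail : forall L, uniq L -> (forall m, m \in L -> m \notin box N) -> \sumR_(m <- L) Cmod (c m) <= rho.
Hypothesis C0 : 0 <= Cst.
Hypothesis rho0 : 0 <= rho.
Hypothesis HC : forall n' v m, (n' < n)%N -> v \in words (box N) n' -> m \in box N ->
  Rabs (2 * dot (wsum v) m + knorm2 m) <= Cst.
Let err := dyson_err A th T Cst rho n.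
Hypothesis err_small : T * err <= / 2.

Let y := inter h ep ue.
Let X := exp (A * T).

Let th0 : 0 <= th.
Proof.
rewrite /th; apply: Rmult_le_pos; last by apply: Rlt_le; apply: Rinv_0_lt_compat.
have := PI_RGT_0 => p; have p2 : 0 < PI ^ 2 by nra.
have h2 : 0 < h ^ 2 by nra.
by apply: Rmult_le_pos; lra.
Qed.

Let T0 : 0 <= T.
Proof. by apply: Rle_trans tT; apply: Rabs_pos. Qed.

Let y_l2 s : is_l2 (y s).
Proof. by have [] := inter_nrm2 ue_sol s. Qed.

Let y0 k : y 0 k = Cconj (psi k).
Proof.
have [E _] := ue_sol.
by rewrite /y /inter !Rmult_0_r Rmult_0_l cis0 E Cmult_1_l.
Qed.

Let y0_nrm : nrm2 (y 0) = 1.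
Proof.
have [_ E] := is_l2_conj psi_l2.
have -> : y 0 = fun k => Cconj (psi k) by apply: funext => k; rewrite y0.
by rewrite E.
Qed.

Let duh s L phi B (sT : Rabs s <= T) (uL : uniq L) (HB : forall s, Rabs s <= T -> sqrt (nrm2 (y s)) <= B) :
  Cmod (\sumC_(k <- L) (phi k * y s k) - \sumC_(n' <- seq.iota 0 n.+1) level c th N y s L phi 0 n')%C <=
  T * (err * (sqrt (\sumR_(k <- L) Cmod (phi k) ^ 2) * B)).
Proof.
apply: (@duhamel c A th T N c_sum th0 T0 y (dinter V h ep ue) y_l2 _ _ s L phi sT uL B Cst HB rho c_tail n C0 rho0 HC).
- by move=> s' k; apply: (inter_sum V_smooth V_per ue_sol).
- by move=> s' k; apply: (inter_der V_smooth V_per h0 ep0 ue_sol).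
Qed.

(** This replaces conservation of the norm, which would require differentiating an infinite sum.
    Testing against the conjugate of the solution on a box gives r^2 <= r (X + B/2) for any bound B
    valid on [-T, T], because T err <= 1/2. So B improves to X + B/2, and iteration contracts to the
    fixed point 2X, free of h. *)
Lemma interaction_apriori s : Rabs s <= T -> sqrt (nrm2 (y s)) <= 2 * X.
Proof.
move=> sT.
have [B0 HB0] := evolution_bounded h0 ep0 ue_sol T0.
have B00 : 0 <= B0 by apply: Rle_trans (HB0 0 _); [apply: sqrt_pos | rewrite Rabs_R0].
have X0 : 0 < X := exp_pos _.
have it j : forall s, Rabs s <= T -> sqrt (nrm2 (y s)) <= 2 * X + B0 * (/ 2) ^ j.
  elim: j => [|j IH] s' s'T; first by rewrite /= Rmult_1_r; have := HB0 s' s'T; rewrite -/y; lra.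
  set B := 2 * X + B0 * (/ 2) ^ j in IH.
  have B_0 : 0 <= B by apply: Rle_trans (IH s' s'T); apply: sqrt_pos.
  have -> : 2 * X + B0 * (/ 2) ^ j.+1 = X + B / 2 by rewrite /B /=; field.
  have XB : 0 <= X + B / 2 by lra.
  have [|_ h1] := @is_l2_le (y s') ((X + B / 2) ^ 2); last first.
    by rewrite -(sqrt_pow2 (X + B / 2)) //; apply: sqrt_le_1_alt.
  move=> J.
  pose phi k := Cconj (y s' k).
  have := duh phi s'T (box_uniq J) IH.
  have Hl0 := @level0_bound c A th T N c_sum T0 y y_l2 s' (box J) phi s'T (box_uniq J) n.+1.
  rewrite y0_nrm sqrt_1 Rmult_1_r -/X in Hl0.
  pose S := \sumC_(k <- box J) (phi k * y s' k).
  pose Lv := \sumC_(n' <- seq.iota 0 n.+1) level c th N y s' (box J) phi 0 n'.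
  rewrite -/S -/Lv in Hl0 *.
  have ES : S = RtoC (\sumR_(k <- box J) Cmod (y s' k) ^ 2).
    rewrite /S RtoC_rsum; apply: eq_bigr => k _; rewrite /phi.
    rewrite /Cmod pow2_sqrt; last by nra.
    by apply: injective_projections => /=; ring.
  have Eq : \sumR_(k <- box J) Cmod (phi k) ^ 2 = \sumR_(k <- box J) Cmod (y s' k) ^ 2.
    by apply: eq_bigr => k _; rewrite /phi Cmod_Cconj.
  rewrite Eq in Hl0 *.
  rewrite ES; set q := \sumR_(k <- box J) _ in Hl0 *.
  have q0 : 0 <= q by apply: rsum_ge0 => k; apply: pow2_ge_0.
  have sq := sqrt_sqrt q q0; have sq0 := sqrt_pos q.
  set r := sqrt q in sq sq0 Hl0 * => h2.
  have h3 : q <= r * (X + B / 2).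
    have : Cmod (RtoC q) <= Cmod (RtoC q - Lv)%C + Cmod Lv.
      by have {1}-> : RtoC q = ((RtoC q - Lv) + Lv)%C; [ring | apply: Cmod_triangle].
    rewrite Cmod_R (Rabs_pos_eq q) // => h4.
    have h5 : T * (err * (r * B)) <= / 2 * (r * B).
      by rewrite -Rmult_assoc; apply: Rmult_le_compat_r => //; apply: Rmult_le_pos.
    by nra.
  have h6 : r <= X + B / 2.
    case: (Req_dec r 0) => [->//|r0].
    by apply: (Rmult_le_reg_l r); lra.
  by rewrite -sq; nra.
apply: le_epsilon => e e0.
have [j Hj] : exists j, B0 * (/ 2) ^ j < e.
  have hh : Rabs (/ 2) < 1 by rewrite Rabs_pos_eq; lra.
  have p : 0 < e / (B0 + 1) by apply: Rdiv_lt_0_compat; lra.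
  have [j Hj] := pow_lt_1_zero (/ 2) hh _ p; exists j.
  have := Hj j (le_n _); have p2 : 0 < (/ 2) ^ j by apply: pow_lt; lra.
  rewrite Rabs_pos_eq; last lra.
  move=> h1; have : (B0 + 1) * (/ 2) ^ j < (B0 + 1) * (e / (B0 + 1)) by apply: Rmult_lt_compat_l; lra.
  have -> : (B0 + 1) * (e / (B0 + 1)) = e by field; lra.
  lra.
by have := it j s sT; lra.
Qed.

Lemma ip_interaction : ip (ue (t * (h / ep))) (u0 (t * (h / ep))) = zsumC (fun k => psi k * y t k)%C.
Proof.
rewrite /ip; congr zsumC; apply: funext => k.
rewrite (free_solution u0_sol); last lra.
rewrite /y /inter Cmult_conj Cconj_cis.
have -> : - (2 * PI ^ 2 * h * knorm2 k) * (t * (h / ep)) = - (2 * PI ^ 2 * h ^ 2 / ep * knorm2 k * t) by field; lra.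
ring.
Qed.

(** The Duhamel estimate with weights psi holds on every finite set of modes with one constant,
    hence survives the passage to the full sums. *)
Lemma overlap_dyson :
  Cmod (ip (ue (t * (h / ep))) (u0 (t * (h / ep))) -
     \sumC_(n' <- seq.iota 0 n.+1) (\sumC_(v <- words (box N) n') (coefw c v * wordQ th t psi v)))%C
  <= T * (err * (2 * X)).
Proof.
rewrite ip_interaction.
have [cpsi_l2 _] := is_l2_conj psi_l2.
have Hy : usum (fun k => psi k * y t k)%C (zsumC (fun k => psi k * y t k)%C).
  have [|H _] := @zsumC_pairing psi (y t) (fun _ => RtoC 1) (0%ZZ, 0%ZZ) 1 psi_l2 (y_l2 t).
    by move=> _; rewrite Cmod_1; lra.
  have E : (fun k => psi k * y t (Z2add (0%ZZ, 0%ZZ) k) * RtoC 1)%C = (fun k => psi k * y t k)%C.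
    by apply: funext => k; rewrite Z2addC Z2add0; ring.
  by rewrite E in H.
have Hw v : usum (fun k => psi k * Cconj (psi (Z2add (wsum v) k)) * Iwk th t 0 k v)%C (wordQ th t psi v).
  have [|H _] := @zsumC_pairing psi (fun k => Cconj (psi k)) (fun k => Iwk th t 0 k v) (wsum v) ((1 + T) ^ size v) psi_l2 cpsi_l2; last exact: H.
  move=> k; rewrite /Iwk; have := @Iw_bound t [seq freq th k m | m <- v] 0 T.
  by rewrite size_map Rminus_0_r; apply.
have HD := usum_big (seq.iota 0 n.+1) (fun n' => usum_big (words (box N) n') (fun v => usum_scal (coefw c v) (Hw v))).
apply: usum_close Hy HD _ => L uL.
have -> : \sumC_(k <- L) (\sumC_(n' <- seq.iota 0 n.+1) (\sumC_(v <- words (box N) n')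
    (coefw c v * (psi k * Cconj (psi (Z2add (wsum v) k)) * Iwk th t 0 k v)))) =
  \sumC_(n' <- seq.iota 0 n.+1) level c th N y t L psi 0 n'.
  rewrite exchange_big /=; apply: eq_bigr => n' _.
  rewrite exchange_big /=; apply: eq_bigr => v _.
  rewrite -csum_scal_l; congr Cmult; apply: eq_bigr => k _.
  by rewrite y0 (Z2addC k); ring.
apply: Rle_trans (duh psi tT uL interaction_apriori) _.
have e0 : 0 <= err.
  rewrite /err /dyson_err; have A0 := dyson_A0 c_sum.
  have i0 : 0 <= / INR (fact n) by apply: Rlt_le; apply: Rinv_0_lt_compat; apply: INR_fact_lt_0.
  have p1 : 0 <= th * T * Cst by apply: Rmult_le_pos => //; apply: Rmult_le_pos.
  have p2 : 0 <= (A * T) ^ n / INR (fact n) by apply: Rmult_le_pos => //; apply: pow_le; apply: Rmult_le_pos.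
  have p3 : 0 < exp (A * T) := exp_pos _.
  have p4 : 0 <= A * (th * T * Cst) by apply: Rmult_le_pos.
  have := Rmult_le_pos _ _ A0 p2; nra.
have X0 : 0 < X := exp_pos _.
apply: Rmult_le_compat_l => //; apply: Rmult_le_compat_l => //.
rewrite -[X in _ <= X]Rmult_1_l; apply: Rmult_le_compat_r; first lra.
by rewrite -sqrt_1 -psi_nrm; apply: sqrt_le_1_alt; apply: is_l2_sum_le.
Qed.
End Overlap.

(** * Test symbols *)

Lemma rsum_iotaS (f : nat -> R) n :
  \sumR_(k <- seq.iota 0 n.+1) f k = (\sumR_(k <- seq.iota 0 n) f k) + f n.
Proof. by rewrite -(addn1 n) iotaD big_cat /= big_seq1 add0n. Qed.

(** The functions u^(-q) exp(-1/u), extended by 0, form a family whose derivatives are combinations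
    of two members; smoothness of the cut-offs follows by induction. *)
Definition flat (q : nat) (u : R) : R := if Rlt_dec 0 u then (/ u) ^ q * exp (- / u) else 0.

Lemma flat_pos q u : 0 < u -> flat q u = (/ u) ^ q * exp (- / u).
Proof. by rewrite /flat; case: Rlt_dec. Qed.

Lemma flat_nonpos q u : u <= 0 -> flat q u = 0.
Proof. by rewrite /flat; case: Rlt_dec => //= h1 h2; lra. Qed.

Lemma flat_ge0 q u : 0 <= flat q u.
Proof.
case: (Rlt_dec 0 u) => h; last by rewrite flat_nonpos; lra.
rewrite flat_pos //; apply: Rmult_le_pos; last by apply: Rlt_le; apply: exp_pos.
by apply: pow_le; apply: Rlt_le; apply: Rinv_0_lt_compat.
Qed.

(** One term of the exponential series, exp(1/u) >= u^(-q-2)/(q+2)!, suffices; quadratic vanishing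
    is what gives derivative 0 at the junction point. *)
Lemma flat_quadratic q u : flat q u <= INR (fact q.+2) * u ^ 2.
Proof.
case: (Rlt_dec 0 u) => h; last first.
  by rewrite flat_nonpos; [apply: Rmult_le_pos; [apply: pos_INR | apply: pow2_ge_0] | lra].
rewrite flat_pos //.
have iu : 0 < / u by apply: Rinv_0_lt_compat.
have h1 : (/ u) ^ q.+2 / INR (fact q.+2) <= exp (/ u).
  apply: Rle_trans (@exp_partial_le (/ u) q.+3 _); last lra.
  rewrite rsum_iotaS; set S := \big[_/_]_(_ <- _) _.
  have : 0 <= S; last lra.
  apply: rsum_ge0 => k; apply: Rmult_le_pos; first by apply: pow_le; lra.
  by apply: Rlt_le; apply: Rinv_0_lt_compat; apply: INR_fact_lt_0.
have f0 := INR_fact_lt_0 q.+2; have e0 := exp_pos (/ u).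
rewrite exp_Ropp.
have -> : (/ u) ^ q * / exp (/ u) = (/ u) ^ q.+2 * u ^ 2 * / exp (/ u) by rewrite -!tech_pow_Rmult; field; lra.
have h2 : (/ u) ^ q.+2 <= INR (fact q.+2) * exp (/ u).
  apply: (Rmult_le_reg_l (/ INR (fact q.+2))); first exact: Rinv_0_lt_compat.
  rewrite -Rmult_assoc Rinv_l; last lra.
  by move: h1; rewrite /Rdiv Rmult_comm; lra.
apply: (Rmult_le_reg_r (exp (/ u))) => //.
rewrite Rmult_assoc Rinv_l; last lra.
have := pow2_ge_0 u; nra.
Qed.

Lemma is_derive_flat q u : is_derive (flat q) u (- INR q * flat q.+1 u + flat q.+2 u).
Proof.
case: (Rtotal_order u 0) => [u0|[->|u0]].
- apply: (is_derive_ext_loc (fun _ => 0)).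
    exists (mkposreal (- u) ltac:(lra)) => v; rewrite /ball /= /AbsRing_ball /abs /minus /plus /opp /= => /Rabs_def2 hv.
    by rewrite flat_nonpos; lra.
  apply: is_derive_eq (is_derive_const (V := R_NormedModule) 0 u) _.
  by rewrite !flat_nonpos; [rewrite /zero /=; ring | lra | lra].
- have -> : - INR q * flat q.+1 0 + flat q.+2 0 = 0 by rewrite !flat_nonpos; [ring | lra | lra].
  apply/is_derive_Reals => e e0.
  have f0 := INR_fact_lt_0 q.+2.
  have p : 0 < e / INR (fact q.+2) by apply: Rdiv_lt_0_compat.
  exists (mkposreal _ p) => d d0 /= hd.
  have -> : flat q 0 = 0 by apply: flat_nonpos; lra.
  rewrite Rplus_0_l !Rminus_0_r Rabs_mult Rabs_inv (Rabs_pos_eq (flat q d)); last exact: flat_ge0.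
  have ad : 0 < Rabs d by apply: Rabs_pos_lt.
  apply: (Rmult_lt_reg_r (Rabs d)) => //; rewrite Rmult_assoc Rinv_l; last lra.
  rewrite Rmult_1_r; apply: Rle_lt_trans (flat_quadratic q d) _.
  rewrite -(pow2_abs d).
  have : INR (fact q.+2) * Rabs d < e.
    have := Rmult_lt_compat_l _ _ _ f0 hd; have -> : INR (fact q.+2) * (e / INR (fact q.+2)) = e by field; lra.
    by [].
  nra.
- apply: (is_derive_ext_loc (fun v => (/ v) ^ q * exp (- / v))).
    exists (mkposreal u u0) => v; rewrite /ball /= /AbsRing_ball /abs /minus /plus /opp /= => /Rabs_def2 hv.
    by rewrite flat_pos; lra.
  have hi : is_derive (fun v => / v) u (- / u ^ 2) by auto_derive; [lra | field; lra].
  have he : is_derive (fun v => exp (- / v)) u (/ u ^ 2 * exp (- / u)) by auto_derive; [lra | field; lra].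
  apply: is_derive_eq (is_derive_Rmult (is_derive_pow _ q _ _ hi) he) _.
  rewrite !flat_pos //.
  case: q => [|q]; first by rewrite /=; field; lra.
  by rewrite -!tech_pow_Rmult; have -> : q.+1.-1 = q by []; field; lra.
Qed.

Lemma flat_continuous q u : continuous (flat q) u.
Proof. by apply: ex_derive_continuous; eexists; apply: is_derive_flat. Qed.

(* The class of finite sums of these products is stable under all partial derivatives. *)
Record tterm := TTerm { tt_c : R; tt_q : nat; tt_r : nat; tt_a : R; tt_b : R; tt_k : R; tt_p : R }.

Definition tval (K : R) (z : tterm) (x y e : R) : R :=
  tt_c z * (flat (tt_q z) (1 + e / K) * flat (tt_r z) (1 - e / K)) *
  Rtrigo_def.cos (tt_a z * x + tt_b z * y + tt_k z * e + tt_p z).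

Definition tsum (K : R) (l : seq tterm) (x y e : R) : R := \sumR_(z <- l) tval K z x y e.

Lemma is_derive_rsum (I : Type) (r : seq I) (f : I -> R -> R) (d : I -> R) x :
  (forall i, is_derive (f i) x (d i)) -> is_derive (fun s => \sumR_(i <- r) f i s) x (\sumR_(i <- r) d i).
Proof.
move=> H; elim: r => [|i r IH].
  apply: (is_derive_ext (fun _ => 0)) => [s|]; first by rewrite big_nil.
  by rewrite big_nil; apply: (is_derive_const (V := R_NormedModule)).
rewrite big_cons; apply: is_derive_ext (is_derive_Rplus (H i) IH) => s.
by rewrite big_cons.
Qed.

Lemma is_derive_cos_lin a b x :
  is_derive (fun s => Rtrigo_def.cos (a * s + b)) x (a * Rtrigo_def.cos (a * x + b + PI / 2)).
Proof. by rewrite cos_plus cos_PI2 sin_PI2; auto_derive => //; ring. Qed.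

Lemma tsum_dx K l x y e : is_derive (fun s => tsum K l s y e) x
  (tsum K [seq TTerm (tt_a z * tt_c z) (tt_q z) (tt_r z) (tt_a z) (tt_b z) (tt_k z) (tt_p z + PI / 2) | z <- l] x y e).
Proof.
rewrite /tsum big_map; apply: is_derive_rsum => z; rewrite /tval /=.
have h := is_derive_scal _ _ (tt_c z * (flat (tt_q z) (1 + e / K) * flat (tt_r z) (1 - e / K))) _
   (is_derive_cos_lin (tt_a z) (tt_b z * y + tt_k z * e + tt_p z) x).
apply: is_derive_eq (is_derive_ext _ _ _ _ _ h) _ => [s|].
  by congr (_ * Rtrigo_def.cos _); ring.
have -> : tt_a z * x + tt_b z * y + tt_k z * e + (tt_p z + PI / 2) =
  tt_a z * x + (tt_b z * y + tt_k z * e + tt_p z) + PI / 2 by ring.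
ring.
Qed.

Lemma tsum_dy K l x y e : is_derive (fun s => tsum K l x s e) y
  (tsum K [seq TTerm (tt_b z * tt_c z) (tt_q z) (tt_r z) (tt_a z) (tt_b z) (tt_k z) (tt_p z + PI / 2) | z <- l] x y e).
Proof.
rewrite /tsum big_map; apply: is_derive_rsum => z; rewrite /tval /=.
have h := is_derive_scal _ _ (tt_c z * (flat (tt_q z) (1 + e / K) * flat (tt_r z) (1 - e / K))) _
   (is_derive_cos_lin (tt_b z) (tt_a z * x + tt_k z * e + tt_p z) y).
apply: is_derive_eq (is_derive_ext _ _ _ _ _ h) _ => [s|].
  by congr (_ * Rtrigo_def.cos _); ring.
have -> : tt_a z * x + tt_b z * y + tt_k z * e + (tt_p z + PI / 2) =
  tt_b z * y + (tt_a z * x + tt_k z * e + tt_p z) + PI / 2 by ring.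
ring.
Qed.

Definition de_terms (K : R) (z : tterm) : seq tterm :=
  let: TTerm c q r a b k p := z in
  [:: TTerm (- INR q / K * c) q.+1 r a b k p; TTerm (/ K * c) q.+2 r a b k p;
      TTerm (INR r / K * c) q r.+1 a b k p; TTerm (- / K * c) q r.+2 a b k p;
      TTerm (k * c) q r a b k (p + PI / 2)].

Lemma tsum_de K l x y e : is_derive (fun s => tsum K l x y s) e
  (tsum K (flatten [seq de_terms K z | z <- l]) x y e).
Proof.
rewrite /tsum big_flatten big_map; apply: is_derive_rsum => -[c q r a b k p]; rewrite /tval /=.
have hf q' s0 : is_derive (fun s => flat q' (1 + s0 * (s / K))) e
    (s0 / K * (- INR q' * flat q'.+1 (1 + s0 * (e / K)) + flat q'.+2 (1 + s0 * (e / K)))).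
  apply: (is_derive_comp (flat q') (fun s => 1 + s0 * (s / K)) e _ (s0 / K) (is_derive_flat _ _)).
  by auto_derive => //; rewrite /Rdiv; ring.
have h1 : is_derive (fun s => flat q (1 + s / K)) e (/ K * (- INR q * flat q.+1 (1 + e / K) + flat q.+2 (1 + e / K))).
  apply: is_derive_eq (is_derive_ext _ _ _ _ _ (hf q 1)) _ => [s|]; first by rewrite Rmult_1_l.
  by rewrite Rmult_1_l /Rdiv; ring.
have h2 : is_derive (fun s => flat r (1 - s / K)) e (- / K * (- INR r * flat r.+1 (1 - e / K) + flat r.+2 (1 - e / K))).
  have E s : 1 + (-1) * (s / K) = 1 - s / K by ring.
  apply: is_derive_eq (is_derive_ext _ _ _ _ _ (hf r (-1))) _ => [s|]; first by rewrite E.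
  by rewrite E /Rdiv; ring.
have h := is_derive_Rmult (is_derive_scal _ _ c _ (is_derive_Rmult h1 h2)) (is_derive_cos_lin k (a * x + b * y + p) e).
apply: is_derive_eq (is_derive_ext _ _ _ _ _ h) _ => [s|].
  by congr (_ * Rtrigo_def.cos _); ring.
rewrite !big_cons big_nil /=.
have -> : a * x + b * y + k * e + (p + PI / 2) = k * e + (a * x + b * y + p) + PI / 2 by ring.
have -> : a * x + b * y + k * e + p = k * e + (a * x + b * y + p) by ring.
rewrite /Rdiv; ring.
Qed.

Lemma tsum_dR3 K ds l : exists l', dR3 ds (tsum K l) = tsum K l'.
Proof.
elim: ds => [|d ds [l' IH]]; first by exists l.
case: d => [|[|d]] /=; rewrite IH.
- eexists; apply: funext => x; apply: funext => y; apply: funext => e; apply: is_derive_unique; exact: tsum_dx.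
- eexists; apply: funext => x; apply: funext => y; apply: funext => e; apply: is_derive_unique; exact: tsum_dy.
- eexists; apply: funext => x; apply: funext => y; apply: funext => e; apply: is_derive_unique; exact: tsum_de.
Qed.

Lemma tsum_continuous K l x y e : continuous (fun p : R * R * R => tsum K l p.1.1 p.1.2 p.2) (x, y, e).
Proof.
have p1 : continuous (fun p : R * R * R => p.1.1) (x, y, e).
  by apply: (continuous_comp fst fst); apply: continuous_fst.
have p2 : continuous (fun p : R * R * R => p.1.2) (x, y, e).
  by apply: (continuous_comp fst snd); [apply: continuous_fst | apply: continuous_snd].
have p3 : continuous (fun p : R * R * R => p.2) (x, y, e) by apply: continuous_snd.
elim: l => [|z l IH].
  apply: (continuous_ext (fun _ => 0)) => [p|]; first by rewrite /tsum big_nil.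
  exact: continuous_const.
apply: (continuous_ext (fun p : R * R * R => tval K z p.1.1 p.1.2 p.2 + tsum K l p.1.1 p.1.2 p.2)).
  by move=> p; rewrite /tsum big_cons.
apply: (continuous_plus (fun p : R * R * R => tval K z p.1.1 p.1.2 p.2)) => //; rewrite /tval.
have scalc c (f : R * R * R -> R) : continuous f (x, y, e) -> continuous (fun p => c * f p) (x, y, e).
  by move=> hf; apply: (continuous_mult (fun _ => c) f) => //; apply: continuous_const.
have addc c (f : R * R * R -> R) : continuous f (x, y, e) -> continuous (fun p => f p + c) (x, y, e).
  by move=> hf; apply: (continuous_plus f (fun _ => c)) => //; apply: continuous_const.
have fl q s : continuous (fun p : R * R * R => flat q (s * p.2 + 1)) (x, y, e).
  apply: (continuous_comp (fun p : R * R * R => s * p.2 + 1) (flat q)); last exact: flat_continuous.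
  by apply: addc; apply: scalc.
apply: (continuous_mult (fun p : R * R * R => tt_c z * (flat (tt_q z) (1 + p.2 / K) * flat (tt_r z) (1 - p.2 / K)))).
  apply: scalc; apply: (continuous_mult (fun p : R * R * R => flat (tt_q z) (1 + p.2 / K))).
    apply: continuous_ext (fl (tt_q z) (/ K)) => p.
    by have -> : / K * p.2 + 1 = 1 + p.2 / K by rewrite /Rdiv; ring.
  apply: continuous_ext (fl (tt_r z) (- / K)) => p.
  by have -> : - / K * p.2 + 1 = 1 - p.2 / K by rewrite /Rdiv; ring.
apply: (continuous_comp (fun p : R * R * R => tt_a z * p.1.1 + tt_b z * p.1.2 + tt_k z * p.2 + tt_p z) Rtrigo_def.cos).
  apply: addc; apply: (continuous_plus (fun p : R * R * R => tt_a z * p.1.1 + tt_b z * p.1.2)); last exact: scalc.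
  by apply: (continuous_plus (fun p : R * R * R => tt_a z * p.1.1)); apply: scalc.
exact: continuous_cos.
Qed.

Lemma tsum_smooth3 K l : smooth3 (tsum K l).
Proof.
move=> ds; have [l' ->] := tsum_dR3 K ds l; split=> x y e; last exact: tsum_continuous.
split; first by eexists; apply: tsum_dx.
split; first by eexists; apply: tsum_dy.
by eexists; apply: tsum_de.
Qed.

(** The factor exp 2 normalises the value at e = 0 to 1. *)
Definition chi (K e : R) : R := exp 2 * (flat 0 (1 + e / K) * flat 0 (1 - e / K)).

Lemma chi_out K e : 0 < K -> K < Rabs e -> chi K e = 0.
Proof.
move=> K0; rewrite /chi => h.
have ek : e = e / K * K by field; lra.
move: h; set q := e / K in ek *; rewrite /Rabs; case: Rcase_abs => h1 h2.
  by rewrite (@flat_nonpos _ (1 + q)); [ring | nra].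
by rewrite (@flat_nonpos _ (1 - q)); [ring | nra].
Qed.

(** Inside the support, with x = e/K, the cut-off is exp(-z), z = 2x^2/(1-x^2). For |x| <= 1/2, 1 -
    exp(-z) <= z <= 2|x|; otherwise 2|x| >= 1. The linear rate is matched to symbols decaying like
    1/|eta|. *)
Lemma chi_range K e : 0 < K -> 0 <= chi K e <= 1 /\ 1 - chi K e <= 2 * (Rabs e / K).
Proof.
move=> K0; rewrite /chi; set x := e / K.
have -> : Rabs e / K = Rabs x by rewrite /x Rabs_mult (Rabs_pos_eq (/ K)) //; apply: Rlt_le; apply: Rinv_0_lt_compat.
have e2 := exp_pos 2.
have ax := Rabs_pos x.
case: (Rlt_dec (Rabs x) 1) => hx; last first.
  have -> : flat 0 (1 + x) * flat 0 (1 - x) = 0.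
    case: (Rlt_dec 0 (1 + x)) => h1; last by rewrite flat_nonpos; [ring | lra].
    case: (Rlt_dec 0 (1 - x)) => h2; last by rewrite (@flat_nonpos _ (1 - x)); [ring | lra].
    by exfalso; apply: hx; apply: Rabs_def1; lra.
  lra.
have /Rabs_def2 [h1 h2] := hx.
have E : exp 2 * (flat 0 (1 + x) * flat 0 (1 - x)) = exp (- (2 * x ^ 2 / (1 - x ^ 2))).
  rewrite !flat_pos; [|lra|lra].
  rewrite /= !Rmult_1_l -!exp_plus; congr exp; field; split; nra.
rewrite E; have x2 : 0 <= x ^ 2 < 1 by nra.
have z0 : 0 <= 2 * x ^ 2 / (1 - x ^ 2).
  by apply: Rmult_le_pos; [nra | apply: Rlt_le; apply: Rinv_0_lt_compat; lra].
set z := 2 * x ^ 2 / (1 - x ^ 2) in z0 *.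
have ez := exp_pos (- z).
have ez1 : exp (- z) <= 1.
  by rewrite -exp_0; case: z0 => [z0|<-]; [apply: Rlt_le; apply: exp_increasing; lra | rewrite Ropp_0; lra].
split; first lra.
case: (Rle_dec (Rabs x) (/ 2)) => hh; last lra.
have h5 : 1 - z <= exp (- z).
  by have := exp_ineq1_le (- z); lra.
have h6 : z <= 2 * Rabs x.
  have zE : z * (1 - x ^ 2) = 2 * x ^ 2 by rewrite /z; field; lra.
  rewrite -(pow2_abs x) in zE x2.
  apply: (Rmult_le_reg_r (1 - Rabs x ^ 2)); first lra.
  by rewrite zE; nra.
lra.
Qed.

Definition tsym (K : R) (m : Z2) (ka ph : R) (x y e : R) : R :=
  chi K e * Rtrigo_def.cos (phase m x y + ka * e + ph).

Lemma tsym_test K m ka ph : 0 < K -> test_symbol (tsym K m ka ph).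
Proof.
move=> K0.
have -> : tsym K m ka ph = tsum K [:: TTerm (exp 2) 0 0 (2 * PI * IZR m.1) (2 * PI * IZR m.2) ka ph].
  apply: funext => x; apply: funext => y; apply: funext => e.
  rewrite /tsum big_seq1 /tval /tsym /chi /=; congr (_ * Rtrigo_def.cos _).
  by rewrite /phase; ring.
split; first exact: tsum_smooth3.
have per a b : Rtrigo_def.cos (b + 2 * PI * IZR a) = Rtrigo_def.cos b.
  by have := cis_add b (2 * PI * IZR a); rewrite cis_2PI Cmult_1_r => -[->].
split.
  move=> x y e; rewrite /tsum !big_seq1 /tval /=; split; congr (_ * _).
    rewrite -(per m.1 (2 * PI * IZR m.1 * x + 2 * PI * IZR m.2 * y + ka * e + ph)); congr Rtrigo_def.cos; ring.
  rewrite -(per m.2 (2 * PI * IZR m.1 * x + 2 * PI * IZR m.2 * y + ka * e + ph)); congr Rtrigo_def.cos; ring.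
exists K => x y e he; rewrite /tsum big_seq1 /tval /=.
by have := chi_out K0 he; rewrite /chi => ->; ring.
Qed.

(** * Quadratic forms of trigonometric symbols and their limits *)

Definition Z2opp (m : Z2) : Z2 := (Z.opp m.1, Z.opp m.2).
Definition cross (m v : Z2) : R := IZR m.1 * IZR v.2 - IZR m.2 * IZR v.1.
(** The rescaled momentum h H_v(xi)/eps at xi = 2 pi h k, the value at mode k of the third variable
    of a symbol. *)
Definition etak (h ep : R) (v k : Z2) : R := h * HL v (2 * PI * h * IZR k.1) (2 * PI * h * IZR k.2) / ep.

Lemma Z2sub_add j m : Z2sub j m = Z2add (Z2opp m) j.
Proof. by rewrite /Z2sub /Z2add /Z2opp /=; congr pair; lia. Qed.

Lemma Z2addNK m j : Z2add m (Z2add (Z2opp m) j) = j.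
Proof. by case: j => a b; rewrite /Z2add /Z2opp /=; congr pair; lia. Qed.

Lemma avgI_invariant v b x y : 0 < Lv v ->
  (forall t, b (x - t * IZR v.2 / Lv v) (y + t * IZR v.1 / Lv v) = b x y) -> avgI v b x y = b x y.
Proof.
move=> L0 H; rewrite /avgI (RInt_extR (g := fun _ => b x y)) // RInt_const /scal /= /mult /=.
by field; lra.
Qed.

Lemma phase_perp m v x y t : 0 < Lv v -> phase m (x - t * IZR v.2 / Lv v) (y + t * IZR v.1 / Lv v) =
  phase m x y - 2 * PI * cross m v / Lv v * t.
Proof. by move=> L0; rewrite /phase /cross; field; lra. Qed.

(** A mode parallel to v is constant along the orthogonal direction, so averaging leaves the symbol
    unchanged. *)
Lemma symb_at_tsym h ep v K m ka ph k : 0 < Lv v -> cross m v = 0 ->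
  symb_at h ep v (tsym K m ka ph) k = (fun x y => chi K (etak h ep v k) *
     Rtrigo_def.cos (phase m x y + (ka * etak h ep v k + ph))).
Proof.
move=> L0 H; apply: funext => x; apply: funext => y; rewrite /symb_at avgI_invariant //.
  by rewrite /tsym -/(etak h ep v k) Rplus_assoc.
by move=> t; rewrite /tsym phase_perp // H; congr (_ * Rtrigo_def.cos (_ + _ + _)); rewrite /Rdiv; ring.
Qed.

Lemma cos_half_cis a : RtoC (Rtrigo_def.cos a) = (RtoC (/ 2) * (cis a + cis (- a)))%C.
Proof. by rewrite /cis cos_neg sin_neg; apply: injective_projections => /=; field. Qed.

Lemma fourier2_cos r m c d : fourier2 (fun x y => r * Rtrigo_def.cos (phase m x y + c)) d =
  ((if m == d then RtoC (r / 2) * cis c else RtoC 0) +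
   (if Z2opp m == d then RtoC (r / 2) * cis (- c) else RtoC 0))%C.
Proof.
rewrite fourier2E; last first.
  apply: cont2_mult; first exact: cont2_const.
  have [h _] := Ccont2_cis (2 * PI * IZR m.1) (2 * PI * IZR m.2) c.
  by apply: cont2_ext h => x y; rewrite /Re /=; congr Rtrigo_def.cos; rewrite /phase; ring.
have h2 k : Ccont2 (fun x y => cis (phase (Z2sub k d) x y)) := Ccont2_cis_phase _.
rewrite /fhat (I2_ext (g := fun x y => (RtoC (r / 2) * cis c) * cis (phase (Z2sub m d) x y) +
   (RtoC (r / 2) * cis (- c)) * cis (phase (Z2sub (Z2opp m) d) x y))%C); last first.
  move=> x y; rewrite RtoC_mult cos_half_cis -!phase_sub.
  have -> : phase (Z2opp m) x y = - phase m x y by rewrite /phase /Z2opp /= !opp_IZR; ring.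
  rewrite Ropp_plus_distr !cis_add.
  have -> : RtoC (r / 2) = (RtoC r * RtoC (/ 2))%C by rewrite -RtoC_mult.
  ring.
have cc z k : Ccont2 (fun x y => z * cis (phase (Z2sub k d) x y))%C.
  by apply: Ccont2_mult => //; apply: Ccont2_const.
rewrite I2_plus // !I2_scal // !I2_cis_phase !Z2sub_eq0.
by case: (_ == d); case: (_ == d); ring.
Qed.

(** The quadratic form of the complex symbol chi(eta) exp(i ka eta) e_m(x), whose operator sends e_k
    to a multiple of e_(k+m). *)
Definition Xsum (h ep : R) (v : Z2) (K : R) (psi : Z2 -> C) (m : Z2) (ka : R) : C :=
  zsumC (fun k => psi k * Cconj (psi (Z2add m k)) * (RtoC (chi K (etak h ep v k)) * cis (ka * etak h ep v k)))%C.

Lemma Xsum_usum h ep v K psi m ka : 0 < K -> is_l2 psi ->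
  usum (fun k => psi k * Cconj (psi (Z2add m k)) * (RtoC (chi K (etak h ep v k)) * cis (ka * etak h ep v k)))%C
   (Xsum h ep v K psi m ka).
Proof.
move=> K0 Hp; have [Hc _] := is_l2_conj Hp.
have [|H _] := @zsumC_pairing psi (fun k => Cconj (psi k)) (fun k => RtoC (chi K (etak h ep v k)) * cis (ka * etak h ep v k))%C m 1 Hp Hc.
  move=> k; rewrite Cmod_mult Cmod_cis Cmod_R Rmult_1_r.
  by have [[h0 h1] _] := chi_range (etak h ep v k) K0; rewrite Rabs_pos_eq.
exact: H.
Qed.

(** A cosine carries the two modes m and -m, so the inner sum over k reduces to the contributions of
    j - m and j + m. *)
Lemma op_quad_tsym h ep v K m ka ph psi : 0 < Lv v -> cross m v = 0 -> 0 < K -> is_l2 psi ->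
  op_quad h ep v (tsym K m ka ph) psi =
  (RtoC (/ 2) * (cis ph * Xsum h ep v K psi m ka + cis (- ph) * Xsum h ep v K psi (Z2opp m) (- ka)))%C.
Proof.
move=> L0 Hcr K0 Hp.
pose g s k := (psi k * (RtoC (chi K (etak h ep v k) / 2) * cis (s * (ka * etak h ep v k + ph))))%C.
have inner j : zsumC (fun k => psi k * fourier2 (symb_at h ep v (tsym K m ka ph) k) (Z2sub j k))%C =
   (g 1 (Z2sub j m) + g (-1) (Z2sub j (Z2opp m)))%C.
  apply: usum_zsumC.
  have one s p : usum (fun k => if p == Z2sub j k then g s k else RtoC 0) (g s (Z2sub j p)).
    have E k : (p == Z2sub j k) = (k == Z2sub j p).
      apply/eqP/eqP => ->; case: j => a b; [case: k => c d | case: p => c d];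
        by rewrite /Z2sub /=; congr pair; lia.
    have := @usum_finite (fun k => if p == Z2sub j k then g s k else RtoC 0) [:: Z2sub j p] isT.
    rewrite big_seq1 E eqxx; apply => k; rewrite inE => /negbTE h'; by rewrite E h'.
  apply: usum_ext (usum_plus (one 1 m) (one (-1) (Z2opp m))) => k.
  rewrite symb_at_tsym // fourier2_cos /g.
  have -> : 1 * (ka * etak h ep v k + ph) = ka * etak h ep v k + ph by ring.
  have -> : -1 * (ka * etak h ep v k + ph) = - (ka * etak h ep v k + ph) by ring.
  by case: (_ == _); case: (_ == _); ring.
apply: usum_zsumC.
have H1 := usum_scal (RtoC (/ 2)) (usum_scal (cis ph) (usum_shift (Z2opp m) (Xsum_usum h ep v m ka K0 Hp))).
have H2 := usum_scal (RtoC (/ 2)) (usum_scal (cis (- ph)) (usum_shift (Z2opp (Z2opp m)) (Xsum_usum h ep v (Z2opp m) (- ka) K0 Hp))).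
rewrite Cmult_plus_distr_l; apply: usum_ext (usum_plus H1 H2) => j /=.
rewrite inner !Z2addNK -!Z2sub_add /g.
set k1 := Z2sub j m; set k2 := Z2sub j (Z2opp m).
have -> : 1 * (ka * etak h ep v k1 + ph) = ka * etak h ep v k1 + ph by ring.
have -> : -1 * (ka * etak h ep v k2 + ph) = - ka * etak h ep v k2 + - ph by ring.
have Eh r : RtoC (r / 2) = (RtoC r * RtoC (/ 2))%C by rewrite -RtoC_mult.
by rewrite !Eh !cis_add; ring.
Qed.

(** The limit hypothesis concerns real symbols; a complex exponential is recovered as cos a + i
    cos(a - pi/2), with two phases of the same family. *)
Lemma Xsum_op_quad h ep v K m ka psi : 0 < Lv v -> cross m v = 0 -> 0 < K -> is_l2 psi ->
  Xsum h ep v K psi m ka =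
  (op_quad h ep v (tsym K m ka 0) psi + Ci * op_quad h ep v (tsym K m ka (- (PI / 2))) psi)%C.
Proof.
move=> L0 Hcr K0 Hp; rewrite !op_quad_tsym // Ropp_0 Ropp_involutive cis0.
have -> : cis (PI / 2) = Ci by rewrite /cis cos_PI2 sin_PI2.
have -> : cis (- (PI / 2)) = (- Ci)%C.
  by rewrite /cis cos_neg sin_neg cos_PI2 sin_PI2; apply: injective_projections => /=; ring.
set X := Xsum _ _ _ _ _ m _; set Y := Xsum _ _ _ _ _ _ _.
have I2' : (Ci * Ci = RtoC (-1))%C by apply: injective_projections => /=; ring.
have H2 : (RtoC (/ 2) * RtoC 2 = RtoC 1)%C by rewrite -RtoC_mult; congr RtoC; field.
have -> : (RtoC (/ 2) * (1 * X + 1 * Y) + Ci * (RtoC (/ 2) * (- Ci * X + Ci * Y)) =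
  RtoC (/ 2) * ((X + Y) - (Ci * Ci) * X + (Ci * Ci) * Y))%C by ring.
rewrite I2'; have -> : (X + Y - RtoC (-1) * X + RtoC (-1) * Y = RtoC 2 * X)%C.
  by apply: injective_projections => /=; ring.
by rewrite Cmult_assoc H2; ring.
Qed.

Definition hlim (f : R -> C) (l : C) : Prop := forall e, 0 < e -> at_right 0 (fun h => Cmod (f h - l)%C < e).

Lemma at_right_intro (P : R -> Prop) h0 : 0 < h0 -> (forall h, 0 < h < h0 -> h <= 1 -> P h) -> at_right 0 P.
Proof.
move=> p H; have m0 : 0 < Rmin h0 1 by apply: Rmin_pos; lra.
exists (mkposreal _ m0) => h; rewrite /ball /= /AbsRing_ball /abs /minus /plus /opp /= => /Rabs_def2 h1 h2.
have := Rmin_l h0 1; have := Rmin_r h0 1 => a b; apply: H; lra.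
Qed.

Lemma at_right_unit : at_right 0 (fun h => 0 < h <= 1).
Proof. by apply: (@at_right_intro _ 1); [lra | move=> h; lra]. Qed.

Definition Fint (F : measure PT R) (g : R -> R -> R -> C) : C :=
  (mint F (fun x y e => Re (g x y e)), mint F (fun x y e => Im (g x y e))).

Definition gsym (K : R) (m : Z2) (ka : R) (x y e : R) : C := (RtoC (chi K e) * cis (phase m x y + ka * e))%C.

Lemma Xsum_lim (eps : R -> R) (psi : R -> Z2 -> C) (v : Z2) (F : measure PT R) K m ka :
  0 < Lv v -> cross m v = 0 -> 0 < K ->
  (forall h, 0 < h <= 1 -> is_l2 (psi h)) ->
  (forall a, test_symbol a -> filterlim (fun h => op_quad h (eps h) v a (psi h)) (at_right 0) (locally (RtoC (mint F a)))) ->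
  hlim (fun h => Xsum h (eps h) v K (psi h) m ka) (Fint F (gsym K m ka)).
Proof.
move=> L0 Hcr K0 Hp HF e e0; have e2 : 0 < e / 2 by lra.
have l1 := HF _ (tsym_test m ka 0 K0); have l2 := HF _ (tsym_test m ka (- (PI / 2)) K0).
move/filterlim_CmodP: l1 => /(_ _ e2) h1; move/filterlim_CmodP: l2 => /(_ _ e2) h2.
apply: filter_imp (filter_and _ _ at_right_unit (filter_and _ _ h1 h2)) => h [hu [hh1 hh2]].
rewrite Xsum_op_quad //; last exact: Hp.
have -> : Fint F (gsym K m ka) = (RtoC (mint F (tsym K m ka 0)) + Ci * RtoC (mint F (tsym K m ka (- (PI / 2)))))%C.
  have E1 : (fun x y e => Re (gsym K m ka x y e)) = tsym K m ka 0.
    apply: funext => x; apply: funext => y; apply: funext => e'.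
    by rewrite /gsym /tsym /Re /= Rplus_0_r; ring.
  have E2 : (fun x y e => Im (gsym K m ka x y e)) = tsym K m ka (- (PI / 2)).
    apply: funext => x; apply: funext => y; apply: funext => e'.
    rewrite /gsym /tsym /Im /=.
    have -> : phase m x y + ka * e' + - (PI / 2) = - (PI / 2 - (phase m x y + ka * e')) by ring.
    by rewrite cos_neg cos_shift; ring.
  by rewrite /Fint E1 E2; apply: injective_projections => /=; ring.
set a := op_quad _ _ _ _ _ in hh1 *; set b := op_quad _ _ _ _ _ in hh2 *.
set a' := RtoC _ in hh1 *; set b' := RtoC _ in hh2 *.
have -> : (a + Ci * b - (a' + Ci * b') = (a - a') + Ci * (b - b'))%C by ring.
apply: Rle_lt_trans (Cmod_triangle _ _) _; rewrite Cmod_mult Cmod_Ci; lra.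
Qed.

(** * Integration against the limit measures *)

Definition meas3 (g : R -> R -> R -> R) : Prop :=
  measurable_fun [set: PT]%classic (fun z : PT => g z.1.1 z.1.2 z.2 : RM).

Lemma meas3_plus f g : meas3 f -> meas3 g -> meas3 (fun x y e => f x y e + g x y e).
Proof. by move=> hf hg; exact: (measurable_realfun.measurable_funD hf hg). Qed.

Lemma meas3_mult f g : meas3 f -> meas3 g -> meas3 (fun x y e => f x y e * g x y e).
Proof. by move=> hf hg; exact: (measurable_realfun.measurable_funM hf hg). Qed.

Lemma meas3_const c : meas3 (fun _ _ _ => c).
Proof. exact: measurable_cst. Qed.

Lemma meas3_x : meas3 (fun x _ _ => x).
Proof. by apply: (measurableT_comp measurable_fst); apply: measurable_fst. Qed.

Lemma meas3_y : meas3 (fun _ y _ => y).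
Proof. by apply: (measurableT_comp measurable_snd); apply: measurable_fst. Qed.

Lemma meas3_e : meas3 (fun _ _ e => e).
Proof. exact: measurable_snd. Qed.

Lemma meas3_comp h g : (forall x, continuity_pt h x) -> meas3 g -> meas3 (fun x y e => h (g x y e)).
Proof.
move=> hc hg; apply: (measurableT_comp _ hg).
apply: measurable_realfun.continuous_measurable_fun => x.
by apply/continuity_ptE; apply: hc.
Qed.

Lemma meas3_lim (u : nat -> R -> R -> R -> R) (g : R -> R -> R -> R) : (forall n, meas3 (u n)) ->
  (forall x y e, is_lim_seq (fun n => u n x y e) (g x y e)) -> meas3 g.
Proof.
move=> hu hl; apply: (measurable_realfun.measurable_fun_cvg (h := fun n (z : PT) => u n z.1.1 z.1.2 z.2)) => //.
move=> z _; apply/cvgrPdist_lt => e e0.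
have /is_lim_seq_spec := hl z.1.1 z.1.2 z.2.
have e0' : 0 < e by apply/RltP.
move=> /(_ (mkposreal e e0')) [N HN].
exists N => // n /= Hn; have := HN n; move/leP: Hn => Hn /(_ Hn) /= h.
by rewrite Num.Theory.distrC; apply/RltP; rewrite -RabsE.
Qed.

Section FiniteMeasure.
Variable F : measure PT R.
Hypothesis Ffin : (F setT < +oo)%E.

Definition mb (g : R -> R -> R -> R) : Prop := meas3 g /\ exists B, forall x y e, Rabs (g x y e) <= B.

Lemma mb_integrable g : mb g -> F.-integrable setT (EFin \o (fun z : PT => g z.1.1 z.1.2 z.2)).
Proof.
move=> [hm [B HB]]; apply: measurable_bounded_integrable => //.
exists B; split; first exact: Num.Theory.num_real.
move=> M /RltP BM z _ /=; apply/RleP; rewrite -RabsE.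
by apply: Rle_trans (HB _ _ _) _; lra.
Qed.

Lemma mint_plus f g : mb f -> mb g -> mint F (fun x y e => f x y e + g x y e) = mint F f + mint F g.
Proof. by move=> /mb_integrable hf /mb_integrable hg; exact: (RintegralD measurableT hf hg). Qed.

Lemma mint_scal r f : mb f -> mint F (fun x y e => r * f x y e) = r * mint F f.
Proof. by move=> /mb_integrable hf; exact: (RintegralZl r measurableT hf). Qed.

Lemma mint_const c : mint F (fun _ _ _ => c) = c * mass F.
Proof. exact: (Rintegral_cst F measurableT c). Qed.

Lemma mint_le f g : mb f -> mb g -> (forall x y e, f x y e <= g x y e) -> mint F f <= mint F g.
Proof.
move=> /mb_integrable hf /mb_integrable hg H.
by apply/RleP; apply: (le_Rintegral measurableT hf hg) => z _; apply/RleP.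
Qed.

Lemma mb_const c : mb (fun _ _ _ => c).
Proof. by split; [apply: meas3_const | exists (Rabs c) => *; lra]. Qed.

Lemma mass_ge0 : 0 <= mass F.
Proof. by apply/RleP; apply: fine_ge0. Qed.

Lemma mint_bound f B : mb f -> (forall x y e, Rabs (f x y e) <= B) -> Rabs (mint F f) <= B * mass F.
Proof.
move=> hf HB.
have h x y e : - B <= f x y e <= B by apply/Rabs_le_between; apply: HB.
have h1 := mint_le (mb_const (- B)) hf (fun x y e => proj1 (h x y e)).
have h2 := mint_le hf (mb_const B) (fun x y e => proj2 (h x y e)).
by rewrite !mint_const in h1 h2; apply: Rabs_le; lra.
Qed.

Lemma mb_plus f g : mb f -> mb g -> mb (fun x y e => f x y e + g x y e).
Proof.
move=> [hf [B HB]] [hg [B' HB']]; split; first exact: meas3_plus.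
exists (B + B') => x y e; apply: Rle_trans (Rabs_triang _ _) _; exact: Rplus_le_compat.
Qed.

Lemma mb_mult f g : mb f -> mb g -> mb (fun x y e => f x y e * g x y e).
Proof.
move=> [hf [B HB]] [hg [B' HB']]; split; first exact: meas3_mult.
exists (B * B') => x y e; rewrite Rabs_mult; apply: Rmult_le_compat => //; exact: Rabs_pos.
Qed.

Definition Cmb (g : R -> R -> R -> C) : Prop :=
  mb (fun x y e => Re (g x y e)) /\ mb (fun x y e => Im (g x y e)).

Lemma Cmb_plus f g : Cmb f -> Cmb g -> Cmb (fun x y e => f x y e + g x y e)%C.
Proof. by move=> [a b] [c d]; split; apply: mb_plus. Qed.

Lemma mb_ext f g : (forall x y e, f x y e = g x y e) -> mb f -> mb g.
Proof.
move=> E; have -> : g = f; last by [].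
by apply: funext => x; apply: funext => y; apply: funext => e; rewrite E.
Qed.

Lemma Cmb_ext f g : (forall x y e, f x y e = g x y e) -> Cmb f -> Cmb g.
Proof. by move=> E [a b]; split; [apply: mb_ext a | apply: mb_ext b] => x y e; rewrite E. Qed.

Lemma Cmb_mult f g : Cmb f -> Cmb g -> Cmb (fun x y e => f x y e * g x y e)%C.
Proof.
move=> [a b] [c d]; have n1 := mb_const (-1); split.
  apply: mb_ext (mb_plus (mb_mult a c) (mb_mult n1 (mb_mult b d))) => x y e.
  by rewrite /Re /Im /=; ring.
by apply: mb_ext (mb_plus (mb_mult a d) (mb_mult b c)) => x y e.
Qed.

Lemma Cmb_const c : Cmb (fun _ _ _ => c).
Proof. by split; apply: mb_const. Qed.

Lemma Cmb_RtoC f : mb f -> Cmb (fun x y e => RtoC (f x y e)).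
Proof. by move=> h; split => //; apply: mb_const. Qed.

Lemma Cmb_cis g : meas3 g -> Cmb (fun x y e => cis (g x y e)).
Proof.
move=> h; split; split.
- by apply: (meas3_comp continuity_cos).
- by exists 1 => x y e; apply: Rabs_le; have := COS_bound (g x y e); rewrite /Re /=; lra.
- by apply: (meas3_comp continuity_sin).
- by exists 1 => x y e; apply: Rabs_le; have := SIN_bound (g x y e); rewrite /Im /=; lra.
Qed.

Lemma Cmb_big (I : Type) (r : seq I) (f : I -> R -> R -> R -> C) :
  (forall i, Cmb (f i)) -> Cmb (fun x y e => \sumC_(i <- r) f i x y e).
Proof.
move=> H; elim: r => [|i r IH].
  by apply: Cmb_ext (Cmb_const (RtoC 0)) => x y e; rewrite big_nil.
by apply: Cmb_ext (Cmb_plus (H i) IH) => x y e; rewrite big_cons.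
Qed.

Lemma Cmb_lim (u : nat -> R -> R -> R -> C) g B : (forall n, Cmb (u n)) ->
  (forall x y e, filterlim (fun n => u n x y e) eventually (locally (g x y e))) ->
  (forall x y e, Cmod (g x y e) <= B) -> Cmb g.
Proof.
move=> hu hl HB; split; split.
- apply: (meas3_lim (u := fun n x y e => Re (u n x y e))) => [n|x y e].
    by have [[]] := hu n.
  exact: Re_lim.
- by exists B => x y e; apply: Rle_trans (Rabs_Re_le _) (HB x y e).
- apply: (meas3_lim (u := fun n x y e => Im (u n x y e))) => [n|x y e].
    by have [_ []] := hu n.
  exact: Im_lim.
- by exists B => x y e; apply: Rle_trans (Rabs_Im_le _) (HB x y e).
Qed.

Lemma Fint_ext f g : (forall x y e, f x y e = g x y e) -> Fint F f = Fint F g.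
Proof.
move=> E; have -> : g = f; last by [].
by apply: funext => x; apply: funext => y; apply: funext => e; rewrite E.
Qed.

Lemma mint_ext f g : (forall x y e, f x y e = g x y e) -> mint F f = mint F g.
Proof.
move=> E; have -> : g = f; last by [].
by apply: funext => x; apply: funext => y; apply: funext => e; rewrite E.
Qed.

Lemma Fint_plus f g : Cmb f -> Cmb g -> Fint F (fun x y e => f x y e + g x y e)%C = (Fint F f + Fint F g)%C.
Proof.
by move=> [a b] [c d]; apply: injective_projections; [exact: (mint_plus a c) | exact: (mint_plus b d)].
Qed.

Lemma Fint_scal z f : Cmb f -> Fint F (fun x y e => z * f x y e)%C = (z * Fint F f)%C.
Proof.
move=> [a b]; have ms r g : mb g -> mb (fun x y e => r * g x y e) by apply: mb_mult; apply: mb_const.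
apply: injective_projections => /=.
  rewrite (@mint_ext _ (fun x y e => z.1 * Re (f x y e) + (- z.2) * Im (f x y e))).
    by rewrite mint_plus ?mint_scal //; [ring | exact: ms | exact: ms].
  by move=> x y e; rewrite /Re /Im /=; ring.
rewrite (@mint_ext _ (fun x y e => z.1 * Im (f x y e) + z.2 * Re (f x y e))).
  by rewrite mint_plus ?mint_scal //; exact: ms.
by move=> x y e; rewrite /Re /Im /=; ring.
Qed.

Lemma Fint_0 : Fint F (fun _ _ _ => RtoC 0) = RtoC 0.
Proof. by rewrite /Fint /= mint_const Rmult_0_l. Qed.

Lemma Fint_const z : Fint F (fun _ _ _ => z) = (z * RtoC (mass F))%C.
Proof. by rewrite /Fint !mint_const; apply: injective_projections => /=; rewrite /Re /Im; ring. Qed.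

Lemma Fint_big (I : Type) (r : seq I) (f : I -> R -> R -> R -> C) : (forall i, Cmb (f i)) ->
  Fint F (fun x y e => \sumC_(i <- r) f i x y e) = \sumC_(i <- r) Fint F (f i).
Proof.
move=> H; elim: r => [|i r IH].
  rewrite big_nil -[RHS]Fint_0; apply: Fint_ext => x y e; by rewrite big_nil.
rewrite big_cons -IH -Fint_plus //; last exact: Cmb_big.
by apply: Fint_ext => x y e; rewrite big_cons.
Qed.

(** Real and imaginary parts are bounded separately, whence the factor 2; it reappears in the
    constants below. *)
Lemma Fint_bound f B : Cmb f -> (forall x y e, Cmod (f x y e) <= B) -> Cmod (Fint F f) <= 2 * B * mass F.
Proof.
move=> [a b] HB; apply: Rle_trans (Cmod_le_abs _) _.
have h1 : Rabs (Re (Fint F f)) <= B * mass F.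
  by apply: (mint_bound a) => x y e; apply: Rle_trans (Rabs_Re_le _) (HB x y e).
have h2 : Rabs (Im (Fint F f)) <= B * mass F.
  by apply: (mint_bound b) => x y e; apply: Rle_trans (Rabs_Im_le _) (HB x y e).
lra.
Qed.

Lemma chi_continuity K x : continuity_pt (chi K) x.
Proof.
apply/continuity_pt_filterlim; apply: ex_derive_continuous.
have := tsum_de K [:: TTerm (exp 2) 0 0 0 0 0 0] 0 0 x; set d := tsum _ _ _ _ _ => H.
exists d; apply: is_derive_ext H => s.
by rewrite /tsum big_seq1 /tval /chi /= !Rmult_0_l !Rplus_0_r cos_0; ring.
Qed.

Lemma mb_chi K : 0 < K -> mb (fun _ _ e => chi K e).
Proof.
move=> K0; split; first by apply: (meas3_comp (chi_continuity K)); apply: meas3_e.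
by exists 1 => x y e; have [[h0 h1] _] := chi_range e K0; rewrite Rabs_pos_eq.
Qed.

Lemma meas3_phase m : meas3 (fun x y _ => phase m x y).
Proof.
rewrite /phase; apply: (meas3_mult (meas3_const (2 * PI))).
by apply: meas3_plus; apply: meas3_mult; (try exact: meas3_const); [apply: meas3_x | apply: meas3_y].
Qed.

Lemma Cmb_exp m ka : Cmb (fun x y e => cis (phase m x y + ka * e)).
Proof.
apply: Cmb_cis; apply: meas3_plus; first exact: meas3_phase.
by apply: meas3_mult; [exact: meas3_const | exact: meas3_e].
Qed.

Lemma Cmb_gsym K m ka : 0 < K -> Cmb (gsym K m ka).
Proof. by move=> K0; apply: Cmb_mult; [apply: Cmb_RtoC; apply: mb_chi | apply: Cmb_exp]. Qed.

(** Test symbols have compact support, so the total mass is only approached. Dominated convergence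
    along K = n+1 shows that a cut-off of F itself loses arbitrarily little. *)
Lemma chi_mass_lim e : 0 < e -> exists K, 0 < K /\ mass F - mint F (fun _ _ x => chi K x) < e.
Proof.
move=> e0.
pose fn n (z : PT) : \bar R := (chi (INR n.+1) z.2)%:E%E.
have K0 n : 0 < INR n.+1 by apply: lt_0_INR; lia.
have i1 := mb_integrable (mb_const 1).
have [|||||] := @dominated_convergence _ _ _ F [set: PT]%classic measurableT fn (fun _ => 1%:E)%E (fun _ => 1%:E)%E.
- by move=> n; apply/measurable_realfun.measurable_EFinP; have [hm _] := mb_chi (K0 n); exact: hm.
- exact: measurable_cst.
- apply: aeW => z _.
  apply/fine_cvgP; split; first by apply: nearW => n.
  apply/cvgrPdist_lt => d /RltP d0.
  have [N HN] := INR_unbounded (2 * Rabs z.2 / d).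
  exists N => // n /= Hn; apply/RltP; rewrite -RabsE.
  have [[h0 h1] h2] := chi_range z.2 (K0 n).
  suff : Rabs (1 - chi (INR n.+1) z.2) < d by [].
  rewrite Rabs_pos_eq; last lra.
  apply: Rle_lt_trans h2 _.
  have nN : INR N <= INR n.+1 by apply: le_INR; apply/leP; apply: leq_trans Hn _.
  have kn := K0 n.
  apply: (Rmult_lt_reg_r (INR n.+1)) => //.
  have -> : 2 * (Rabs z.2 / INR n.+1) * INR n.+1 = (d : R) * (2 * Rabs z.2 / (d : R)).
    move: (INR n.+1) kn (Rabs z.2) (d : R) d0 => q q0 r d' d0'.
    have qn : q <> 0 by apply: Rgt_not_eq.
    have dn : d' <> 0 by apply: Rgt_not_eq.
    by field.
  by apply: Rmult_lt_compat_l => //; lra.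
- exact: i1.
- apply: aeW => z n _; rewrite /fn /= lee_fin; apply/RleP; rewrite -RabsE.
  by have [[h0 h1] h2] := chi_range z.2 (K0 n); rewrite Rabs_pos_eq.
move=> _ _ hc.
have fm : (\int[F]_(z in [set: PT]%classic) 1%:E)%E = (mass F)%:E%E.
  rewrite integral_cst ?measurableT // mul1e /mass fineK // ge0_fin_numE //.
rewrite fm in hc.
have /fine_cvgP [_ /cvgrPdist_lt] := hc.
have e0' : (0 < e)%R by apply/RltP.
move=> /(_ e e0') [N _ HN].
exists (INR N.+1); split; first exact: K0.
have := HN N (leqnn N) => /= /RltP; rewrite -RabsE => h.
by apply: Rle_lt_trans (Rle_abs _) h.
Qed.
End FiniteMeasure.

(** * Semiclassical limits of single Dyson words *)

(** The factor relating the frequency of a letter m parallel to v to the variable eta. *)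
Definition sl (v m : Z2) : R := 2 * PI * dot m v / Lv v.
Definition Gw (t : R) (v : Z2) (w : seq Z2) (e : R) : C := Iw t [seq (c * e)%Re | c <- [seq sl v m | m <- w]] 0.
Definition gword (t : R) (v : Z2) (w : seq Z2) (x y e : R) : C := (Gw t v w e * cis (phase (wsum w) x y))%C.

Lemma IZR_sq_ge1 z : z <> 0%ZZ -> 1 <= IZR z ^ 2.
Proof.
move=> H; have -> : IZR z ^ 2 = IZR (z * z) by rewrite mult_IZR; ring.
by apply: IZR_le; nia.
Qed.

Lemma knorm2_ge0 m : 0 <= knorm2 m.
Proof. by rewrite /knorm2; nra. Qed.

Lemma knorm2_ge1 (m : Z2) : m <> (0%ZZ, 0%ZZ) -> 1 <= knorm2 m.
Proof.
case: m => a b H; rewrite /knorm2 /=.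
case: (Z.eq_dec a 0) => [a0|/IZR_sq_ge1 a1] /=.
  have b0 : b <> 0%ZZ by move=> b0; apply: H; rewrite a0 b0.
  by have := IZR_sq_ge1 b0 => /=; nra.
by rewrite /= in a1; nra.
Qed.

Lemma Lv_sq v : Lv v ^ 2 = knorm2 v.
Proof. by rewrite /Lv pow2_sqrt //; apply: knorm2_ge0. Qed.

(** Rests on (m.v)(k.v) - (k.m)|v|^2 = -(m x v)(k x v): for m parallel to v, k.m depends on k only
    through k.v. *)
Lemma freq_par h ep v k m : 0 < Lv v -> ep <> 0 -> cross m v = 0 ->
  freq (2 * PI ^ 2 * h ^ 2 / ep) k m = sl v m * etak h ep v k.
Proof.
move=> L0 e0 Hc.
have E : dot m v * dot k v - dot k m * Lv v ^ 2 = - cross m v * cross k v.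
  by rewrite Lv_sq /dot /cross /knorm2; ring.
have E2 : dot k m = dot m v * dot k v / Lv v ^ 2.
  have -> : dot m v * dot k v = dot k m * Lv v ^ 2 by rewrite Hc in E; lra.
  by field; lra.
rewrite /freq E2 /sl /etak /HL.
have -> : 2 * PI * h * IZR k.1 * IZR v.1 + 2 * PI * h * IZR k.2 * IZR v.2 = 2 * PI * h * dot k v.
  by rewrite /dot; ring.
by field; lra.
Qed.

(** For m parallel to v this slope is 2 pi |m| up to sign, and a nonzero integer vector has length
    at least 1. *)
Lemma sl_ge1 v m : 0 < Lv v -> cross m v = 0 -> m <> (0%ZZ, 0%ZZ) -> 1 <= Rabs (sl v m).
Proof.
move=> L0 Hc m0; have m1 := knorm2_ge1 m0.
have E : dot m v ^ 2 = knorm2 m * Lv v ^ 2.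
  have : dot m v ^ 2 = knorm2 m * Lv v ^ 2 - cross m v ^ 2 by rewrite Lv_sq /dot /cross /knorm2; ring.
  by rewrite Hc; lra.
have h : Lv v <= Rabs (dot m v).
  apply: Rsqr_incr_0_var; last exact: Rabs_pos.
  rewrite -Rsqr_abs /Rsqr; nra.
have pi0 := PI_RGT_0.
rewrite /sl /Rdiv Rabs_mult Rabs_inv (Rabs_pos_eq (Lv v)); last lra.
rewrite Rabs_mult (Rabs_pos_eq (2 * PI)); last lra.
apply: (Rmult_le_reg_r (Lv v)) => //; rewrite Rmult_assoc Rinv_l; last lra.
by have := PI2_1; nra.
Qed.

Lemma cross_add m p v : cross (Z2add m p) v = cross m v + cross p v.
Proof. by rewrite /cross /Z2add /= !plus_IZR; ring. Qed.

Lemma cross_wsum w v : (forall m, m \in w -> cross m v = 0) -> cross (wsum w) v = 0.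
Proof.
elim: w => [|m w IH] H; first by rewrite /cross /=; ring.
rewrite /= cross_add H ?mem_head // IH; first ring.
by move=> p pw; apply: H; rewrite in_cons pw orbT.
Qed.

Lemma hlim_plus f g l m : hlim f l -> hlim g m -> hlim (fun h => f h + g h)%C (l + m)%C.
Proof.
move=> Hf Hg e e0; have e2 : 0 < e / 2 by lra.
apply: filter_imp (filter_and _ _ (Hf _ e2) (Hg _ e2)) => h [h1 h2].
have -> : (f h + g h - (l + m) = (f h - l) + (g h - m))%C by ring.
by apply: Rle_lt_trans (Cmod_triangle _ _) _; lra.
Qed.

Lemma hlim_const l : hlim (fun _ => l) l.
Proof. by move=> e e0; apply: filter_forall => h; have -> : (l - l = 0)%C by [ring]; rewrite Cmod_0. Qed.

Lemma hlim_scal z f l : hlim f l -> hlim (fun h => z * f h)%C (z * l)%C.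
Proof.
move=> Hf e e0; have z0 := Cmod_ge_0 z.
have e2 : 0 < e / (1 + Cmod z) by apply: Rdiv_lt_0_compat; lra.
apply: filter_imp (Hf _ e2) => h h1.
have -> : (z * f h - z * l = z * (f h - l))%C by ring.
rewrite Cmod_mult; apply: (Rle_lt_trans _ (Cmod z * (e / (1 + Cmod z)))).
  by apply: Rmult_le_compat_l => //; lra.
have {2}-> : e = (1 + Cmod z) * (e / (1 + Cmod z)) by field; lra.
by nra.
Qed.

Lemma hlim_big (I : Type) (r : seq I) (f : I -> R -> C) (l : I -> C) :
  (forall i, hlim (f i) (l i)) -> hlim (fun h => \sumC_(i <- r) f i h) (\sumC_(i <- r) l i).
Proof.
move=> H; elim: r => [|i r IH].
  rewrite big_nil => e e0; apply: filter_imp (hlim_const (RtoC 0) e0) => h; by rewrite big_nil.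
rewrite big_cons => e e0; apply: filter_imp (hlim_plus (H i) IH e0) => h; by rewrite big_cons.
Qed.

Lemma hlim_ext f g l : at_right 0 (fun h => f h = g h) -> hlim f l -> hlim g l.
Proof. by move=> E H e e0; apply: filter_imp (filter_and _ _ E (H e e0)) => h [<-]. Qed.

Lemma hlim_approx f l : (forall d, 0 < d -> exists2 g, exists2 m, hlim g m & Cmod (m - l)%C <= d &
   at_right 0 (fun h => Cmod (f h - g h)%C <= d)) -> hlim f l.
Proof.
move=> H e e0; have e4 : 0 < e / 4 by lra.
have [g [m Hg Hm] Hfg] := H _ e4.
apply: filter_imp (filter_and _ _ Hfg (Hg _ e4)) => h [h1 h2].
have -> : (f h - l = (f h - g h) + ((g h - m) + (m - l)))%C by ring.
apply: Rle_lt_trans (Cmod_triangle _ _) _.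
by have := Cmod_triangle (g h - m) (m - l); lra.
Qed.

Section WordLimits.
Variables (eps : R -> R) (psi : R -> Z2 -> C) (t : R).
Hypothesis eps_pos : forall h, 0 < h <= 1 -> 0 < eps h.
Hypothesis psi_unit : forall h, 0 < h <= 1 -> is_l2 (psi h) /\ nrm2 (psi h) = 1.

Let th h := 2 * PI ^ 2 * h ^ 2 / eps h.
Let T := Rabs t.

Lemma Gw_bound v w e : Cmod (Gw t v w e) <= (1 + T) ^ size w.
Proof.
have := @Iw_bound t [seq (c * e)%Re | c <- [seq sl v m | m <- w]] 0 T.
by rewrite !size_map Rminus_0_r; apply; apply: Rle_refl.
Qed.

Lemma Cmb_expsum Q m : Cmb (fun x y e => expsum Q e * cis (phase m x y))%C.
Proof.
apply: (@Cmb_ext (fun x y e => \sumC_(q <- Q) (q.1 * cis (phase m x y + q.2 * e)))).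
  move=> x y e; rewrite /expsum Cmult_comm csum_scal_l; apply: eq_bigr => q _.
  by rewrite cis_add; ring.
by apply: Cmb_big => q; apply: Cmb_mult; [apply: Cmb_const | apply: Cmb_exp].
Qed.

Lemma Gw_approx v w K d : 0 <= K -> 0 < d -> exists Q, forall e, Rabs e <= K -> Cmod (Gw t v w e - expsum Q e)%C <= d.
Proof.
move=> K0 d0; have [|Q HQ] := @Iw_expsum_approx t [seq sl v m | m <- w] T K (Rabs_pos t) K0 d 0 d0.
  by rewrite Rminus_0_r; apply: Rle_refl.
by exists Q.
Qed.

(** Measurability in eta is obtained from a pointwise limit of exponential sums, the n-th being
    accurate to 1/(n+1) on the window |eta| <= n. *)
Lemma Cmb_gword v w : Cmb (gword t v w).
Proof.
have [Q HQ] : exists Q : nat -> seq (C * R), forall n e, Rabs e <= INR n -> Cmod (Gw t v w e - expsum (Q n) e)%C <= / INR n.+1.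
  have H (n : nat) : exists Q, forall e, Rabs e <= INR n -> Cmod (Gw t v w e - expsum Q e)%C <= / INR n.+1.
    by apply: Gw_approx; [apply: pos_INR | apply: Rinv_0_lt_compat; apply: lt_0_INR; lia].
  by have [Q HQ] := choice H; exists Q.
apply: (@Cmb_lim (fun n x y e => expsum (Q n) e * cis (phase (wsum w) x y))%C _ ((1 + T) ^ size w)).
- by move=> n; apply: Cmb_expsum.
- move=> x y e; apply: eventually_CmodP => d d0.
  have [N1 HN1] := INR_unbounded (Rabs e); have [N2 HN2] := INR_unbounded (/ d).
  exists (maxn N1 N2) => n Hn.
  have n1 : INR N1 <= INR n by apply: le_INR; lia.
  have n2 : INR N2 <= INR n by apply: le_INR; lia.
  rewrite /gword; set a := expsum _ _; set b := cis _.
  have -> : (a * b - Gw t v w e * b = - (Gw t v w e - a) * b)%C by ring.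
  rewrite Cmod_mult Cmod_cis Cmod_opp Rmult_1_r.
  apply: Rle_trans (HQ n e _) _; first lra.
  rewrite -(Rinv_inv d); apply: Rinv_le_contravar; first exact: Rinv_0_lt_compat.
  by rewrite S_INR; lra.
- by move=> x y e; rewrite /gword Cmod_mult Cmod_cis Rmult_1_r; apply: Gw_bound.
Qed.

(** A nonzero letter oscillates at least as fast as |eta|, so integrating by parts at that letter
    gains 1/|eta|. *)
Lemma Gw_decay v w e : 0 < Lv v -> (forall m, m \in w -> cross m v = 0) ->
  (exists2 m, m \in w & m <> (0%ZZ, 0%ZZ)) -> Rabs e * Cmod (Gw t v w e) <= 3 * (1 + T) ^ size w.
Proof.
move=> L0 Hp [m mw m0].
have p0 : 0 <= (1 + T) ^ size w by apply: pow_le; have := Rabs_pos t; rewrite -/T; lra.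
case: (Req_dec e 0) => [->|e0]; first by rewrite Rabs_R0 Rmult_0_l; lra.
have ea : 0 < Rabs e by apply: Rabs_pos_lt.
have := @Iw_fast t [seq (c * e)%Re | c <- [seq sl v m | m <- w]] 0 T (Rabs e) ea.
rewrite Rminus_0_r !size_map => /(_ (Rle_refl _)) H.
have : Cmod (Gw t v w e) <= 3 * (1 + T) ^ size w / Rabs e.
  apply: H; exists (sl v m * e).
    by apply: map_f; apply: map_f.
  rewrite Rabs_mult; have := sl_ge1 L0 (Hp _ mw) m0; nra.
move=> h; have -> : 3 * (1 + T) ^ size w = Rabs e * (3 * (1 + T) ^ size w / Rabs e) by field; lra.
by apply: Rmult_le_compat_l => //; lra.
Qed.

Lemma wordQ_usum h w c B : 0 < h <= 1 -> (forall k, Cmod (c k) <= B) ->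
  usum (fun k => psi h k * Cconj (psi h (Z2add (wsum w) k)) * c k)%C
    (zsumC (fun k => psi h k * Cconj (psi h (Z2add (wsum w) k)) * c k)%C) /\
  Cmod (zsumC (fun k => psi h k * Cconj (psi h (Z2add (wsum w) k)) * c k)%C) <= B.
Proof.
move=> hh Hc; have [H1 H2] := psi_unit hh; have [H3 H4] := is_l2_conj H1.
have [a b] := zsumC_pairing (wsum w) H1 H3 Hc; split; first exact: a.
by move: b; rewrite H4 H2 sqrt_1 !Rmult_1_r.
Qed.

Lemma Iwk_bound h k w : Cmod (Iwk (th h) t 0 k w) <= (1 + T) ^ size w.
Proof.
have := @Iw_bound t [seq freq (th h) k m | m <- w] 0 T.
by rewrite size_map Rminus_0_r; apply; apply: Rle_refl.
Qed.

(* A word along [v] with a nonzero letter has a symbol decaying like [1/|eta|], so cutting it off at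
   [|eta| <= K] costs [O(1/K)] both in the quadratic form and in the limit integral; the cut-off
   symbol is then replaced by exponential sums, which are admissible test symbols. *)
Lemma par_word_lim v w (F : measure PT R) : 0 < Lv v -> (F setT < +oo)%E ->
  (forall a, test_symbol a -> filterlim (fun h => op_quad h (eps h) v a (psi h)) (at_right 0) (locally (RtoC (mint F a)))) ->
  (forall m, m \in w -> cross m v = 0) -> (exists2 m, m \in w & m <> (0%ZZ, 0%ZZ)) ->
  hlim (fun h => wordQ (th h) t (psi h) w) (Fint F (gword t v w)).
Proof.
move=> L0 Ffin HF Hp Hnz; apply: hlim_approx => d d0.
set C2 := 3 * (1 + T) ^ size w.
have C20 : 0 < C2 by rewrite /C2; have := pow_lt (1 + T) (size w); have := Rabs_pos t; rewrite -/T; nra.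
have mF := mass_ge0 F.
pose d' := d / (1 + 2 * mass F); have d'0 : 0 < d' by apply: Rdiv_lt_0_compat; lra.
have dd' : d' * (1 + 2 * mass F) = d by rewrite /d'; field; lra.
(* With this K the cut-off error (2|e|/K)|Gw| is at most 2 C2/K = d'/2; the other half is the
   exponential-sum error on |e| <= K. The factor 1 + 2 mass in [d'] covers the limit integral. *)
pose K := 4 * C2 / d'; have K0 : 0 < K by apply: Rdiv_lt_0_compat; lra.
have d2 : 0 < d' / 2 by lra.
have [Q HQ] := Gw_approx v w (Rlt_le _ _ K0) d2.
have key e : Cmod (Gw t v w e - RtoC (chi K e) * expsum Q e)%C <= d'.
  have [[c0 c1] c2] := chi_range e K0.
  have -> : (Gw t v w e - RtoC (chi K e) * expsum Q e =
     RtoC (1 - chi K e) * Gw t v w e + RtoC (chi K e) * (Gw t v w e - expsum Q e))%C.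
    by rewrite RtoC_minus; ring.
  apply: Rle_trans (Cmod_triangle _ _) _; rewrite !Cmod_mult !Cmod_R !Rabs_pos_eq; try lra.
  have h1 : (1 - chi K e) * Cmod (Gw t v w e) <= d' / 2.
    apply: (Rle_trans _ (2 * (Rabs e / K) * Cmod (Gw t v w e))).
      by apply: Rmult_le_compat_r => //; apply: Cmod_ge_0.
    have -> : 2 * (Rabs e / K) * Cmod (Gw t v w e) = 2 / K * (Rabs e * Cmod (Gw t v w e)) by field; lra.
    have -> : d' / 2 = 2 / K * C2 by rewrite /K; field; lra.
    apply: Rmult_le_compat_l; first by apply: Rlt_le; apply: Rdiv_lt_0_compat; lra.
    exact: Gw_decay.
  have h2 : chi K e * Cmod (Gw t v w e - expsum Q e)%C <= d' / 2.
    case: (Rle_dec (Rabs e) K) => he.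
      by have := HQ e he; have := Cmod_ge_0 (Gw t v w e - expsum Q e)%C; nra.
    by rewrite chi_out //; lra.
  lra.
have Hcr := cross_wsum Hp.
exists (fun h => \sumC_(q <- Q) (q.1 * Xsum h (eps h) v K (psi h) (wsum w) q.2)).
  exists (\sumC_(q <- Q) (q.1 * Fint F (gsym K (wsum w) q.2))).
    apply: hlim_big => q; apply: hlim_scal; apply: Xsum_lim => //.
    by move=> h hh; have [] := psi_unit hh.
  have E : (\sumC_(q <- Q) (q.1 * Fint F (gsym K (wsum w) q.2)) - Fint F (gword t v w) =
     Fint F (fun x y e => - (Gw t v w e - RtoC (chi K e) * expsum Q e) * cis (phase (wsum w) x y)))%C.
    have cg q : Cmb (fun x y e => q.1 * gsym K (wsum w) q.2 x y e)%C.
      by apply: Cmb_mult; [apply: Cmb_const | apply: Cmb_gsym].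
    have cw := Cmb_gword v w.
    have cm : Cmb (fun x y e => RtoC (-1) * gword t v w x y e)%C by apply: Cmb_mult => //; apply: Cmb_const.
    have cs : Cmb (fun x y e => \sumC_(q <- Q) (q.1 * gsym K (wsum w) q.2 x y e)) by apply: Cmb_big.
    rewrite (eq_bigr (fun q => Fint F (fun x y e => q.1 * gsym K (wsum w) q.2 x y e)%C)); last first.
      by move=> q _; rewrite Fint_scal //; apply: Cmb_gsym.
    rewrite -(Fint_big Ffin) //.
    have -> : forall a b : C, (a - b = a + RtoC (-1) * b)%C by move=> a b; ring.
    rewrite -(Fint_scal Ffin) // -(Fint_plus Ffin) //.
    apply: Fint_ext => x y e; rewrite /gword /gsym /expsum.
    rewrite (eq_bigr (fun q => (RtoC (chi K e) * cis (phase (wsum w) x y)) * (q.1 * cis (q.2 * e)))%C); last first.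
      by move=> q _; rewrite cis_add; ring.
    by rewrite -csum_scal_l; ring.
  rewrite E.
  have cE : Cmb (fun x y e => - (Gw t v w e - RtoC (chi K e) * expsum Q e) * cis (phase (wsum w) x y))%C.
    apply: (@Cmb_ext (fun x y e => RtoC (-1) * gword t v w x y e + RtoC (chi K e) * (expsum Q e * cis (phase (wsum w) x y)))%C).
      by move=> x y e; rewrite /gword; ring.
    apply: Cmb_plus; apply: Cmb_mult; [exact: Cmb_const | exact: Cmb_gword | by apply: Cmb_RtoC; apply: mb_chi | exact: Cmb_expsum].
  apply: Rle_trans (Fint_bound Ffin (B := d') cE _) _; last by nra.
  by move=> x y e; rewrite Cmod_mult Cmod_cis Cmod_opp Rmult_1_r.
apply: filter_imp at_right_unit => h hh.
have ep := eps_pos hh; have [pl _] := psi_unit hh.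
have IG k : Iwk (th h) t 0 k w = Gw t v w (etak h (eps h) v k).
  rewrite /Iwk /Gw; congr Iw; rewrite -map_comp; apply/eq_in_map => m mw.
  by rewrite /= /th (@freq_par h (eps h) v k m) //; [lra | apply: Hp].
have [H1 H2] := @wordQ_usum h w (fun k => Gw t v w (etak h (eps h) v k) - RtoC (chi K (etak h (eps h) v k)) * expsum Q (etak h (eps h) v k))%C d' hh (fun k => key _).
have [H3 _] := @wordQ_usum h w (fun k => Iwk (th h) t 0 k w) _ hh (fun k => Iwk_bound h k w).
have H4 := usum_big Q (fun q => usum_scal q.1 (Xsum_usum h (eps h) v (wsum w) q.2 K0 pl)).
have H5 := usum_plus H3 (usum_scal (RtoC (-1)) H4).
have -> : (wordQ (th h) t (psi h) w - \sumC_(q <- Q) (q.1 * Xsum h (eps h) v K (psi h) (wsum w) q.2))%C =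
   zsumC (fun k => psi h k * Cconj (psi h (Z2add (wsum w) k)) * (Gw t v w (etak h (eps h) v k) - RtoC (chi K (etak h (eps h) v k)) * expsum Q (etak h (eps h) v k)))%C.
  have -> : forall a b : C, (a - b = a + RtoC (-1) * b)%C by move=> a b; ring.
  apply: usum_unique H5 _; apply: usum_ext H1 => k.
  rewrite IG /expsum.
  rewrite [X in (_ = _ + RtoC (-1) * X)%C](eq_bigr (fun q => (psi h k * Cconj (psi h (Z2add (wsum w) k)) * RtoC (chi K (etak h (eps h) v k))) * (q.1 * cis (q.2 * etak h (eps h) v k)))%C); last first.
    by move=> q _; ring.
  by rewrite -csum_scal_l; ring.
apply: Rle_trans H2 _.
by rewrite -dd'; nra.
Qed.

(** Here the symbol is constant and cannot be cut off, but the form is evaluated exactly: the volume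
    of a simplex times the squared norm of psi, which is 1. *)
Lemma zero_word_lim w : (forall m, m \in w -> m = (0%ZZ, 0%ZZ)) ->
  hlim (fun h => wordQ (th h) t (psi h) w) (RtoC (t ^ size w / INR (fact (size w)))).
Proof.
move=> Hz.
have w0 : wsum w = (0%ZZ, 0%ZZ).
  elim: w Hz => [//|m w IH] Hz /=; rewrite (Hz m) ?mem_head // Z2addC Z2add0; apply: IH.
  by move=> p pw; apply: Hz; rewrite in_cons pw orbT.
apply: hlim_ext (hlim_const _); apply: filter_imp at_right_unit => h hh.
have [pl p1] := psi_unit hh.
set r := t ^ size w / INR (fact (size w)).
have IE k : Iwk (th h) t 0 k w = RtoC r.
  rewrite /Iwk Iw_zero; first by rewrite size_map Rminus_0_r.
  move=> o /mapP [m mw ->]; rewrite (Hz m mw) /freq /dot /=; ring.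
have [H _] := @wordQ_usum h w (fun k => Iwk (th h) t 0 k w) _ hh (fun k => Iwk_bound h k w).
apply: (usum_unique _ H).
have E k : (RtoC r * RtoC (Cmod (psi h k) ^ 2))%C = (psi h k * Cconj (psi h (Z2add (wsum w) k)) * Iwk (th h) t 0 k w)%C.
  rewrite IE w0 Z2addC Z2add0 Cmult_comm; congr Cmult.
  rewrite /Cmod pow2_sqrt; last by nra.
  by apply: injective_projections => /=; ring.
apply: usum_ext E _.
suff H1 : usum (fun k => RtoC (Cmod (psi h k) ^ 2)) (RtoC 1).
  by have := usum_scal (RtoC r) H1; rewrite Cmult_1_r.
rewrite -p1.
have [|N|l Hl] := @usum_dominated (fun k => RtoC (Cmod (psi h k) ^ 2)) (fun k => Cmod (psi h k) ^ 2) 1.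
- by move=> k; rewrite Cmod_R Rabs_pos_eq; [lra | apply: pow2_ge_0].
- by rewrite -p1; apply: is_l2_box.
have -> : RtoC (nrm2 (psi h)) = l; last exact: Hl.
have h1 := Re_lim (usum_sqsum Hl); have h2 := Im_lim (usum_sqsum Hl).
have e1 : (fun n => Re (sqsumC (fun k => RtoC (Cmod (psi h k) ^ 2)) n)) = sqsumR (fun k => Cmod (psi h k) ^ 2).
  by apply: funext => n; rewrite sqsumCE sqsumRE -RtoC_rsum.
have e2 : (fun n => Im (sqsumC (fun k => RtoC (Cmod (psi h k) ^ 2)) n)) = (fun _ => 0).
  by apply: funext => n; rewrite sqsumCE -RtoC_rsum.
rewrite e1 in h1; rewrite e2 in h2.
have h3 := is_lim_seq_unique _ _ h2; rewrite Lim_seq_const in h3.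
rewrite /nrm2 (is_lim_seq_unique _ _ h1).
by case: l h3 {Hl h1 h2} => a b /= [<-].
Qed.
End WordLimits.

(** * Non-parallel modes and the total mass *)

Lemma cross_sq_ge1 m1 m2 : cross m1 m2 <> 0 -> 1 <= cross m1 m2 ^ 2.
Proof.
have -> : cross m1 m2 = IZR (m1.1 * m2.2 - m1.2 * m2.1) by rewrite /cross minus_IZR !mult_IZR.
by move=> H; apply: IZR_sq_ge1 => H0; apply: H; rewrite H0.
Qed.

Lemma knorm2_pair_gt0 m1 m2 : cross m1 m2 <> 0 -> 0 < knorm2 m1 + knorm2 m2.
Proof.
move=> /cross_sq_ge1 c1; have n1 := knorm2_ge0 m1; have n2 := knorm2_ge0 m2.
have : cross m1 m2 ^ 2 = knorm2 m1 * knorm2 m2 - dot m1 m2 ^ 2 by rewrite /cross /knorm2 /dot; ring.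
by have := pow2_ge_0 (dot m1 m2); nra.
Qed.

(* [(m1 x m2)^2 |k|^2 = |(k.m1) m2 - (k.m2) m1|^2], so [k] cannot be nearly orthogonal to both
   [m1] and [m2]. *)
Lemma fast_letter h ep del m1 m2 k : 0 < h -> 0 < ep -> 0 < del -> cross m1 m2 <> 0 ->
  del < 4 * PI ^ 2 * h ^ 2 * knorm2 k ->
  exists2 m, m \in [:: m1; m2] &
    h / ep * sqrt (del / (knorm2 m1 + knorm2 m2)) <= Rabs (freq (2 * PI ^ 2 * h ^ 2 / ep) k m).
Proof.
move=> h0 ep0 del0 Hc Hk; have c1 := cross_sq_ge1 Hc.
have n1 := knorm2_ge0 m1; have n2 := knorm2_ge0 m2; have nk := knorm2_ge0 k.
set S := knorm2 m1 + knorm2 m2.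
have S0 : 0 < S := knorm2_pair_gt0 Hc.
have id : cross m1 m2 ^ 2 * knorm2 k <= 2 * (dot k m1 ^ 2 * knorm2 m2 + dot k m2 ^ 2 * knorm2 m1).
  have -> : cross m1 m2 ^ 2 * knorm2 k =
     (dot k m1 * IZR m2.1 - dot k m2 * IZR m1.1) ^ 2 + (dot k m1 * IZR m2.2 - dot k m2 * IZR m1.2) ^ 2.
    by rewrite /cross /knorm2 /dot; ring.
  have q (a b : R) : (a - b) ^ 2 <= 2 * (a ^ 2 + b ^ 2) by have := pow2_ge_0 (a + b); nra.
  apply: Rle_trans (Rplus_le_compat _ _ _ _ (q _ _) (q _ _)) _.
  by apply: Req_le; rewrite /knorm2; ring.
have [m mi Hm] : exists2 m, m \in [:: m1; m2] & knorm2 k <= 2 * S * dot k m ^ 2.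
  case: (Rle_dec (dot k m1 ^ 2) (dot k m2 ^ 2)) => hd.
    exists m2; first by rewrite !inE eqxx orbT.
    by rewrite /S; nra.
  exists m1; first by rewrite !inE eqxx.
  by rewrite /S; nra.
exists m => //; have pi2 : 2 <= PI by have := PI2_1; lra.
set d := dot k m in Hm *.
have -> : Rabs (freq (2 * PI ^ 2 * h ^ 2 / ep) k m) = h / ep * (4 * PI ^ 2 * h * Rabs d).
  have -> : freq (2 * PI ^ 2 * h ^ 2 / ep) k m = h / ep * (4 * PI ^ 2 * h) * d.
    by rewrite /freq -/d; field; lra.
  rewrite Rabs_mult Rabs_pos_eq; first ring.
  apply: Rmult_le_pos; last by nra.
  by apply: Rlt_le; apply: Rdiv_lt_0_compat.
apply: Rmult_le_compat_l; first by apply: Rlt_le; apply: Rdiv_lt_0_compat.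
have a0 := Rabs_pos d.
rewrite -(sqrt_pow2 (4 * PI ^ 2 * h * Rabs d)); last first.
  by apply: Rmult_le_pos => //; nra.
apply: sqrt_le_1_alt.
have -> : (4 * PI ^ 2 * h * Rabs d) ^ 2 = 16 * PI ^ 4 * h ^ 2 * d ^ 2.
  by rewrite -(pow2_abs d); ring.
apply: (Rmult_le_reg_r S) => //.
have -> : del / S * S = del by field; lra.
have p0 : 0 <= PI ^ 2 * h ^ 2 by nra.
have -> : 16 * PI ^ 4 * h ^ 2 * d ^ 2 * S = 8 * PI ^ 2 * (PI ^ 2 * h ^ 2) * (2 * S * d ^ 2) by ring.
have s0 : 0 <= 2 * S * d ^ 2 by lra.
have h1 : 4 * PI ^ 2 * h ^ 2 * knorm2 k <= 4 * (PI ^ 2 * h ^ 2) * (2 * S * d ^ 2).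
  have -> : 4 * PI ^ 2 * h ^ 2 * knorm2 k = 4 * (PI ^ 2 * h ^ 2) * knorm2 k by ring.
  by apply: Rmult_le_compat_l; lra.
have h2 : 0 <= (PI ^ 2 * h ^ 2) * (2 * S * d ^ 2) by apply: Rmult_le_pos.
have p4 : 4 <= PI ^ 2 by nra.
by nra.
Qed.

Lemma at_right_all (I : eqType) (r : seq I) (P : I -> R -> Prop) :
  (forall i, i \in r -> at_right 0 (P i)) -> at_right 0 (fun h => forall i, i \in r -> P i h).
Proof.
elim: r => [|a r IH] H; first by apply: filter_forall.
have h1 := H a (mem_head _ _).
have h2 := IH (fun i ir => H i (mem_behead (s := a :: r) ir)).
apply: filter_imp (filter_and _ _ h1 h2) => h [p1 p2] i.
by rewrite in_cons => /orP [/eqP -> //|]; apply: p2.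
Qed.

Lemma disjoint_sum_le1 (I : eqType) (r : seq I) (f : I -> R) : uniq r ->
  (forall i, 0 <= f i <= 1) ->
  (forall i j, i \in r -> j \in r -> i <> j -> f i = 0 \/ f j = 0) ->
  0 <= \sumR_(i <- r) f i <= 1.
Proof.
move=> ur f01; elim: r ur => [|a r IH] /=; first by rewrite big_nil; lra.
case/andP => ar ur H; rewrite big_cons.
have [h1 h2] := IH ur (fun i j ir jr => H i j (mem_behead (s := a :: r) ir) (mem_behead (s := a :: r) jr)).
case: (Req_dec (f a) 0) => [->|fa]; first by lra.
have -> : \sumR_(i <- r) f i = 0.
  rewrite (eq_big_seq (fun _ => 0)).
    by elim: (r) => [|b r' IHr]; rewrite ?big_nil // big_cons IHr Rplus_0_l.
  move=> i ir; have [//|//|] := H a i (mem_head _ _) (mem_behead (s := a :: r) ir).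
    by move=> ai; move: ar; rewrite ai ir.
  by [].
by have := f01 a; lra.
Qed.

Definition lowp (del h : R) (psi : Z2 -> C) (k : Z2) : C :=
  if Rle_dec (4 * PI ^ 2 * h ^ 2 * knorm2 k) del then psi k else RtoC 0.

Section Mixed.
Variables (eps : R -> R) (psi : R -> Z2 -> C).
Hypothesis eps_pos : forall h, 0 < h <= 1 -> 0 < eps h.
Hypothesis eps_up : filterlim (fun h => eps h / h) (at_right 0) (locally 0).
Hypothesis psi_unit : forall h, 0 < h <= 1 -> is_l2 (psi h) /\ nrm2 (psi h) = 1.
Hypothesis psi_low : forall eta, 0 < eta -> exists delta0, 0 < delta0 /\
            forall delta, 0 < delta < delta0 -> exists h0, 0 < h0 /\
              forall h, 0 < h < h0 -> h <= 1 -> sqrt (nrm2 (lowp delta h (psi h))) < eta.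

Lemma ratio_infty M : at_right 0 (fun h => M < h / eps h).
Proof.
have m0 : 0 < / (1 + Rabs M) by apply: Rinv_0_lt_compat; have := Rabs_pos M; lra.
have H : at_right 0 (fun h => Rabs (eps h / h) < / (1 + Rabs M)).
  have := eps_up (locally_ball (0 : R) (mkposreal _ m0)).
  by rewrite /filtermap => H; apply: filter_imp H => h; rewrite /ball /= /AbsRing_ball /abs /minus /plus /opp /= Ropp_0 Rplus_0_r.
apply: filter_imp (filter_and _ _ H at_right_unit) => h [h1 hh].
have ep := eps_pos hh; have p : 0 < eps h / h by apply: Rdiv_lt_0_compat; lra.
rewrite Rabs_pos_eq in h1; last lra.
have -> : h / eps h = / (eps h / h) by field; lra.
apply: (Rlt_trans _ (1 + Rabs M)); first by have := Rle_abs M; lra.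
rewrite -(Rinv_inv (1 + Rabs M)); apply: Rinv_lt_contravar => //.
by apply: Rmult_lt_0_compat => //.
Qed.

Lemma low_part e : 0 < e -> exists del, 0 < del /\
  at_right 0 (fun h => sqrt (nrm2 (lowp del h (psi h))) < e).
Proof.
move=> e0; have [d0 [d0p H]] := psi_low e0.
have dd : 0 < d0 / 2 < d0 by lra.
have [h0 [h0p H']] := H _ dd; exists (d0 / 2); split; first lra.
exact: at_right_intro h0p H'.
Qed.

(** Only the factor [psi h k] is split by the size of |h k|: on low modes the symbol has the crude
    bound B but psi is small, on the others it has the bound B'. *)
Lemma split_bound h del p (c : Z2 -> C) B B' : 0 < h <= 1 ->
  (forall k, Cmod (c k) <= B) ->
  (forall k, del < 4 * PI ^ 2 * h ^ 2 * knorm2 k -> Cmod (c k) <= B') -> 0 <= B' ->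
  Cmod (zsumC (fun k => psi h k * Cconj (psi h (Z2add p k)) * c k)%C) <=
    B' + B * sqrt (nrm2 (lowp del h (psi h))).
Proof.
move=> hh HB HB' B'0; have [H1 H2] := psi_unit hh; have [H3 H4] := is_l2_conj H1.
have lo k : Cmod (lowp del h (psi h) k) <= Cmod (psi h k).
  rewrite /lowp; case: (Rle_dec _ _) => hk; first exact: Rle_refl.
  by rewrite Cmod_0; apply: Cmod_ge_0.
have [lo2 _] := nrm2_mono lo H1.
pose chi' k := if Rle_dec (4 * PI ^ 2 * h ^ 2 * knorm2 k) del then RtoC 0 else c k.
have Hc' k : Cmod (chi' k) <= B'.
  rewrite /chi'; case: (Rle_dec _ _) => hk; first by rewrite Cmod_0.
  by apply: HB'; lra.
have [a1 a2] := zsumC_pairing p H1 H3 Hc'.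
have [b1 b2] := zsumC_pairing p lo2 H3 HB.
have E k : (psi h k * Cconj (psi h (Z2add p k)) * chi' k + lowp del h (psi h) k * Cconj (psi h (Z2add p k)) * c k =
   psi h k * Cconj (psi h (Z2add p k)) * c k)%C.
  by rewrite /chi' /lowp; case: (Rle_dec _ _) => hk /=; ring.
rewrite (usum_zsumC (usum_ext E (usum_plus a1 b1))).
apply: Rle_trans (Cmod_triangle _ _) _.
move: a2 b2; rewrite H4 H2 sqrt_1 !Rmult_1_r => a2 b2; lra.
Qed.

Lemma mixed_word_lim t w m1 m2 : m1 \in w -> m2 \in w -> cross m1 m2 <> 0 ->
  hlim (fun h => wordQ (2 * PI ^ 2 * h ^ 2 / eps h) t (psi h) w) (RtoC 0).
Proof.
move=> w1 w2 Hc e e0.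
set p := (1 + Rabs t) ^ size w.
have p1 : 1 <= p by apply: pow_R1_Rle; have := Rabs_pos t; lra.
have e2 : 0 < e / (2 * p) by apply: Rdiv_lt_0_compat; lra.
have [del [del0 Hdel]] := low_part e2.
set S := knorm2 m1 + knorm2 m2.
set q := sqrt (del / S).
have S0 : 0 < S := knorm2_pair_gt0 Hc.
have q0 : 0 < q by apply: sqrt_lt_R0; apply: Rdiv_lt_0_compat.
(* A letter of frequency at least 6p/e makes the fast bound 3p/Om at most e/2; the low modes
   contribute less than p e/(2p) = e/2. *)
apply: filter_imp (filter_and _ _ (filter_and _ _ Hdel at_right_unit) (ratio_infty (6 * p / e / q))) => h [[h1 hh] h2].
have ep := eps_pos hh.
have -> : (wordQ (2 * PI ^ 2 * h ^ 2 / eps h) t (psi h) w - 0 = wordQ (2 * PI ^ 2 * h ^ 2 / eps h) t (psi h) w)%C by ring.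
have fast : 6 * p / e < h / eps h * q.
  have -> : 6 * p / e = 6 * p / e / q * q by field; lra.
  exact: Rmult_lt_compat_r.
have B'0 : 0 < e / 2 by lra.
apply: Rle_lt_trans (split_bound (wsum w) (B := p) (B' := e / 2) hh _ _ (Rlt_le _ _ B'0)) _.
- by move=> k; apply: Iwk_bound.
- move=> k Hk; have h0 : 0 < h by lra.
  have [m mi Hm] := fast_letter h0 ep del0 Hc Hk.
  have f0 : 0 < h / eps h * q by apply: Rlt_trans fast; apply: Rdiv_lt_0_compat; lra.
  have mw : m \in w by move: mi; rewrite !inE => /orP [] /eqP ->.
  have := @Iw_fast t [seq freq (2 * PI ^ 2 * h ^ 2 / eps h) k m | m <- w] 0 (Rabs t) _ f0.
  rewrite Rminus_0_r size_map -/p => /(_ (Rle_refl _)) G.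
  apply: Rle_trans (G _) _; first by exists (freq (2 * PI ^ 2 * h ^ 2 / eps h) k m) => //; apply: map_f.
  have -> : e / 2 = 3 * p / (6 * p / e) by field; lra.
  apply: Rmult_le_compat_l; first lra.
  apply: Rinv_le_contravar; last lra.
  by apply: Rdiv_lt_0_compat; lra.
have E : e = e / 2 + p * (e / (2 * p)) by field; lra.
by rewrite [X in _ < X]E; apply: Rplus_lt_compat_l; apply: Rmult_lt_compat_l; lra.
Qed.

Lemma etak_freq h ep v k : 0 < Lv v -> ep <> 0 ->
  freq (2 * PI ^ 2 * h ^ 2 / ep) k v = 2 * PI * Lv v * etak h ep v k.
Proof. by move=> L0 e0; rewrite /freq /etak /HL /dot; field; lra. Qed.

(* For small [h], a frequency [k] with [|h k|] bounded below has [|etak v k| <= K v] for at most one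
   direction [v], so the cut-offs [chi (K v) (etak v k)] sum to at most 1. *)
Lemma mass_sum (F : Z2 -> measure PT R) (P : seq Z2) : uniq P ->
  (forall v, v \in P -> 0 < Lv v) ->
  (forall v v', v \in P -> v' \in P -> v <> v' -> cross v v' <> 0) ->
  (forall v, v \in P -> (F v setT < +oo)%E /\
    forall a, test_symbol a -> filterlim (fun h => op_quad h (eps h) v a (psi h)) (at_right 0) (locally (RtoC (mint (F v) a)))) ->
  \sumR_(v <- P) mass (F v) <= 1.
Proof.
move=> uP PL Pc PF.
(* Errors: one e per direction for cutting off F v, one per direction for the low modes, and one for
   the distance to the limit. *)
suff H e : 0 < e -> \sumR_(v <- P) mass (F v) <= 1 + (2 * INR (size P) + 1) * e.
  apply: Rle_plus_epsilon => e e0.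
  have s0 := pos_INR (size P); have p0 : 0 < 2 * INR (size P) + 1 by lra.
  have := H (e / (2 * INR (size P) + 1)) (Rdiv_lt_0_compat _ _ e0 p0).
  by have -> : (2 * INR (size P) + 1) * (e / (2 * INR (size P) + 1)) = e by field; lra.
move=> e0.
have [K HK] : exists K : Z2 -> R, forall v, 0 < K v /\ (v \in P -> mass (F v) - mint (F v) (fun _ _ x => chi (K v) x) < e).
  have H (v : Z2) : exists K, 0 < K /\ (v \in P -> mass (F v) - mint (F v) (fun _ _ x => chi K x) < e).
    case: (boolP (v \in P)) => vP; last by exists 1; split => //; lra.
    have [Ffin _] := PF v vP; have [K [K0 HK]] := chi_mass_lim Ffin e0.
    by exists K.
  by have [K HK] := choice H; exists K.
have K0 v : 0 < K v by have [] := HK v.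
have [del [del0 Hdel]] := low_part e0.
pose X v h := Xsum h (eps h) v (K v) (psi h) (0%ZZ, 0%ZZ) 0.
have XL v : v \in P -> hlim (X v) (Fint (F v) (gsym (K v) (0%ZZ, 0%ZZ) 0)).
  move=> vP; have [Ffin HF] := PF v vP; apply: Xsum_lim => //; first exact: PL.
    by rewrite /cross /=; ring.
  by move=> h hh; have [] := psi_unit hh.
have SL : hlim (fun h => \sumC_(v <- P) X v h) (\sumC_(v <- P) Fint (F v) (gsym (K v) (0%ZZ, 0%ZZ) 0)).
  have -> : (fun h => \sumC_(v <- P) X v h) = (fun h => \sumC_(v <- P) (if v \in P then X v h else RtoC 0)).
    by apply: funext => h; apply: eq_big_seq => v ->.
  have -> : \sumC_(v <- P) Fint (F v) (gsym (K v) (0%ZZ, 0%ZZ) 0) =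
     \sumC_(v <- P) (if v \in P then Fint (F v) (gsym (K v) (0%ZZ, 0%ZZ) 0) else RtoC 0).
    by apply: eq_big_seq => v ->.
  apply: (@hlim_big _ P (fun v h => if v \in P then X v h else RtoC 0)) => v.
  case: ifP => vP; [exact: XL | exact: hlim_const].
(* The right-hand side is the frequency that one letter of the pair must reach; exceeding 2 pi L_v
   K_v means that k lies outside the support of the cut-off in that direction. *)
have fast : at_right 0 (fun h => forall ij, ij \in [seq (i, j) | i <- P, j <- P] -> ij.1 <> ij.2 ->
    2 * PI * (Lv ij.1 * K ij.1 + Lv ij.2 * K ij.2) < h / eps h * sqrt (del / (knorm2 ij.1 + knorm2 ij.2))).
  apply: at_right_all => -[i j] /allpairsP [[i' j'] /= [iP jP [-> ->]]] {i j}.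
  case: (eqVneq i' j') => [->|/eqP ne]; first by apply: filter_forall => h.
  set q := sqrt _; have q0 : 0 < q.
    apply: sqrt_lt_R0; apply: Rdiv_lt_0_compat => //.
    have := PL _ iP; have := PL _ jP; rewrite -!Lv_sq; nra.
  apply: filter_imp (ratio_infty (2 * PI * (Lv i' * K i' + Lv j' * K j') / q)) => h Hh _.
  have -> : 2 * PI * (Lv i' * K i' + Lv j' * K j') = 2 * PI * (Lv i' * K i' + Lv j' * K j') / q * q by field; lra.
  exact: Rmult_lt_compat_r.
(* The claim no longer involves h, so a single small value satisfying all the conditions is
   enough. *)
have [h [[[h1 hh] h2] h3]] := filter_ex _ (filter_and _ _ (filter_and _ _ (filter_and _ _ Hdel at_right_unit) fast) (SL _ e0)).
have ep := eps_pos hh; have [pl pn] := psi_unit hh.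
pose c k := \sumR_(v <- P) chi (K v) (etak h (eps h) v k).
have chi01 v x : 0 <= chi (K v) x <= 1 by have [] := chi_range x (K0 v).
have cP k : 0 <= c k <= INR (size P).
  rewrite /c; elim: (P) => [|a r IH]; first by rewrite big_nil /=; lra.
  by rewrite big_cons /= -/(INR (size r).+1) S_INR; have := chi01 a (etak h (eps h) a k); lra.
have cb k : Cmod (RtoC (c k)) <= INR (size P) by rewrite Cmod_R Rabs_pos_eq; have := cP k; lra.
have cb' k : del < 4 * PI ^ 2 * h ^ 2 * knorm2 k -> Cmod (RtoC (c k)) <= 1.
  move=> Hk; rewrite Cmod_R Rabs_pos_eq; last by have := cP k; lra.
  suff H : 0 <= c k <= 1 by case: H.
  apply: disjoint_sum_le1 => //.
  move=> i j iP jP ne.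
  have h0 : 0 < h by lra.
  have [m mi Hm] := fast_letter h0 ep del0 (Pc _ _ iP jP ne) Hk.
  have := h2 (i, j) (allpairs_f _ iP jP) ne => /= H.
  have pi0 := PI_RGT_0.
  have Li := PL _ iP; have Lj := PL _ jP.
  have Ki := K0 i; have Kj := K0 j.
  have k0 (v : Z2) : 0 < Lv v -> 2 * PI * (Lv v * K v) < Rabs (freq (2 * PI ^ 2 * h ^ 2 / eps h) k v) -> chi (K v) (etak h (eps h) v k) = 0.
    move=> Lp; rewrite etak_freq //; last lra.
    rewrite Rabs_mult (Rabs_pos_eq (2 * PI * Lv v)); last nra.
    move=> HH; apply: chi_out => //.
    apply: (Rmult_lt_reg_l (2 * PI * Lv v)); first by nra.
    lra.
  have LKi : 0 < PI * (Lv i * K i) by apply: Rmult_lt_0_compat => //; apply: Rmult_lt_0_compat.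
  have LKj : 0 < PI * (Lv j * K j) by apply: Rmult_lt_0_compat => //; apply: Rmult_lt_0_compat.
  move: mi Hm; rewrite !inE => /orP [] /eqP -> Hm; [left | right]; apply: k0 => //; lra.
have bnd := split_bound (0%ZZ, 0%ZZ) hh cb cb' Rle_0_1.
have XE : \sumC_(v <- P) X v h = zsumC (fun k => psi h k * Cconj (psi h (Z2add (0%ZZ, 0%ZZ) k)) * RtoC (c k))%C.
  have H4 := usum_big P (fun v => Xsum_usum h (eps h) v (0%ZZ, 0%ZZ) 0 (K0 v) pl).
  symmetry; apply: usum_zsumC; apply: usum_ext H4 => k.
  rewrite /c RtoC_rsum csum_scal_l; apply: eq_bigr => v _.
  by rewrite Rmult_0_l cis0 Cmult_1_r.
rewrite -XE in bnd.
set Ls := \sumC_(v <- P) Fint (F v) (gsym (K v) (0%ZZ, 0%ZZ) 0) in h3 SL.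
have LE : Re Ls = \sumR_(v <- P) mint (F v) (fun _ _ x => chi (K v) x).
  rewrite /Ls Re_csum; apply: eq_bigr => v _; rewrite /Fint /=; apply: mint_ext => x y z.
  have -> : phase (0%ZZ, 0%ZZ) x y + 0 * z = 0 by rewrite phaseE /=; ring.
  by rewrite /gsym /= cos_0; ring.
have h4 : Re Ls <= 1 + INR (size P) * e + e.
  apply: Rle_trans (Rle_abs _) _; apply: Rle_trans (Rabs_Re_le _) _.
  have -> : Ls = (\sumC_(v <- P) X v h - (\sumC_(v <- P) X v h - Ls))%C by ring.
  apply: Rle_trans (Cmod_triangle _ _) _; rewrite Cmod_opp.
  have s0 := pos_INR (size P).
  have : INR (size P) * sqrt (nrm2 (lowp del h (psi h))) <= INR (size P) * e by apply: Rmult_le_compat_l; lra.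
  lra.
have h5 : \sumR_(v <- P) mass (F v) <= Re Ls + INR (size P) * e.
  rewrite LE; have HKP v : v \in P -> mass (F v) <= mint (F v) (fun _ _ x => chi (K v) x) + e.
    by move=> vP; have := proj2 (HK v) vP; lra.
  elim: (P) HKP => [|a r IH] H; first by rewrite !big_nil /=; lra.
  rewrite !big_cons /= -/(INR (size r).+1) S_INR.
  have := H a (mem_head _ _); have := IH (fun v vr => H v (mem_behead (s := a :: r) vr)); lra.
lra.
Qed.
End Mixed.

(** * Primitive directions *)

Lemma primP v : prim v = true ->
  Z.gcd v.1 v.2 = 1%ZZ /\ ((0 < v.1)%ZZ \/ v = (0%ZZ, 1%ZZ)).
Proof.
case: v => a b; rewrite /prim /= => /andP [/Z.eqb_eq h1 /orP [/Z.ltb_lt h|/andP [/Z.eqb_eq h2 /Z.eqb_eq h3]]].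
  by split; [exact: h1 | left].
by split; [exact: h1 | right; congr pair].
Qed.

Lemma prim_Lv v : prim v = true -> 0 < Lv v.
Proof.
move=> /primP [g1 _]; apply: sqrt_lt_R0.
suff : 1 <= knorm2 v by lra.
by apply: knorm2_ge1 => v0; move: g1; rewrite v0.
Qed.

Lemma crossZ m v : cross m v = 0 <-> (m.1 * v.2 = m.2 * v.1)%ZZ.
Proof.
have -> : cross m v = IZR (m.1 * v.2 - m.2 * v.1) by rewrite /cross minus_IZR !mult_IZR.
split; first by move=> /eq_IZR; lia.
by move=> H; apply: IZR_eq; lia.
Qed.

(** With coprime coordinates, proportionality makes the first coordinates divide each other; the
    sign convention then forces equality. *)
Lemma prim_inj v v' : prim v = true -> prim v' = true -> cross v v' = 0 -> v = v'.
Proof.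
move=> /primP [g1 s1] /primP [g2 s2] /crossZ.
case: v g1 s1 => a b /= g1 s1; case: v' g2 s2 => a' b' /= g2 s2 H.
case: s1 => [a0|[? ?]]; case: s2 => [a0'|[? ?]]; subst.
- have d1 : (a | a')%ZZ by apply: (Z.gauss _ b) => //; exists b'; lia.
  have d2 : (a' | a)%ZZ by apply: (Z.gauss _ b') => //; exists b; lia.
  have aa : a = a' by apply: Z.divide_antisym_nonneg => //; lia.
  by subst; congr pair; nia.
- by lia.
- by lia.
- by [].
Qed.

(** Divide by the gcd and normalise the sign. The quotient stays in the same box, so a truncation to
    [box N] contains the directions of all its nonzero modes. *)
Lemma prim_ex (m : Z2) N : m <> (0%ZZ, 0%ZZ) -> m \in box N ->
  exists v, [/\ prim v = true, cross m v = 0 & v \in box N].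
Proof.
case: m => a b m0 /mem_box /= [ha hb].
pose g := Z.gcd a b; have g0 : (0 < g)%ZZ.
  have := Z.gcd_nonneg a b; have : Z.gcd a b <> 0%ZZ; last by rewrite /g; lia.
  by move=> /Z.gcd_eq_0 [a0 b0]; apply: m0; rewrite a0 b0.
have [p Hp] : (g | a)%ZZ by apply: Z.gcd_divide_l.
have [q Hq] : (g | b)%ZZ by apply: Z.gcd_divide_r.
have gpq : Z.gcd p q = 1%ZZ.
  have : (g * Z.gcd p q = g)%ZZ by rewrite -Z.gcd_mul_mono_l_nonneg; [rewrite {2}/g; congr Z.gcd; lia | lia].
  by nia.
have key r s : Z.gcd r s = 1%ZZ -> (0 < r)%ZZ \/ (r = 0 /\ s = 1)%ZZ -> prim (r, s) = true.
  move=> h1 h2; rewrite /prim /= h1 /=.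
  case: h2 => [/Z.ltb_lt h|[-> ->]]; last by [].
  by apply/orP; left; exact: h.
case: (Z_dec p 0) => [[pn|pp]|p0].
- exists ((- p)%ZZ, (- q)%ZZ); split.
  + by apply: key; [rewrite Z.gcd_opp_l Z.gcd_opp_r | lia].
  + by apply/crossZ => /=; nia.
  + by apply/mem_box => /=; nia.
- exists (p, q); split.
  + by apply: key; [ | lia].
  + by apply/crossZ => /=; nia.
  + by apply/mem_box => /=; nia.
exists (0%ZZ, 1%ZZ); split => //.
  by apply/crossZ => /=; nia.
apply/mem_box => /=; have : b <> 0%ZZ by move=> b0; apply: m0; rewrite b0 Hp p0.
by lia.
Qed.

Definition par (v m : Z2) : bool := Z.eqb (Z.mul m.1 v.2) (Z.mul m.2 v.1).

Lemma parP v m : reflect (cross m v = 0) (par v m).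
Proof.
apply: (iffP idP) => [H|/crossZ /Z.eqb_eq //].
by apply/crossZ/Z.eqb_eq.
Qed.

(** * Averages along the directions orthogonal to [v] *)

Lemma cont2_line g a b x y : cont2 g -> Ccont (fun s => RtoC (g (x + a * s) (y + b * s))).
Proof.
move=> Hg s; split; last exact: continuous_const.
have lin c z : continuous (fun s : R => z + c * s) s.
  apply: continuous_plus; first exact: continuous_const.
  by apply: continuous_mult; [exact: continuous_const | exact: continuous_id].
apply: (continuous_comp_2 (fun s => x + a * s) (fun s => y + b * s) g) => //.
exact/continuity_2d_pt_filterlim.
Qed.

Lemma Ccont2_line g a b x y : Ccont2 g -> Ccont (fun s => g (x + a * s)%Re (y + b * s)%Re).
Proof.
move=> [Ha Hb].
apply: (@Ccont_ext (fun s => RtoC (Re (g (x + a * s)%Re (y + b * s)%Re)) + Ci * RtoC (Im (g (x + a * s)%Re (y + b * s)%Re)))%C).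
  by move=> s; apply: injective_projections; rewrite /Re /Im /=; ring.
apply: Ccont_plus; first exact: (@cont2_line (fun x y => Re (g x y))).
apply: Ccont_mult; first exact: Ccont_const.
exact: (@cont2_line (fun x y => Im (g x y))).
Qed.

Definition Cavg (v : Z2) (g : R -> R -> C) (x y : R) : C :=
  (RtoC (/ Lv v) * CInt (fun t => g (x + (- IZR v.2 / Lv v) * t)%Re (y + (IZR v.1 / Lv v) * t)%Re) 0 (Lv v))%C.

Lemma CInt_RtoC f a b : CInt (fun s => RtoC (f s)) a b = RtoC (RInt f a b).
Proof. by rewrite /CInt /= RInt_const /scal /= /mult /= Rmult_0_r. Qed.

Lemma avgI_Cavg v b x y : RtoC (avgI v b x y) = Cavg v (fun x y => RtoC (b x y)) x y.
Proof.
rewrite /Cavg CInt_RtoC /avgI RtoC_mult; congr (_ * RtoC _)%C; apply: RInt_extR => t.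
by congr (b _ _); rewrite /Rdiv; ring.
Qed.

Section Averages.
Variable v : Z2.
Hypothesis L0 : 0 < Lv v.

Lemma Cavg_plus f g x y : Ccont2 f -> Ccont2 g ->
  Cavg v (fun x y => f x y + g x y)%C x y = (Cavg v f x y + Cavg v g x y)%C.
Proof.
move=> Hf Hg; rewrite /Cavg CInt_plus; try exact: Ccont2_line.
by ring.
Qed.

Lemma Cavg_scal z f x y : Ccont2 f -> Cavg v (fun x y => z * f x y)%C x y = (z * Cavg v f x y)%C.
Proof.
move=> Hf; rewrite /Cavg CInt_scal; last exact: Ccont2_line.
by ring.
Qed.

Lemma Cavg_big (I : Type) (r : seq I) (f : I -> R -> R -> C) x y : (forall i, Ccont2 (f i)) ->
  Cavg v (fun x y => \sumC_(i <- r) f i x y) x y = \sumC_(i <- r) Cavg v (f i) x y.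
Proof.
move=> H; rewrite /Cavg CInt_big; last by move=> i; apply: Ccont2_line.
by rewrite csum_scal_l.
Qed.

Lemma Cavg_bound f B x y : Ccont2 f -> (forall x y, Cmod (f x y) <= B) -> Cmod (Cavg v f x y) <= B.
Proof.
move=> Hf HB; rewrite /Cavg Cmod_mult Cmod_R Rabs_pos_eq; last by apply: Rlt_le; apply: Rinv_0_lt_compat.
apply: (Rmult_le_reg_l (Lv v)) => //; rewrite -Rmult_assoc Rinv_r ?Rmult_1_l; last lra.
apply: Rle_trans (CInt_bound (B := B) _ _) _; [exact: Ccont2_line | by [] | ].
by rewrite Rminus_0_r Rabs_pos_eq; lra.
Qed.

(** Over a length L_v in the orthogonal direction the phase runs through an integer number of
    periods, namely the determinant of m and v up to sign. *)
Lemma Cavg_cis m x y : Cavg v (fun x y => cis (phase m x y)) x y =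
  if par v m then cis (phase m x y) else RtoC 0.
Proof.
rewrite /Cavg (@CInt_ext _ (fun t => cis ((- (2 * PI * cross m v / Lv v)) * t + phase m x y))); last first.
  move=> t; congr cis; have := phase_perp m x y t L0.
  have -> : x - t * IZR v.2 / Lv v = x + - IZR v.2 / Lv v * t by rewrite /Rdiv; ring.
  have -> : y + t * IZR v.1 / Lv v = y + IZR v.1 / Lv v * t by rewrite /Rdiv; ring.
  by move=> ->; ring.
case: parP => [->|Hc].
  rewrite (@CInt_ext _ (fun _ => cis (phase m x y))); last by move=> s; congr cis; field; lra.
  rewrite /CInt !RInt_const /scal /= /mult /=; apply: injective_projections => /=; field; lra.
set a := - (2 * PI * cross m v / Lv v).
have pi0 := PI_RGT_0.
have a0 : a <> 0.
  rewrite /a; apply: Ropp_neq_0_compat; apply: Rmult_integral_contrapositive_currified; last first.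
    by apply: Rinv_neq_0_compat; lra.
  by apply: Rmult_integral_contrapositive_currified => //; lra.
pose z : C := (0, - / a).
rewrite (@CInt_Cder (fun s => z * cis (a * s + phase m x y)%Re)%C); first last.
- exact: Ccont_cis.
- move=> s; apply: Cder_eq (Cder_scal _ (Cder_cis _ _ _)) _.
  rewrite Cmult_assoc; have -> : (z * imC a = RtoC 1)%C.
    by rewrite /z /imC; apply: injective_projections => /=; field; exact: a0.
  by ring.
have -> : cis (a * Lv v + phase m x y) = cis (a * 0 + phase m x y).
  have -> : a * Lv v = 2 * PI * IZR (m.2 * v.1 - m.1 * v.2).
    by rewrite minus_IZR !mult_IZR /a /cross; field; lra.
  by rewrite cis_add cis_2PI Rmult_0_r Rplus_0_l; ring.
by ring.
Qed.

Definition modes (N : nat) : seq Z2 := [seq m <- box N | par v m].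

Variables (V : R -> R -> R) (c : Z2 -> C).
Hypothesis Vc : cont2 V.

(** Averaging is a contraction for the sup norm and merely deletes the modes not parallel to v, so
    the approximation error is not enlarged. *)
Lemma avgI_modes N rho x y :
  (forall x y, Cmod (RtoC (V x y) - \sumC_(m <- box N) (c m * cis (phase m x y)))%C <= rho) ->
  Cmod (RtoC (avgI v V x y) - \sumC_(m <- modes N) (c m * cis (phase m x y)))%C <= rho.
Proof.
move=> H; have cc m : Ccont2 (fun x y => c m * cis (phase m x y))%C.
  by apply: Ccont2_mult; [exact: Ccont2_const | exact: Ccont2_cis_phase].
have cs : Ccont2 (fun x y => \sumC_(m <- box N) (c m * cis (phase m x y))) by apply: Ccont2_big.
have cV := Ccont2_RtoC Vc.
have -> : (RtoC (avgI v V x y) - \sumC_(m <- modes N) (c m * cis (phase m x y)))%C =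
    Cavg v (fun x y => RtoC (V x y) + RtoC (-1) * \sumC_(m <- box N) (c m * cis (phase m x y)))%C x y.
  rewrite Cavg_plus //; last by apply: Ccont2_mult => //; exact: Ccont2_const.
  rewrite Cavg_scal // Cavg_big // avgI_Cavg.
  rewrite /modes big_filter big_mkcond /=.
  rewrite (eq_bigr (fun m => Cavg v (fun x y => c m * cis (phase m x y))%C x y)); first ring.
  move=> m _; rewrite Cavg_scal; last exact: Ccont2_cis_phase.
  by rewrite Cavg_cis; case: (par v m); ring.
apply: Cavg_bound.
  by apply: Ccont2_plus => //; apply: Ccont2_mult => //; exact: Ccont2_const.
move=> {}x {}y; have -> : (RtoC (V x y) + RtoC (-1) * \sumC_(m <- box N) (c m * cis (phase m x y)))%C =
  (RtoC (V x y) - \sumC_(m <- box N) (c m * cis (phase m x y)))%C by ring.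
exact: H.
Qed.

(** The time integral of the averaged truncated potential along the line directed by v with speed e:
    on it the phase of mode m grows at rate [sl v m * e]. *)
Definition Theta (t : R) (N : nat) (x y e : R) : C :=
  \sumC_(m <- modes N) (c m * cis (phase m x y) * CInt (fun s => cis (sl v m * e * s + 0)%Re) 0 t).

Definition th_int (t x y e : R) : R :=
  RInt (fun s => avgI v V (x + s * e * IZR v.1 / Lv v) (y + s * e * IZR v.2 / Lv v)) 0 t.

Hypothesis approx : forall rho, 0 < rho -> exists N, forall n, (N <= n)%N -> forall x y,
  Cmod (RtoC (V x y) - \sumC_(m <- box n) (c m * cis (phase m x y)))%C <= rho.

Lemma Ccont2_avgI : Ccont2 (fun x y => RtoC (avgI v V x y)).
Proof.
apply: Ccont2_unif_lim => e e0; have [N HN] := approx e0.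
exists (fun x y => \sumC_(m <- modes N) (c m * cis (phase m x y))).
  apply: Ccont2_big => m; apply: Ccont2_mult; [exact: Ccont2_const | exact: Ccont2_cis_phase].
by move=> x y; apply: avgI_modes; apply: HN.
Qed.

Lemma Theta_close t N rho x y e :
  (forall x y, Cmod (RtoC (V x y) - \sumC_(m <- box N) (c m * cis (phase m x y)))%C <= rho) ->
  Cmod (RtoC (th_int t x y e) - Theta t N x y e)%C <= rho * Rabs t.
Proof.
move=> H.
pose a := e * IZR v.1 / Lv v; pose b := e * IZR v.2 / Lv v.
have E1 : RtoC (th_int t x y e) = CInt (fun s => RtoC (avgI v V (x + a * s)%Re (y + b * s)%Re)) 0 t.
  rewrite CInt_RtoC /th_int; congr RtoC; apply: RInt_extR => s.
  by congr (avgI v V _ _); rewrite /a /b /Rdiv; ring.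
have cm m : Ccont (fun s => c m * cis (phase m (x + a * s)%Re (y + b * s)%Re))%C.
  apply: (@Ccont2_line (fun x y => c m * cis (phase m x y))%C).
  by apply: Ccont2_mult; [exact: Ccont2_const | exact: Ccont2_cis_phase].
have E2 : Theta t N x y e = CInt (fun s => \sumC_(m <- modes N) (c m * cis (phase m (x + a * s)%Re (y + b * s)%Re))) 0 t.
  rewrite CInt_big // /Theta; apply: eq_bigr => m _.
  rewrite -CInt_scal; last exact: Ccont_cis.
  apply: CInt_ext => s; rewrite -Cmult_assoc -cis_add; congr (_ * cis _)%C.
  by rewrite /sl /dot /phase /a /b; field; lra.
have cA : Ccont (fun s => RtoC (avgI v V (x + a * s)%Re (y + b * s)%Re)).
  exact: (@Ccont2_line (fun x y => RtoC (avgI v V x y)) _ _ _ _ Ccont2_avgI).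
have cS : Ccont (fun s => RtoC (-1) * \sumC_(m <- modes N) (c m * cis (phase m (x + a * s)%Re (y + b * s)%Re)))%C.
  by apply: Ccont_mult; [exact: Ccont_const | apply: Ccont_big].
have -> : (RtoC (th_int t x y e) - Theta t N x y e)%C =
   CInt (fun s => RtoC (avgI v V (x + a * s)%Re (y + b * s)%Re) + RtoC (-1) * \sumC_(m <- modes N) (c m * cis (phase m (x + a * s)%Re (y + b * s)%Re)))%C 0 t.
  rewrite CInt_plus // CInt_scal; last by apply: Ccont_big.
  by rewrite -E1 -E2; ring.
rewrite -[X in Rabs X]Rminus_0_r; apply: CInt_bound; first exact: Ccont_plus.
move=> s _; have := avgI_modes (x + a * s)%Re (y + b * s)%Re H.
set S := \big[_/_]_(_ <- _) _.
by have -> : forall z : C, (z + RtoC (-1) * S = z - S)%C by move=> z; ring.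
Qed.
End Averages.

(** * The truncated exponential and the limiting sums over words *)

Definition Pn (n : nat) (z : C) : C := \sumC_(k <- seq.iota 0 n.+1) (Cpow z k * RtoC (/ INR (fact k))).

Lemma Cmod_Cpow z n : Cmod (Cpow z n) = Cmod z ^ n.
Proof. by elim: n => [|n IH]; rewrite ?Cpow_S ?Cmod_mult ?IH //= Cmod_1. Qed.

Lemma inv_fact_pos k : 0 < / INR (fact k).
Proof. by apply: Rinv_0_lt_compat; apply: INR_fact_lt_0. Qed.

Lemma Cpow_diff z w R k : Cmod z <= R -> Cmod w <= R ->
  Cmod (Cpow z k.+1 - Cpow w k.+1)%C <= INR k.+1 * R ^ k * Cmod (z - w)%C.
Proof.
move=> hz hw; have d0 := Cmod_ge_0 (z - w)%C; have R0 : 0 <= R by have := Cmod_ge_0 z; lra.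
elim: k => [|k IH].
  rewrite !Cpow_S /= !Cmult_1_r; lra.
rewrite Cpow_S (Cpow_S w).
have -> : (z * Cpow z k.+1 - w * Cpow w k.+1 = z * (Cpow z k.+1 - Cpow w k.+1) + (z - w) * Cpow w k.+1)%C by ring.
apply: Rle_trans (Cmod_triangle _ _) _; rewrite !Cmod_mult (Cmod_Cpow w).
have h1 : Cmod z * Cmod (Cpow z k.+1 - Cpow w k.+1)%C <= R * (INR k.+1 * R ^ k * Cmod (z - w)%C).
  by apply: Rmult_le_compat => //; apply: Cmod_ge_0.
have h2 : Cmod (z - w)%C * Cmod w ^ k.+1 <= Cmod (z - w)%C * R ^ k.+1.
  by apply: Rmult_le_compat_l => //; apply: pow_incr; split => //; apply: Cmod_ge_0.
rewrite (S_INR k.+1); apply: Rle_trans (Rplus_le_compat _ _ _ _ h1 h2) _; apply: Req_le.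
by have -> : R ^ k.+1 = R * R ^ k by []; ring.
Qed.

(** The constant must not depend on n: the factor k in |z^k - w^k| <= k R^(k-1) |z - w| is absorbed
    by k!, and the sums stay below exp R. *)
Lemma Pn_lipschitz n z w R : Cmod z <= R -> Cmod w <= R ->
  Cmod (Pn n z - Pn n w)%C <= Cmod (z - w)%C * exp R.
Proof.
move=> hz hw; have d0 := Cmod_ge_0 (z - w)%C; have R0 : 0 <= R by have := Cmod_ge_0 z; lra.
suff H : Cmod (Pn n z - Pn n w)%C <= Cmod (z - w)%C * (\sumR_(k <- seq.iota 0 n) (R ^ k / INR (fact k))).
  apply: Rle_trans H _; apply: Rmult_le_compat_l => //; exact: exp_partial_le.
elim: n => [|n IH].
  rewrite /Pn /= !big_seq1 big_nil Rmult_0_r.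
  set a := (_ * _)%C; have -> : (a - a = RtoC 0)%C by ring.
  by rewrite Cmod_0; lra.
rewrite /Pn !(csum_iotaS _ n.+1) -/(Pn n z) -/(Pn n w).
set a := RtoC (/ INR (fact n.+1)).
have -> : (Pn n z + Cpow z n.+1 * a - (Pn n w + Cpow w n.+1 * a) = (Pn n z - Pn n w) + (Cpow z n.+1 - Cpow w n.+1) * a)%C by ring.
apply: Rle_trans (Cmod_triangle _ _) _.
rewrite -{3}(addn1 n) iotaD big_cat /= big_seq1 add0n Rmult_plus_distr_l.
apply: Rplus_le_compat => //.
rewrite Cmod_mult {}/a Cmod_R Rabs_pos_eq; last exact: Rlt_le (inv_fact_pos _).
have -> : Cmod (z - w)%C * (R ^ n / INR (fact n)) = INR n.+1 * R ^ n * Cmod (z - w)%C * / INR (fact n.+1).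
  have -> : INR (fact n.+1) = INR n.+1 * INR (fact n) by rewrite -mult_INR.
  have := INR_fact_lt_0 n; have : 0 < INR n.+1 by apply: lt_0_INR; lia.
  by move=> a b; field; split; lra.
by apply: Rmult_le_compat_r; [exact: Rlt_le (inv_fact_pos _) | apply: Cpow_diff].
Qed.

Lemma words_filter (T : eqType) (p : pred T) (M : seq T) n (f : seq T -> C) :
  \sumC_(w <- words M n) (if all p w then f w else RtoC 0) = \sumC_(w <- words [seq m <- M | p m] n) f w.
Proof.
elim: n f => [|n IH] f; first by rewrite /= !big_seq1.
rewrite !csum_words big_filter [RHS]big_mkcond /=; apply: eq_bigr => a _.
case: (p a) => /=; first exact: IH.
by elim: (words M n) => [|w r IHr]; rewrite ?big_nil // big_cons IHr Cplus_0_l.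
Qed.

(** The spatial phase of a word is the product of the phases of its letters; absorbing them into the
    coefficients brings the sum to the form of [words_power]. *)
Lemma gword_cprod (c : Z2 -> C) t v w x y e :
  (coefw c w * gword t v w x y e)%C =
  (cprod (fun m => Ci * c m * cis (phase m x y))%C w * Iw t (map (fun m => (sl v m * e)%Re) w) 0)%C.
Proof.
rewrite /gword /Gw -map_comp /coefw.
have -> : (cprod (fun m => Ci * c m * cis (phase m x y)) w = cprod (fun m => Ci * c m) w * cis (phase (wsum w) x y))%C.
  elim: w => [|m w IH].
    have -> : phase (wsum [::]) x y = 0 by rewrite /phase /=; ring.
    by rewrite cis0 /=; ring.
  rewrite /= IH.
  have -> : phase (Z2add m (wsum w)) x y = phase m x y + phase (wsum w) x y.
    by rewrite /phase /Z2add /= !plus_IZR; ring.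
  by rewrite cis_add; ring.
set I1 := Iw _ _ _; by ring.
Qed.

Definition zmode (m : Z2) : bool := m == (0%ZZ, 0%ZZ).
Definition prims (N : nat) : seq Z2 := [seq v <- box N | prim v].

Lemma mem_prims N v : v \in prims N -> prim v = true.
Proof. by rewrite mem_filter => /andP []. Qed.

Section LimitWords.
Variables (V : R -> R -> R) (t : R) (F : Z2 -> measure PT R) (N : nat).
Hypothesis Ffin : forall v, prim v = true -> (F v setT < +oo)%E.
Let c := fourier2 V.

(** The limit assigned to a word. Zero words are parallel to every v and receive each mass once; the
    first summand corrects this so that they total t^n/n!. *)
Definition LimW (w : seq Z2) : C :=
  ((if all zmode w then RtoC (t ^ size w / INR (fact (size w))) * (RtoC 1 - \sumC_(v <- prims N) RtoC (mass (F v))) else RtoC 0)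
   + \sumC_(v <- prims N) (if all (par v) w then Fint (F v) (gword t v w) else RtoC 0))%C.

Lemma gword_zero v w x y e : all zmode w -> gword t v w x y e = RtoC (t ^ size w / INR (fact (size w))).
Proof.
move=> /allP Hz; have Hz' m : m \in w -> m = (0%ZZ, 0%ZZ) by move=> /Hz /eqP.
have w0 : wsum w = (0%ZZ, 0%ZZ).
  elim: w Hz' {Hz} => [//|m w IH] Hz /=; rewrite (Hz m) ?mem_head // Z2addC Z2add0; apply: IH.
  by move=> p pw; apply: Hz; rewrite in_cons pw orbT.
rewrite /gword /Gw Iw_zero.
  have -> : phase (wsum w) x y = 0 by rewrite w0 /phase /=; ring.
  by rewrite !size_map Rminus_0_r cis0 Cmult_1_r.
by move=> o /mapP [s /mapP [m mw ->] ->]; rewrite (Hz' m mw) /sl /dot /=; rewrite /Rdiv; ring.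
Qed.

Lemma LimW_zero w : all zmode w -> LimW w = RtoC (t ^ size w / INR (fact (size w))).
Proof.
move=> Hz; rewrite /LimW Hz; set r := RtoC (_ / _).
have -> : \sumC_(v <- prims N) (if all (par v) w then Fint (F v) (gword t v w) else RtoC 0) =
   (r * \sumC_(v <- prims N) RtoC (mass (F v)))%C.
  rewrite csum_scal_l; apply: eq_big_seq => v vP.
  have -> : all (par v) w.
    by apply/allP => m mw; apply/parP; rewrite (eqP (allP Hz m mw)) /cross /=; ring.
  have Fv := Ffin (mem_prims vP).
  by rewrite -Fint_const; apply: Fint_ext => x y e; rewrite gword_zero.
by ring.
Qed.

(** Both parts are sums over all words in a sub-alphabet, the zero mode alone or the modes parallel
    to v, so [words_power] turns each into a term of an exponential series. *)
Lemma LimW_sum n : \sumC_(w <- words (box N) n) (coefw c w * LimW w) =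
  (Cpow (Ci * (RtoC t * c (0%ZZ, 0%ZZ))) n * RtoC (/ INR (fact n)) * (RtoC 1 - \sumC_(v <- prims N) RtoC (mass (F v)))
   + \sumC_(v <- prims N) Fint (F v) (fun x y e => Cpow (Ci * Theta v c t N x y e) n * RtoC (/ INR (fact n)))%C)%C.
Proof.
set Z := (RtoC 1 - _)%C.
rewrite (eq_bigr (fun w => (if all zmode w then Z * (coefw c w * RtoC (t ^ size w / INR (fact (size w)))) else RtoC 0)
   + \sumC_(v <- prims N) (if all (par v) w then Fint (F v) (fun x y e => coefw c w * gword t v w x y e)%C else RtoC 0))%C); last first.
  move=> w _; rewrite /LimW Cmult_plus_distr_l csum_scal_l; congr Cplus.
    by case: (all zmode w); rewrite -/Z; ring.
  apply: eq_big_seq => v vP; case: (all (par v) w); last by ring.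
  by rewrite (Fint_scal (Ffin (mem_prims vP))) //; apply: Cmb_gword.
rewrite big_split /=; congr Cplus.
  rewrite words_filter -csum_scal_l Cmult_comm; congr Cmult.
  set M := [seq m <- box N | zmode m].
  have ME : M = [:: (0%ZZ, 0%ZZ)].
    have uM : uniq M by apply: filter_uniq; apply: box_uniq.
    have z0 : (0%ZZ, 0%ZZ) \in M by rewrite mem_filter /zmode eqxx /=; apply/mem_box => /=; lia.
    have zM m : m \in M -> m = (0%ZZ, 0%ZZ) by rewrite mem_filter => /andP [/eqP].
    case: M uM z0 zM => [|a [|b r]] //= uM z0 zM.
      by rewrite (zM a) // mem_head.
    by move: uM; rewrite (zM a) ?mem_head // (zM b) ?inE ?eqxx ?orbT.
  have := words_power M (fun m => Ci * c m)%C (fun _ => 0) t n 0.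
  rewrite ME big_seq1.
  have -> : CInt (fun sg => cis (0 * sg + 0)) 0 t = RtoC t.
    rewrite (@CInt_ext _ (fun _ => RtoC 1)); last by move=> s; rewrite Rmult_0_l Rplus_0_l cis0.
    by rewrite CInt_RtoC RInt_const /scal /= /mult /= Rminus_0_r Rmult_1_r.
  have -> : (Ci * c (0%ZZ, 0%ZZ) * RtoC t = Ci * (RtoC t * c (0%ZZ, 0%ZZ)))%C by ring.
  move=> <-; apply: eq_bigr => w _; rewrite /coefw Iw_zero ?size_map ?Rminus_0_r //.
  by move=> o /mapP [m _ ->].
rewrite exchange_big /=; apply: eq_big_seq => v vP.
have Fv := Ffin (mem_prims vP).
rewrite words_filter -(Fint_big Fv); last first.
  by move=> w; apply: Cmb_mult; [exact: Cmb_const | exact: Cmb_gword].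
apply: Fint_ext => x y e.
rewrite (eq_bigr (fun w => cprod (fun m => Ci * c m * cis (phase m x y)) w * Iw t (map (fun m => (sl v m * e)%Re) w) 0)%C); last first.
  by move=> w _; rewrite gword_cprod.
rewrite words_power; congr (Cpow _ _ * _)%C; rewrite /Theta csum_scal_l; apply: eq_bigr => m _.
by ring.
Qed.

Lemma Cmb_Cpow f n : Cmb f -> Cmb (fun x y e => Cpow (f x y e) n).
Proof.
move=> Hf; elim: n => [|n IH]; first exact: (Cmb_const (RtoC 1)).
by apply: (Cmb_mult Hf IH).
Qed.

Lemma Cmb_Theta v : Cmb (fun x y e => Ci * Theta v c t N x y e)%C.
Proof.
apply: Cmb_mult; first exact: Cmb_const.
apply: Cmb_big => m.
apply: (@Cmb_ext (fun x y e => c m * gword t v [:: m] x y e)%C); last first.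
  by apply: Cmb_mult; [exact: Cmb_const | exact: Cmb_gword].
move=> x y e; rewrite /gword /Gw /= Z2add0.
rewrite (@CInt_ext _ (fun s => cis (sl v m * e * s + 0)%Re)); last by move=> s; rewrite Cmult_1_r.
by ring.
Qed.
End LimitWords.

(** * Passage to the limit *)

Lemma hlim_big_in (I : eqType) (r : seq I) (f : I -> R -> C) (l : I -> C) :
  (forall i, i \in r -> hlim (f i) (l i)) -> hlim (fun h => \sumC_(i <- r) f i h) (\sumC_(i <- r) l i).
Proof.
move=> H.
have -> : \sumC_(i <- r) l i = \sumC_(i <- r) (if i \in r then l i else RtoC 0) by apply: eq_big_seq => i ->.
have -> : (fun h => \sumC_(i <- r) f i h) = (fun h => \sumC_(i <- r) (if i \in r then f i h else RtoC 0)).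
  by apply: funext => h; apply: eq_big_seq => i ->.
apply: (@hlim_big _ r (fun i h => if i \in r then f i h else RtoC 0)) => i.
by case: ifP => ir; [exact: H | exact: hlim_const].
Qed.

Lemma pow_fact_small x e : 0 < e -> exists N, forall n, (N <= n)%N -> Rabs (x ^ n / INR (fact n)) <= e.
Proof.
move=> e0; have [N HN] := cv_speed_pow_fact x e e0; exists N => n Hn.
have := HN n (ssrnat.leP Hn); rewrite /Rdist Rminus_0_r; lra.
Qed.

Lemma prims_uniq N : uniq (prims N).
Proof. by apply: filter_uniq; apply: box_uniq. Qed.

Lemma fourier2_0 V : fourier2 V (0%ZZ, 0%ZZ) = RtoC (torus_int V).
Proof.
rewrite /fourier2 /torus_int; apply: injective_projections => /=.
  apply: RInt_extR => x; apply: RInt_extR => y.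
  have -> : 2 * PI * (0 * x + 0 * y) = 0 by ring.
  by rewrite cos_0 Rmult_1_r.
rewrite (@RInt_extR _ (fun _ => 0)).
  by rewrite RInt_const /scal /= /mult /=; ring.
move=> x; rewrite (@RInt_extR _ (fun _ => 0)).
  by rewrite RInt_const /scal /= /mult /=; ring.
move=> y; have -> : 2 * PI * (0 * x + 0 * y) = 0 by ring.
by rewrite sin_0 Rmult_0_r.
Qed.

Section PhaseApprox.
Variables (V : R -> R -> R) (t A : R).
Hypothesis V_smooth : smooth2 V.
Hypothesis V_per : periodic2 V.
Let c := fourier2 V.
Hypothesis c_sum : forall L, uniq L -> \sumR_(m <- L) Cmod (c m) <= A.
Let X := (A + 1) * Rabs t.

Lemma V_approx rho : 0 < rho -> exists N, forall n, (N <= n)%N -> forall x y,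
  Cmod (RtoC (V x y) - \sumC_(m <- box n) (c m * cis (phase m x y)))%C <= rho.
Proof. exact: (usum_em_cont c_sum (fun x y => fourier_inversion x y V_smooth V_per)). Qed.

Let A0 : 0 <= A.
Proof. by have := c_sum (L := [::]) isT; rewrite big_nil. Qed.

Lemma Theta_bound v N x y e : Cmod (Theta v c t N x y e) <= A * Rabs t.
Proof.
apply: Rle_trans (Cmod_csum _ _) _.
apply: (Rle_trans _ (\sumR_(m <- modes v N) (Rabs t * Cmod (c m)))).
  apply: rsum_le => m; rewrite !Cmod_mult Cmod_cis Rmult_1_r Rmult_comm.
  apply: Rmult_le_compat_r; first exact: Cmod_ge_0.
  apply: Rle_trans (CInt_bound (B := 1) (Ccont_cis _ _) _) _; last by rewrite Rminus_0_r; lra.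
  by move=> s _; rewrite Cmod_cis; lra.
rewrite -rsum_scal_l Rmult_comm; apply: Rmult_le_compat_r; first exact: Rabs_pos.
by apply: c_sum; apply: filter_uniq; apply: box_uniq.
Qed.

(** Taylor remainder of the exponential plus the replacement of the exact phase by [Theta]. For rho
    <= 1 both phases are bounded by X = (A+1)|t|. *)
Definition phase_err (rho : R) (n : nat) : R := X ^ n.+1 / INR (fact n.+1) + rho * Rabs t * exp X.

Let cis_Pn n x : Rabs x <= X -> Cmod (cis x - Pn n (Ci * RtoC x))%C <= X ^ n.+1 / INR (fact n.+1).
Proof.
move=> hx; apply: Rle_trans (cis_taylor n x) _.
apply: Rmult_le_compat_r; first exact: Rlt_le (inv_fact_pos _).
by apply: pow_incr; split => //; apply: Rabs_pos.
Qed.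

Lemma cis_th_approx v N n rho x y e : 0 < Lv v -> 0 <= rho <= 1 ->
  (forall x y, Cmod (RtoC (V x y) - \sumC_(m <- box N) (c m * cis (phase m x y)))%C <= rho) ->
  Cmod (cis (th_int v V t x y e) - Pn n (Ci * Theta v c t N x y e))%C <= phase_err rho n.
Proof.
move=> L0 r0 H.
have Vc : cont2 V := dR2_cont2 [::] V_smooth.
have h1 := Theta_close L0 Vc V_approx t x y e H.
have h2 := Theta_bound v N x y e.
have t0 := Rabs_pos t.
have hr : rho * Rabs t <= Rabs t by nra.
set th := th_int _ _ _ _ _ _ in h1 *; set Th := Theta _ _ _ _ _ _ _ in h1 h2 *.
have hX : Rabs th <= X.
  rewrite -Cmod_R; have -> : RtoC th = (RtoC th - Th + Th)%C by ring.
  by apply: Rle_trans (Cmod_triangle _ _) _; rewrite /X; lra.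
have -> : (cis th - Pn n (Ci * Th) = (cis th - Pn n (Ci * RtoC th)) + (Pn n (Ci * RtoC th) - Pn n (Ci * Th)))%C by ring.
apply: Rle_trans (Cmod_triangle _ _) _; apply: Rplus_le_compat; first exact: cis_Pn.
apply: Rle_trans (@Pn_lipschitz n (Ci * RtoC th)%C (Ci * Th)%C X _ _) _.
- by rewrite Cmod_mult Cmod_Ci Rmult_1_l Cmod_R.
- by rewrite Cmod_mult Cmod_Ci Rmult_1_l /X; lra.
apply: Rmult_le_compat_r; first exact: Rlt_le (exp_pos _).
have -> : (Ci * RtoC th - Ci * Th = Ci * (RtoC th - Th))%C by ring.
by rewrite Cmod_mult Cmod_Ci Rmult_1_l.
Qed.

Lemma cis_mean_approx n rho : 0 <= rho ->
  Cmod (cis (t * torus_int V) - Pn n (Ci * (RtoC t * c (0%ZZ, 0%ZZ))))%C <= phase_err rho n.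
Proof.
move=> r0; rewrite /c fourier2_0 -RtoC_mult.
have t0 := Rabs_pos t.
have hc : Rabs (torus_int V) <= A.
  rewrite -Cmod_R -fourier2_0; have := c_sum (L := [:: (0%ZZ, 0%ZZ)]) isT.
  by rewrite big_seq1.
apply: Rle_trans (cis_Pn n _) _; first by rewrite Rabs_mult /X; nra.
rewrite /phase_err; have := exp_pos X; have : 0 <= rho * Rabs t by apply: Rmult_le_pos.
by nra.
Qed.

Lemma phase_err_small e : 0 < e -> exists2 rho, 0 < rho <= 1 &
  exists N, forall n, (N <= n)%N -> phase_err rho n <= e.
Proof.
move=> e0; have t0 := Rabs_pos t; have eX := exp_pos X.
pose D := 1 + 2 * (Rabs t * exp X) / e.
have tX : 0 <= Rabs t * exp X by apply: Rmult_le_pos; lra.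
have tXe : 0 <= 2 * (Rabs t * exp X) / e.
  by apply: Rmult_le_pos; [lra | apply: Rlt_le; apply: Rinv_0_lt_compat].
have D1 : 1 <= D by rewrite /D; lra.
have e2 : 0 < e / 2 by lra.
have [N HN] := pow_fact_small X e2.
exists (/ D).
  split; first by apply: Rinv_0_lt_compat; lra.
  by rewrite -Rinv_1; apply: Rinv_le_contravar; lra.
exists N => n Hn; rewrite /phase_err.
have h1 := HN n.+1 (leq_trans Hn (leqnSn n)).
have h2 := Rle_abs (X ^ n.+1 / INR (fact n.+1)).
have h3 : / D * Rabs t * exp X <= e / 2.
  apply: (Rmult_le_reg_l D); first lra.
  have -> : D * (/ D * Rabs t * exp X) = Rabs t * exp X by field; lra.
  have -> : D * (e / 2) = e / 2 + Rabs t * exp X by rewrite /D; field; lra.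
  lra.
lra.
Qed.

(** The approximation of the limit integrand, applied with n growing, also supplies its
    measurability. *)
Lemma Cmb_cis_th v : 0 < Lv v -> Cmb (fun x y e => cis (th_int v V t x y e)).
Proof.
move=> L0.
apply: (@Cmb_lim (fun n x y e => Pn n (Ci * Theta v c t n x y e))%C _ 1).
- move=> n; apply: Cmb_big => k; apply: Cmb_mult; last exact: Cmb_const.
  by apply: Cmb_Cpow; apply: Cmb_Theta.
- move=> x y e; apply: eventually_CmodP => d d0.
  have [rho [r0 r1] [N1 HN1]] := phase_err_small d0.
  have [N2 HN2] := V_approx r0.
  exists (maxn N1 N2) => n Hn.
  have -> : forall a b : C, Cmod (a - b)%C = Cmod (b - a)%C.
    by move=> a b; rewrite -Cmod_opp; congr Cmod; ring.
  apply: Rle_trans (cis_th_approx n x y e L0 _ (HN2 n _)) (HN1 n _).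
  + by split; [apply: Rlt_le|].
  + by apply: leq_trans Hn; apply: leq_maxr.
  + by apply: leq_trans Hn; apply: leq_maxl.
- by move=> x y e; rewrite Cmod_cis; lra.
Qed.
End PhaseApprox.

Section Main.
Variables (V : R -> R -> R) (eps : R -> R) (psi : R -> Z2 -> C) (F : Z2 -> measure PT R) (t A : R).
Hypothesis V_smooth : smooth2 V.
Hypothesis V_per : periodic2 V.
Let c := fourier2 V.
Hypothesis c_sum : forall L, uniq L -> \sumR_(m <- L) Cmod (c m) <= A.
Hypothesis eps_pos : forall h, 0 < h <= 1 -> 0 < eps h.
Hypothesis eps_low : filterlim (fun h => eps h / h ^ 2) (at_right 0) (Rbar_locally p_infty).
Hypothesis eps_up : filterlim (fun h => eps h / h) (at_right 0) (locally 0).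
Hypothesis psi_unit : forall h, 0 < h <= 1 -> is_l2 (psi h) /\ nrm2 (psi h) = 1.
Hypothesis psi_low : forall eta, 0 < eta -> exists delta0, 0 < delta0 /\
            forall delta, 0 < delta < delta0 -> exists h0, 0 < h0 /\
              forall h, 0 < h < h0 -> h <= 1 -> sqrt (nrm2 (lowp delta h (psi h))) < eta.
Hypothesis HF : forall v, prim v = true -> (F v setT < +oo)%E /\
   forall a, test_symbol a ->
     filterlim (fun h => op_quad h (eps h) v a (psi h)) (at_right 0) (locally (RtoC (mint (F v) a))).

Let th h := 2 * PI ^ 2 * h ^ 2 / eps h.
Let Ffin v (Hv : prim v = true) := proj1 (HF Hv).
Let A0 : 0 <= A.
Proof. by have := c_sum (L := [::]) isT; rewrite big_nil. Qed.

Lemma word_lim N n w : w \in words (box N) n -> hlim (fun h => wordQ (th h) t (psi h) w) (LimW t F N w).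
Proof.
move=> Hw; have wB : {subset w <= box N} := all_words Hw.
case: (boolP (all zmode w)) => [Hz|/allPn [m mw mz]].
  rewrite LimW_zero //; apply: zero_word_lim => // m mw.
  exact: (eqP (allP Hz m mw)).
have m0 : m <> (0%ZZ, 0%ZZ) by apply/eqP.
have [v [pv cv vB]] := prim_ex m0 (wB m mw).
have nz : all zmode w = false by apply/negbTE/allPn; exists m.
have only v' : v' \in prims N -> all (par v') w -> v' = v.
  move=> /mem_prims pv' /allP /(_ m mw) /parP cv'.
  apply: prim_inj => //.
  have n1 := knorm2_ge1 m0.
  (* This identity shows that two vectors parallel to the same nonzero m are parallel to each other;
     thus a single nonzero letter fixes the direction of the word. *)
  have id : cross v' v * knorm2 m = cross m v * dot m v' - cross m v' * dot m v.
    by rewrite /cross /knorm2 /dot; ring.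
  by rewrite cv cv' in id; nra.
have vP : v \in prims N by rewrite mem_filter pv.
rewrite /LimW nz Cplus_0_l.
case: (boolP (all (par v) w)) => [Hv|/allPn [m' mw' Hm']].
  have -> : \sumC_(v' <- prims N) (if all (par v') w then Fint (F v') (gword t v' w) else RtoC 0) = Fint (F v) (gword t v w).
    rewrite (bigD1_seq v) ?prims_uniq //= Hv.
    rewrite big1_seq ?Cplus_0_r // => v' /andP [ne v'P]; case: ifP => // Hv'.
    by move: ne; rewrite (only _ v'P Hv') eqxx.
  apply: par_word_lim => //.
  - exact: prim_Lv.
  - exact: Ffin.
  - by have [] := HF pv.
  - by move=> p pw; apply/parP; apply: (allP Hv).
  - by exists m.
have -> : \sumC_(v' <- prims N) (if all (par v') w then Fint (F v') (gword t v' w) else RtoC 0) = RtoC 0.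
  rewrite big1_seq // => v' v'P; case: ifP => // Hv'; have E := only _ v'P Hv'.
  by move: Hm'; rewrite -E (allP Hv' _ mw').
apply: (mixed_word_lim eps_pos eps_up psi_unit psi_low t mw mw') => cmm.
case/parP: Hm'; have n1 := knorm2_ge1 m0.
have id : cross m' v * knorm2 m = cross m v * dot m m' - cross m m' * dot m v.
  by rewrite /cross /knorm2 /dot; ring.
by rewrite cv cmm in id; nra.
Qed.

Definition massN (N : nat) : R := \sumR_(v <- prims N) mass (F v).
Definition cisF (v : Z2) : C := Fint (F v) (fun x y e => cis (th_int v V t x y e)).
Definition TN (N : nat) : C := \sumC_(v <- prims N) cisF v.

Lemma massN_le1 N : massN N <= 1.
Proof.
apply: (mass_sum eps_pos eps_up psi_unit psi_low) => //.
- exact: prims_uniq.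
- by move=> v /mem_prims; apply: prim_Lv.
- by move=> v v' /mem_prims pv /mem_prims pv' ne Hc; apply: ne; apply: prim_inj.
- by move=> v /mem_prims; apply: HF.
Qed.

Lemma massN_ge0 N : 0 <= massN N.
Proof. by apply: rsum_ge0 => v; apply: mass_ge0. Qed.

(** One integer N truncates the modes, the directions and the exponential series, so that a single
    limit in N removes all three. *)
Definition LN (N : nat) : C :=
  (Pn N (Ci * (RtoC t * c (0%ZZ, 0%ZZ))) * (RtoC 1 - RtoC (massN N))
   + \sumC_(v <- prims N) Fint (F v) (fun x y e => Pn N (Ci * Theta v c t N x y e)))%C.

Lemma words_lim N : hlim (fun h => \sumC_(n' <- seq.iota 0 N.+1) (\sumC_(w <- words (box N) n') (coefw c w * wordQ (th h) t (psi h) w)))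
  (LN N).
Proof.
have -> : LN N = \sumC_(n' <- seq.iota 0 N.+1) (\sumC_(w <- words (box N) n') (coefw c w * LimW t F N w)).
  rewrite /LN /Pn /massN RtoC_rsum.
  rewrite [RHS](eq_bigr _ (fun n _ => LimW_sum V t N Ffin n)) big_split /=; congr Cplus.
    by rewrite Cmult_comm csum_scal_l; apply: eq_bigr => n _; rewrite Cmult_comm.
  rewrite exchange_big /=; apply: eq_big_seq => v vP.
  rewrite -(Fint_big (Ffin (mem_prims vP))) // => n.
  by apply: Cmb_mult; [apply: Cmb_Cpow; apply: Cmb_Theta | exact: Cmb_const].
apply: hlim_big => n; apply: hlim_big_in => w Hw; apply: hlim_scal; exact: word_lim Hw.
Qed.

(** One error comes from the mean-value term, whose weight 1 - massN lies in [0, 1]; two come from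
    the integrals, by the factor 2 of [Fint_bound] and total mass at most 1. The inequality massN <=
    1 is used in both. *)
Lemma LN_close N rho : 0 <= rho <= 1 ->
  (forall x y, Cmod (RtoC (V x y) - \sumC_(m <- box N) (c m * cis (phase m x y)))%C <= rho) ->
  Cmod (LN N - (cis (t * torus_int V) * (RtoC 1 - RtoC (massN N)) + TN N))%C <= 3 * phase_err t A rho N.
Proof.
move=> r01 H; have m0 := massN_ge0 N; have m1 := massN_le1 N.
set D := phase_err t A rho N.
have h1 := @cis_mean_approx V t A c_sum N rho (proj1 r01).
have D0 : 0 <= D by apply: Rle_trans h1; apply: Cmod_ge_0.
rewrite -/c -/D in h1.
set P0 := Pn N _ in h1; set E0 := cis _ in h1.
have h2 : Cmod (\sumC_(v <- prims N) Fint (F v) (fun x y e => Pn N (Ci * Theta v c t N x y e)) - TN N)%C <= 2 * D * massN N.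
  have -> : (\sumC_(v <- prims N) Fint (F v) (fun x y e => Pn N (Ci * Theta v c t N x y e)) - TN N)%C =
     \sumC_(v <- prims N) (if prim v then Fint (F v) (fun x y e => Pn N (Ci * Theta v c t N x y e) + RtoC (-1) * cis (th_int v V t x y e)) else RtoC 0)%C.
    have -> : forall a b : C, (a - b = a + RtoC (-1) * b)%C by move=> a b; ring.
    rewrite /TN csum_scal_l -big_split /=; apply: eq_big_seq => v vP.
    have pv := mem_prims vP; have Fv := Ffin pv; have Lp := prim_Lv pv.
    have cth := Cmb_cis_th t V_smooth V_per c_sum Lp.
    rewrite pv Fint_plus //; first by rewrite Fint_scal.
    - apply: Cmb_big => k; apply: Cmb_mult; last exact: Cmb_const.
      by apply: Cmb_Cpow; apply: Cmb_Theta.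
    - by apply: Cmb_mult => //; exact: Cmb_const.
  apply: Rle_trans (Cmod_csum _ _) _; rewrite /massN rsum_scal_l; apply: rsum_le => v.
  case: (boolP (prim v)) => pv; last first.
    by rewrite Cmod_0; have := mass_ge0 (F v); nra.
  have Fv := Ffin pv; have Lp := prim_Lv pv.
  have cth := Cmb_cis_th t V_smooth V_per c_sum Lp.
  apply: Fint_bound => //.
    apply: Cmb_plus; last by apply: Cmb_mult => //; exact: Cmb_const.
    apply: Cmb_big => k; apply: Cmb_mult; last exact: Cmb_const.
    by apply: Cmb_Cpow; apply: Cmb_Theta.
  move=> x y e; rewrite -Cmod_opp.
  set a := Pn _ _; set b := cis _; have -> : (- (a + RtoC (-1) * b) = b - a)%C by ring.
  exact: (@cis_th_approx V t A V_smooth V_per c_sum v N N rho x y e Lp r01 H).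
rewrite /LN -/P0 -/E0.
set U := \sumC_(v <- prims N) _ in h2 *.
have -> : (P0 * (RtoC 1 - RtoC (massN N)) + U - (E0 * (RtoC 1 - RtoC (massN N)) + TN N) =
   - ((E0 - P0) * (RtoC (1 - massN N))) + (U - TN N))%C by rewrite RtoC_minus; ring.
apply: Rle_trans (Cmod_triangle _ _) _; rewrite Cmod_opp Cmod_mult Cmod_R Rabs_pos_eq; last lra.
have h3 : Cmod (E0 - P0)%C * (1 - massN N) <= D * 1 by apply: Rmult_le_compat => //; [apply: Cmod_ge_0 | lra | lra].
nra.
Qed.

Lemma theta_small e : 0 < e -> at_right 0 (fun h => 0 <= th h <= e).
Proof.
move=> e0; have pi0 := PI_RGT_0; have p2 : 0 < PI ^ 2 by nra.
have H : at_right 0 (fun h => 2 * PI ^ 2 / e < eps h / h ^ 2).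
  have HP : Rbar_locally p_infty (fun y => 2 * PI ^ 2 / e < y) by exists (2 * PI ^ 2 / e).
  exact: (eps_low HP).
apply: filter_imp (filter_and _ _ H at_right_unit) => h [h1 hh].
have ep := eps_pos hh; have h2 : 0 < h ^ 2 by nra.
have q0 : 0 < 2 * PI ^ 2 / e by apply: Rdiv_lt_0_compat; lra.
have -> : th h = 2 * PI ^ 2 / (eps h / h ^ 2) by rewrite /th; field; lra.
have -> : e = 2 * PI ^ 2 / (2 * PI ^ 2 / e) by field; lra.
split.
  by apply: Rlt_le; apply: Rdiv_lt_0_compat; lra.
by apply: Rmult_le_compat_l; [lra | apply: Rinv_le_contravar; lra].
Qed.

Variables (u0 ue : R -> R -> Z2 -> C).
Hypothesis u0_sol : forall h, 0 < h <= 1 -> SchrSol h (fun _ _ => 0) (psi h) (u0 h).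
Hypothesis ue_sol : forall h, 0 < h <= 1 -> SchrSol h (fun x y => eps h * V x y) (psi h) (ue h).

Let ov h := ip (ue h (t * (h / eps h))) (u0 h (t * (h / eps h))).

(** The tail and the factorial term are small for N large, independently of h. The constant [Cst]
    grows with N, so the phase error theta Cst is made small only once N is fixed, by taking h
    small. *)
Lemma overlap_words e : 0 < e -> exists N0, forall N, (N0 <= N)%N ->
  at_right 0 (fun h => Cmod (ov h - \sumC_(n' <- seq.iota 0 N.+1)
     (\sumC_(w <- words (box N) n') (coefw c w * wordQ (th h) t (psi h) w)))%C <= e).
Proof.
move=> e0; set T := Rabs t; have T0 : 0 <= T := Rabs_pos t.
set G := exp (A * T); have G0 : 0 < G := exp_pos _.
(* The bound 1/2 is what the norm bootstrap needs, and e/(2G) makes the final error T err 2G at most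
   e. [D] is chosen so that three errors of size r cost T(2rG + Ar) = (D-1) r <= m. *)
pose m := Rmin (/ 2) (e / (2 * G)).
have m0 : 0 < m by apply: Rmin_pos; [lra | apply: Rdiv_lt_0_compat; lra].
pose D := 1 + T * (2 * G + A).
have D1 : 1 <= D.
  by rewrite /D; have : 0 <= T * (2 * G + A) by [apply: Rmult_le_pos; lra]; lra.
pose r := m / D; have r0 : 0 < r by apply: Rdiv_lt_0_compat; lra.
have rm : T * ((r + r) * G + A * r) <= m.
  have -> : T * ((r + r) * G + A * r) = (D - 1) * r by rewrite /D; ring.
  have -> : m = D * r by rewrite /r; field; lra.
  by nra.
have [N1 HN1] := usum_tail (fun k => Cmod_ge_0 (c k)) c_sum r0.
have [N2 HN2] := pow_fact_small (A * T) r0.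
exists (maxn N1 N2) => N HN.
have tail := HN1 N (leq_trans (leq_maxl _ _) HN).
have fs := HN2 N (leq_trans (leq_maxr _ _) HN).
have [Cst [C0 HC]] : exists Cst, 0 <= Cst /\ forall n' v m, (n' < N)%N -> v \in words (box N) n' -> m \in box N ->
   Rabs (2 * dot (wsum v) m + knorm2 m) <= Cst.
  pose l := flatten [seq [seq (v, p) | v <- words (box N) n', p <- box N] | n' <- seq.iota 0 N].
  have [B [B0 HB]] := finite_bound l (fun vp => Rabs (2 * dot (wsum vp.1) vp.2 + knorm2 vp.2)).
  exists B; split => // n' v p n'N vw pB; apply: (HB (v, p)).
  apply/flatten_mapP; exists n'; first by rewrite mem_iota.
  by apply: allpairs_f.
have d0 : 0 < r / (1 + A * T * Cst).
  apply: Rdiv_lt_0_compat => //.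
  have : 0 <= A * T * Cst by [apply: Rmult_le_pos => //; apply: Rmult_le_pos]; lra.
apply: filter_imp (filter_and _ _ (theta_small d0) at_right_unit) => h [[th0 thd] hh].
have ep := eps_pos hh; have [pl pn] := psi_unit hh; have h0 : 0 < h by lra.
have ATC : 0 <= A * T * Cst by apply: Rmult_le_pos => //; apply: Rmult_le_pos.
have thC : A * (th h * T * Cst) <= r.
  have -> : A * (th h * T * Cst) = A * T * Cst * th h by ring.
  have : A * T * Cst * th h <= A * T * Cst * (r / (1 + A * T * Cst)) by apply: Rmult_le_compat_l.
  have -> : A * T * Cst * (r / (1 + A * T * Cst)) = r - r / (1 + A * T * Cst) by field; lra.
  lra.
have errb : T * dyson_err A (th h) T Cst r N <= m.
  apply: Rle_trans rm; apply: Rmult_le_compat_l => //; rewrite /dyson_err -/G.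
  have := Rle_abs ((A * T) ^ N / INR (fact N)) => ab.
  apply: Rplus_le_compat; first by apply: Rmult_le_compat_r; lra.
  by apply: Rmult_le_compat_l; lra.
have m2 : m <= / 2 := Rmin_l _ _.
have m3 : m <= e / (2 * G) := Rmin_r _ _.
have := @overlap_dyson V h (eps h) t T A r Cst N N (psi h) (ue h) (u0 h) V_smooth V_per h0 ep pl pn
  (ue_sol hh) (u0_sol hh) (Rle_refl _) c_sum tail C0 (Rlt_le _ _ r0) HC (Rle_trans _ _ _ errb m2).
rewrite -/(th h) -/G -/c -/(ov h) => H; apply: Rle_trans H _.
have -> : e = e / (2 * G) * (2 * G) by field; lra.
rewrite -Rmult_assoc; apply: Rmult_le_compat_r; lra.
Qed.

Lemma overlap_limit (S : R) (T : C) : is_lim_seq massN S -> filterlim TN eventually (locally T) ->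
  filterlim ov (at_right 0) (locally (cis (t * torus_int V) * (RtoC 1 - RtoC S) + T)%C).
Proof.
move=> HS HT; apply/filterlim_CmodP => e e0.
have e8 : 0 < e / 8 by lra.
have [N1 HN1] := overlap_words e8.
(* The value e/24 becomes e/8 after the factor 3 of [LN_close]; five errors of size e/8 are added in
   the end. *)
have [rho [r0 r1] [N2 HN2]] := @phase_err_small t A (e / 24) ltac:(lra).
have [N3 HN3] := V_approx V_smooth V_per c_sum r0.
have [N4 HN4] := proj2 (is_lim_seq_spec massN S) HS (mkposreal _ e8).
have [N5 HN5] := proj1 (filterlim_CmodP _ _) HT _ e8.
pose N := maxn (maxn N1 N2) (maxn N3 (maxn N4 N5)).
have k1 : (N1 <= N)%N by rewrite /N; lia.
have k2 : (N2 <= N)%N by rewrite /N; lia.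
have k3 : (N3 <= N)%N by rewrite /N; lia.
have k4 : (N4 <= N)%coq_nat by rewrite /N; lia.
have k5 : (N5 <= N)%coq_nat by rewrite /N; lia.
have a3 := LN_close (conj (Rlt_le _ _ r0) r1) (HN3 N k3).
have a4 := HN4 N k4; rewrite /= in a4.
have a5 := HN5 N k5.
have a2 := HN2 N k2.
apply: filter_imp (filter_and _ _ (HN1 N k1) (words_lim N e8)) => h [b1 b2].
set W := \sumC_(n' <- _) _ in b1 b2.
set E0 := cis (t * torus_int V).
have -> : (ov h - (E0 * (RtoC 1 - RtoC S) + T) = (ov h - W) + ((W - LN N) +
   ((LN N - (E0 * (RtoC 1 - RtoC (massN N)) + TN N)) + ((TN N - T) + - (E0 * RtoC (massN N - S))))))%C.
  by rewrite RtoC_minus; ring.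
apply: Rle_lt_trans (Cmod_triangle _ _) _.
apply: Rle_lt_trans (Rplus_le_compat_l _ _ _ (Cmod_triangle _ _)) _.
apply: Rle_lt_trans (Rplus_le_compat_l _ _ _ (Rplus_le_compat_l _ _ _ (Cmod_triangle _ _))) _.
apply: Rle_lt_trans (Rplus_le_compat_l _ _ _ (Rplus_le_compat_l _ _ _ (Rplus_le_compat_l _ _ _ (Cmod_triangle _ _)))) _.
rewrite Cmod_opp (Cmod_mult E0) Cmod_cis Cmod_R Rmult_1_l.
by rewrite -/E0 in a3; lra.
Qed.
End Main.

Theorem theorem2p1
  (V : R -> R -> R)
  (eps : R -> R)
  (psi : R -> Z2 -> C)
  (F : Z2 -> measure PT R)
  (u0 ue : R -> R -> Z2 -> C)
  (HV : smooth2 V /\ periodic2 V)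
  (Heps_pos : forall h, 0 < h <= 1 -> 0 < eps h)
  (Heps_low : filterlim (fun h => eps h / h ^ 2) (at_right 0) (Rbar_locally p_infty))
  (Heps_up : filterlim (fun h => eps h / h) (at_right 0) (locally 0))
  (Hpsi : forall h, 0 < h <= 1 -> is_l2 (psi h) /\ nrm2 (psi h) = 1)
  (Hlow : forall eta, 0 < eta -> exists delta0, 0 < delta0 /\
            forall delta, 0 < delta < delta0 -> exists h0, 0 < h0 /\
              forall h, 0 < h < h0 -> h <= 1 ->
                sqrt (nrm2 (fun k => if Rle_dec (4 * PI ^ 2 * h ^ 2 * knorm2 k) delta
                                     then psi h k else RtoC 0)) < eta)
  (Hhigh : forall eta, 0 < eta -> exists R0,
            forall Rr, R0 < Rr -> exists h0, 0 < h0 /\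
              forall h, 0 < h < h0 -> h <= 1 ->
                sqrt (nrm2 (fun k => if Rle_dec Rr (4 * PI ^ 2 * h ^ 2 * knorm2 k)
                                     then psi h k else RtoC 0)) < eta)
  (HF : forall v, prim v = true ->
          torus_measure (F v) /\
          forall a, test_symbol a ->
            filterlim (fun h => op_quad h (eps h) v a (psi h)) (at_right 0)
              (locally (RtoC (mint (F v) a))))
  (Hu0 : forall h, 0 < h <= 1 -> SchrSol h (fun _ _ => 0) (psi h) (u0 h))
  (Hue : forall h, 0 < h <= 1 -> SchrSol h (fun x y => eps h * V x y) (psi h) (ue h)) :
  forall t : R,
    exists S : R, exists T : C,
      is_lim_seq (sqsumR (fun v => if prim v then mass (F v) else 0)) S
      /\ filterlim
           (sqsumC (fun v => if prim v then
               let th := fun x y e =>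
                 RInt (fun s => avgI v V (x + s * e * IZR v.1 / Lv v)
                                         (y + s * e * IZR v.2 / Lv v)) 0 t in
               (mint (F v) (fun x y e => Rtrigo_def.cos (th x y e)),
                mint (F v) (fun x y e => Rtrigo_def.sin (th x y e)))
             else RtoC 0))
           eventually (locally T)
      /\ filterlim (fun h => ip (ue h (t * (h / eps h))) (u0 h (t * (h / eps h))))
           (at_right 0)
           (locally (cis (t * torus_int V) * (RtoC 1 - RtoC S) + T)%C).
Proof.
move=> t.
have [V_smooth V_per] := HV.
have [A HA] := fhat_summable V_smooth V_per.
have c_sum L : uniq L -> \sumR_(m <- L) Cmod (fourier2 V m) <= A.
  move=> uL; apply: Rle_trans (HA L uL); apply: rsum_le => m.
  by rewrite (fourier2E m (dR2_cont2 [::] V_smooth)); apply: Rle_refl.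
have F_lim v : prim v = true -> (F v setT < +oo)%E /\ forall a, test_symbol a ->
    filterlim (fun h => op_quad h (eps h) v a (psi h)) (at_right 0) (locally (RtoC (mint (F v) a))).
  by move=> /HF [[]].
have mass_eq N : sqsumR (fun v => if prim v then mass (F v) else 0) N = massN F N.
  by rewrite sqsumRE /massN big_filter [RHS]big_mkcond.
have cisF_eq N : sqsumC (fun v => if prim v then cisF V F t v else RtoC 0) N = TN V F t N.
  by rewrite sqsumCE /TN big_filter [RHS]big_mkcond.
have m1 := massN_le1 Heps_pos Heps_up Hpsi Hlow F_lim.
(* The box sums of masses increase and never exceed 1, so they converge. *)
have [S HS] : ex_finite_lim_seq (massN F).
  apply: (@ex_finite_lim_seq_incr _ 1) => // N.
  rewrite -!mass_eq !sqsumRE; apply: rsum_subset; [ | exact: box_uniq | exact: box_subset].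
  by move=> v; case: ifP => _; [exact: mass_ge0 | exact: Rle_refl].
(* Each oscillatory integral has modulus at most twice the mass of its measure, so the series is
   dominated by 2 times the series of masses. *)
have [||T HT] := @usum_dominated (fun v => if prim v then cisF V F t v else RtoC 0)
    (fun v => 2 * (if prim v then mass (F v) else 0)) 2.
- move=> v; case: (boolP (prim v)) => pv; last by rewrite Cmod_0; lra.
  have [Fv _] := F_lim v pv.
  have := Fint_bound Fv (B := 1) (Cmb_cis_th t V_smooth V_per c_sum (prim_Lv pv)).
  rewrite Rmult_1_r; apply => x y e; rewrite Cmod_cis; exact: Rle_refl.
- by move=> N; rewrite -rsum_scal_l -sqsumRE mass_eq; have := m1 N; lra.
have {}HT := usum_sqsum HT.
exists S, T; split; [ | split].
- by apply: is_lim_seq_ext HS => N; rewrite mass_eq.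
- exact: HT.
- apply: (overlap_limit V_smooth V_per c_sum Heps_pos Heps_low Heps_up Hpsi Hlow F_lim Hu0 Hue HS).
  by apply: filterlim_ext HT.
Qed.
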